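(* Let $X$ be a complex Banach space and $z\in S_{X''}$. In the spectrum of $\mathcal{A}_u(B_X)$ the following hold. (a) If $z\in\mathrm{Ext}_{\mathbb{C}}(\overline{B}_{X''})$, then $\mathcal{GP}(\delta_z)$ does not intersect any fiber other than $\mathcal{M}_z$. Indeed, for any $w\in S_{X''}$ with $w\neq z$, any $\varphi\in\mathcal{M}_z$ and any $\psi\in\mathcal{M}_w$, one has $\mathcal{GP}(\varphi)\ne\mathcal{GP}(\psi)$. (b) If $z\notin\mathrm{Ext}_{\mathbb{C}}(\overline{B}_{X''})$, then $\mathcal{GP}(\delta_z)$ intersects a disk of fibers: there is $u\in X''$, $u\neq0$, such that $\{\delta_{z+\lambda u}:\lambda\in\mathbb{C},\ |\lambda|<1\}\subset\mathcal{GP}(\delta_z)$.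
   Context: For a complex Banach space $X$, $B_X$ is its open unit ball, $X'$ and $X''$ its dual and bidual, and $S_{X''}$, $\overline{B}_{X''}$ the unit sphere and closed unit ball of $X''$. $\mathcal{A}=\mathcal{A}_u(B_X)$ is the complex Banach algebra of all holomorphic functions $f\colon B_X\to\mathbb{C}$ that are uniformly continuous with respect to the norm of $X$, with the norm $\|f\|=\sup\{|f(x)|:\|x\|<1\}$. The spectrum $\mathcal{M}(\mathcal{A})$ is the set of nonzero algebra homomorphisms $\varphi\colon\mathcal{A}\to\mathbb{C}$. The (restrictions to $B_X$ of the) elements of $X'$ belong to $\mathcal{A}$, and $\varphi|_{X'}\in\overline{B}_{X''}$ for each $\varphi\in\mathcal{M}(\mathcal{A})$; the fiber over $z\in\overline{B}_{X''}$ is $\mathcal{M}_z=\{\varphi\in\mathcal{M}(\mathcal{A}):\varphi|_{X'}=z\}$. Each $f\in\mathcal{A}_u(B_X)$ has a canonical (Aron–Berner) extension $\tilde f\in\mathcal{A}_u(B_{X''})$: a continuous $m$-homogeneous polynomial $P$ on $X$ with associated symmetric $m$-linear form $A$ is extended by $\tilde P(z)=\tilde A(z,\dots,z)$, where $\tilde A(z_1,\dots,z_m)=\lim_{\alpha_1}\cdots\lim_{\alpha_m}A(x_{\alpha_1},\dots,x_{\alpha_m})$ for nets $(x_{\alpha_j})$ in $X$ converging weak-star to $z_j\in X''$; and $\tilde f=\sum_m\tilde P_m$ on $B_{X''}$ if $f=\sum_mP_m$ is the Taylor series at $0$. By uniform continuity $\tilde f$ is defined on $\overline{B}_{X''}$,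 the map $f\mapsto\tilde f$ is a Banach algebra homomorphism, and $\delta_z\in\mathcal{M}_z$ denotes the homomorphism $\delta_z(f)=\tilde f(z)$, $z\in\overline{B}_{X''}$. For $\varphi,\psi\in\mathcal{M}(\mathcal{A})$ put $\|\varphi-\psi\|=\sup\{|\varphi(f)-\psi(f)|:f\in\mathcal{A},\ \|f\|\le1\}$. The relation $\|\varphi-\psi\|<2$ is an equivalence relation, whose classes are the Gleason parts; $\mathcal{GP}(\varphi)=\{\psi\in\mathcal{M}(\mathcal{A}):\|\varphi-\psi\|<2\}$. For a convex set $C$ in a complex Banach space, $z\in C$ is a complex extreme point of $C$ (written $z\in\mathrm{Ext}_{\mathbb{C}}(C)$) if having $z+\lambda y\in C$ for all $\lambda\in\mathbb{C}$ with $|\lambda|\le1$ implies $y=0$. *)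

(* Defs.v *)
(* Built on MathComp-Analysis; the complex numbers are R[i] (mathcomp-real-closed)
   over an arbitrary R : realType. *)
From HB Require Import structures.
From mathcomp Require Import all_boot all_order all_algebra all_fingroup.
From mathcomp Require Import all_classical reals ereal topology normedtype.
From mathcomp Require Import sequences derive landau.
From mathcomp Require Import complex.

Set Implicit Arguments.
Unset Strict Implicit.
Unset Printing Implicit Defensive.

Import Order.TTheory GRing.Theory Num.Theory.
Import numFieldNormedType.Exports.

Local Open Scope classical_set_scope.
Local Open Scope ring_scope.
Local Open Scope complex_scope.

(* R[i] carries no topology in the libraries; give it the one of R[i]^o, as
   numFieldNormedType does for abstract fields. *)
HB.instance Definition _ (R : realType) := NormedModule.copy R[i] R[i]^o.

(* On R[i] and on a normedModType R[i], `|x| has values in R[i]; the order of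
   R[i] compares only numbers with the same imaginary part, so `|x| < e forces
   e to be real.  For suprema we use the real-valued modulus. *)
Definition modulus (R : realType) (c : R[i]) : R := ComplexField.Normc.normc c.

Section Modulus.
Variable R : realType.

Lemma modulusE (c : R[i]) : `|c| = (modulus c)%:C.
Proof. by []. Qed.

Lemma modulus_ge0 (c : R[i]) : 0 <= modulus c.
Proof. by case: c => a b; exact: sqrtr_ge0. Qed.

Lemma modulusD (c d : R[i]) : modulus (c + d) <= modulus c + modulus d.
Proof. by rewrite -lecR rmorphD/= -!modulusE; exact: ler_normD. Qed.

Lemma modulusM (c d : R[i]) : modulus (c * d) = modulus c * modulus d.
Proof. exact: ComplexField.Normc.normcM. Qed.

Lemma gt0_RRe (e : R[i]) : 0 < e -> (complex.Re e)%:C = e.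
Proof. by move=> e0; apply/RRe_real/gtr0_real. Qed.

End Modulus.

Section Dual.
Variables (R : realType) (X : normedModType R[i]).

Definition dual_pred : {pred (X -> R[i])} :=
  mem [set g : X -> R[i] | linear g /\ continuous g].

Record dual := Dual { dual_val :> X -> R[i] ; _ : dual_val \in dual_pred }.

HB.instance Definition _ := [isSub for dual_val].
HB.instance Definition _ := [Choice of dual by <:].

Lemma dual_submod_closed : submod_closed dual_pred.
Proof.
split.
  rewrite inE; split=> [a x y|x]; last exact: cvg_cst.
  by rewrite /= scaler0 addr0.
move=> a f g /set_mem[fl fc] /set_mem[gl gc]; apply/mem_set; split => [b x y|x].
  have E t : (a *: f + g) t = a *: f t + g t by [].
  by rewrite !E fl gl !scalerDr !scalerA mulrC addrACA.
by apply: cvgD; [apply: cvgZ; [exact: cvg_cst|exact: fc]|exact: gc].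
Qed.

HB.instance Definition _ := GRing.isSubmodClosed.Build _ _ dual_pred
  dual_submod_closed.
HB.instance Definition _ := [SubChoice_isSubLmodule of dual by <:].


Lemma dual_linear (g : dual) : linear g.
Proof. by case: g => g /= /set_mem[]. Qed.

Lemma dual_continuous (g : dual) : continuous g.
Proof. by case: g => g /= /set_mem[]. Qed.

HB.instance Definition _ (g : dual) :=
  GRing.isLinear.Build R[i] X R[i] *:%R (dual_val g) (dual_linear g).

Lemma dual_ext (g h : dual) : g =1 h -> g = h.
Proof. by move=> gh; apply/val_inj/funext. Qed.

Definition dual_norm (g : dual) : R :=
  sup [set modulus (g x) | x in [set x : X | `|x| <= 1]].

Lemma dual_norm_has_sup (g : dual) :
  has_sup [set modulus (g x) | x in [set x : X | `|x| <= 1]].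
Proof.
split; first by exists (modulus (g 0)), 0 => //=; rewrite normr0.
have /linear_bounded_continuous/linear_boundedP := @dual_continuous g.
move=> /pinfty_ex_gt0 [M M0 gM].
exists (complex.Re M) => _ [x /= x1 <-].
rewrite -lecR -modulusE (_ : (complex.Re M)%:C = M); last first.
  by apply/RRe_real/gtr0_real.
by rewrite (le_trans (gM x))// ler_piMr// ltW.
Qed.

Lemma dual_norm_ub (g : dual) (x : X) : `|x| <= 1 -> modulus (g x) <= dual_norm g.
Proof. by move=> x1; apply: sup_upper_bound; [exact: dual_norm_has_sup|exists x]. Qed.

Lemma dual_norm_le (g : dual) (M : R) :
  (forall x, `|x| <= 1 -> modulus (g x) <= M) -> dual_norm g <= M.
Proof.
move=> gM; apply: ge_sup; first by have [] := dual_norm_has_sup g.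
by move=> _ [x x1 <-]; exact: gM.
Qed.

Lemma dual_norm_ge0 (g : dual) : 0 <= dual_norm g.
Proof. by rewrite (le_trans (modulus_ge0 (g 0)))// dual_norm_ub// normr0. Qed.

Lemma ler_dual_normD (f g : dual) :
  (dual_norm (f + g))%:C <= (dual_norm f)%:C + (dual_norm g)%:C.
Proof.
rewrite -rmorphD lecR; apply: dual_norm_le => x x1.
rewrite (le_trans (_ : _ <= modulus (f x) + modulus (g x)))//.
  by rewrite -lecR rmorphD/= -!modulusE; exact: ler_normD.
by rewrite lerD// dual_norm_ub.
Qed.

Lemma dual_normZ_le (l : R[i]) (g : dual) :
  dual_norm (l *: g) <= modulus l * dual_norm g.
Proof.
apply: dual_norm_le => x x1; rewrite /modulus.
rewrite (_ : (l *: g) x = l * g x)// ComplexField.Normc.normcM.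
by rewrite ler_wpM2l ?modulus_ge0// dual_norm_ub.
Qed.

Lemma dual_normZ (l : R[i]) (g : dual) :
  (dual_norm (l *: g))%:C = `|l| * (dual_norm g)%:C.
Proof.
rewrite modulusE -rmorphM; congr (_ %:C); apply/le_anti/andP; split.
  exact: dual_normZ_le.
have [->|l0] := eqVneq l 0.
  by rewrite /modulus ComplexField.Normc.normc0 mul0r dual_norm_ge0.
have ml0 : 0 < modulus l by rewrite -ltcR -modulusE normr_gt0.
rewrite -ler_pdivlMl//.
have := dual_normZ_le l^-1 (l *: g).
by rewrite scalerA mulVf// scale1r /modulus ComplexField.Normc.normcV.
Qed.

Lemma dual_norm0_eq0 (g : dual) : (dual_norm g)%:C = 0 -> g = 0.
Proof.
move=> /complexI g0; apply: dual_ext => x.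
suff H y : `|y| <= 1 -> g y = 0.
  have [->|x0] := eqVneq x 0; first by rewrite linear0.
  have := H (`|x|^-1 *: x); rewrite normfZV// => /(_ (lexx _)).
  rewrite linearZ/= => /eqP; rewrite scaler_eq0 invr_eq0 normr_eq0 (negbTE x0).
  by move=> /eqP.
move=> y1; apply/eqP; rewrite -normr_eq0 modulusE.
suff -> : modulus (g y) = 0 by [].
by apply/le_anti; rewrite modulus_ge0 -g0 dual_norm_ub.
Qed.

HB.instance Definition _ := Lmodule_isNormed.Build R[i] dual
  ler_dual_normD dual_normZ dual_norm0_eq0.

Lemma dual_normE (g : dual) : `|g| = (dual_norm g)%:C.
Proof. by []. Qed.

Lemma dual_norm_bound (g : dual) (x : X) :
  `|g x| <= (dual_norm g)%:C * `|x|.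
Proof.
have [->|x0] := eqVneq x 0; first by rewrite linear0 !normr0 mulr0.
have x1 : `| `|x|^-1 *: x | <= 1 by rewrite normfZV.
have := dual_norm_ub g x1; rewrite -lecR -modulusE linearZ/= normrZ normfV.
by rewrite normr_id mulrC ler_pdivrMr// normr_gt0.
Qed.

End Dual.

Notation bidual X := (dual (dual X)).

Section NearDifferentiable.
Variables (K : numFieldType) (V W : normedModType K).

Lemma near0_differentiable (f : V -> W) (x : V) :
  (\forall y \near x, f y = 0) -> differentiable f x.
Proof.
move=> f0; have fx : f x = 0 := nbhs_singleton f0.
have f0s : \forall h \near (0 : V), f (h + x) = 0.
  by move: f0; rewrite (near_shift 0) subr0.
have fE : f \o shift x = cst (f x) + (\0 : V -> W) +o_ 0 id.
  apply/eqaddoP => _/posnumP[e]; near=> h => /=.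
  have -> : (f \o shift x - (cst (f x) + \0)) h = f (h + x) - (f x + 0) by [].
  rewrite fx addr0 subr0 (_ : f (h + x) = 0) ?normr0 ?mulr_ge0//.
  by near: h.
have c0 : continuous (\0 : V -> W) by move=> ?; exact: cvg_cst.
apply/diff_locallyP; rewrite (@diff_unique _ _ _ f \0 x c0 fE).
by split.
Unshelve. all: by end_near. Qed.

Lemma near_eq_differentiable (f g : V -> W) (x : V) :
  (\forall y \near x, f y = g y) -> differentiable g x -> differentiable f x.
Proof.
move=> fg dg; rewrite (_ : f = (f - g) + g); last by rewrite subrK.
apply: differentiableD => //; apply: near0_differentiable.
apply: filterS fg => y fgy; have -> : (f - g) y = f y - g y by [].
by rewrite fgy subrr.
Qed.

End NearDifferentiable.
Definition unit_ball (R : realType) (X : normedModType R[i]) : set X :=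
  [set x | `|x| < 1].
Arguments unit_ball {R} X.

Section Au.
Variables (R : realType) (X : normedModType R[i]).
Local Notation B := (set_type (unit_ball X)).

(* Holomorphic = complex Frechet differentiable at each point of the open ball;
   'valL_0 f extends f by 0 outside the ball, which does not affect
   differentiability at its points. *)
Definition Au_pred : {pred (B -> R[i])} :=
  mem [set f : B -> R[i] |
    (forall x : B, differentiable ('valL_0 f) (val x)) /\ unif_continuous f].

Record Au := MkAu { Au_val :> B -> R[i] ; _ : Au_val \in Au_pred }.

HB.instance Definition _ := [isSub for Au_val].
HB.instance Definition _ := [Choice of Au by <:].

Lemma unit_ballP (x : B) : `|val x| < 1.
Proof. by case: x => x /= /set_mem. Qed.

Lemma valL_val (f : B -> R[i]) (x : B) : 'valL_0 f (val x) = f x.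
Proof. exact: (congr1 (fun h : B -> R[i] => h x) (valLK 0 f)). Qed.

Lemma valL_out (f : B -> R[i]) (x : X) : ~ unit_ball X x -> 'valL_0 f x = 0.
Proof.
move=> xB; rewrite /valL_/= oinv_set_val insubF//.
by apply/negP => /set_mem.
Qed.

Lemma near_unit_ball (x : B) : \forall y \near val x, unit_ball X y.
Proof.
have x1 : 0 < 1 - `|val x| by rewrite subr_gt0 unit_ballP.
apply/nbhs_ballP; exists (1 - `|val x|) => //= y; rewrite -ball_normE /= => xy.
rewrite /unit_ball/= -[y](subKr (val x)) (le_lt_trans (ler_normB _ _))//.
by rewrite -ltrBrDl.
Qed.

Lemma Au_unif_continuousP (f : B -> R[i]) : unif_continuous f <->
  forall e : R, 0 < e -> exists2 d : R, 0 < d &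
    forall x y : B, `|val x - val y| < d%:C -> modulus (f x - f y) < e.
Proof.
split=> [fu e e0|fu A].
  have /fu : entourage [set xy : R[i] * R[i] | ball xy.1 e%:C xy.2].
    by rewrite -entourage_ballE; exists e%:C => //=; rewrite ltcR.
  case=> V; rewrite -entourage_ballE => -[d /= d0 dV] Ve.
  exists (complex.Re d); first by rewrite -ltcR gt0_RRe.
  move=> x y; rewrite gt0_RRe// => xyd.
  have /= := Ve (x, y); rewrite -ball_normE /= -ltcR -modulusE; apply.
  by apply: dV; rewrite -ball_normE.
rewrite -entourage_ballE => -[e /= e0 eA].
have [|d d0 fd] := fu (complex.Re e); first by rewrite -ltcR gt0_RRe.
exists [set xy : X * X | ball xy.1 d%:C xy.2].
  by rewrite -entourage_ballE; exists d%:C => //=; rewrite ltcR.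
move=> [x y] /= xyd; apply: eA; rewrite -ball_normE /=.
by rewrite modulusE -(gt0_RRe e0) ltcR; apply: fd; rewrite -ball_normE in xyd.
Qed.

Lemma Au_bounded (f : B -> R[i]) : unif_continuous f ->
  exists M : R, forall x : B, modulus (f x) <= M.
Proof.
move=> /Au_unif_continuousP/(_ 1 ltr01)[d d0 fd].
pose F := 'valL_0 f.
have Fd y z : unit_ball X y -> unit_ball X z -> `|y - z| < d%:C ->
    modulus (F y - F z) < 1.
  move=> y1 z1 yz; pose y' : B := SigSub (mem_set y1).
  pose z' : B := SigSub (mem_set z1).
  have -> : F y = f y' by exact: (valL_val f y').
  have -> : F z = f z' by exact: (valL_val f z').
  exact: fd.
have [N Nd] : exists N : nat, N.+1%:R^-1 < d.
  exists (Num.truncn d^-1); rewrite invf_plt ?posrE//.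
  by rewrite truncnS_gt.
pose a : R := N.+1%:R^-1; have a0 : 0 < a by rewrite invr_gt0.
exists (modulus (F 0) + N.+1%:R) => x.
have x1 := unit_ballP x.
have H k : (k <= N.+1)%N ->
    modulus (F ((k%:R * a)%:C *: val x)) <= modulus (F 0) + k%:R.
  have inB j : (j <= N.+1)%N -> unit_ball X ((j%:R * a)%:C *: val x).
    move=> jN; rewrite /unit_ball/= normrZ ger0_norm ?lecR ?mulr_ge0// ?ltW//.
    rewrite (le_lt_trans _ x1)// ler_piMl// lecR.
    by rewrite ler_pdivrMr// mul1r ler_nat.
  elim: k => [_|k IH kN]; first by rewrite mul0r scale0r addr0.
  rewrite -[F _](subrK (F ((k%:R * a)%:C *: val x))) (le_trans (modulusD _ _))//.
  rewrite -[in leRHS]natr1 addrA [leLHS]addrC lerD//.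
    by apply: IH; exact: ltnW.
  apply/ltW/Fd; [exact: inB|exact/inB/ltnW|].
  rewrite -scalerBl -rmorphB -mulrBl -natr1 addrAC subrr add0r mul1r.
  rewrite normrZ ger0_norm ?lecR ?ltW//.
  rewrite (@lt_trans _ _ (a%:C))// ?ltcR//.
  by rewrite gtr_pMr ?ltcR.
have := H N.+1 (leqnn _); rewrite /a mulfV ?pnatr_eq0// scale1r.
by rewrite /F valL_val.
Qed.

Lemma valLD (f g : B -> R[i]) : 'valL_0 (f + g) = 'valL_0 f + 'valL_0 g.
Proof.
apply/funext => x; have -> : ('valL_0 f + 'valL_0 g) x = 'valL_0 f x + 'valL_0 g x by [].
have [xB|xB] := pselect (unit_ball X x); last by rewrite !valL_out// addr0.
pose x' : B := SigSub (mem_set xB).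
by rewrite (valL_val _ x') (valL_val f x') (valL_val g x').
Qed.

Lemma valLM (f g : B -> R[i]) : 'valL_0 (f * g) = 'valL_0 f * 'valL_0 g.
Proof.
apply/funext => x; have -> : ('valL_0 f * 'valL_0 g) x = 'valL_0 f x * 'valL_0 g x by [].
have [xB|xB] := pselect (unit_ball X x); last by rewrite !valL_out// mulr0.
pose x' : B := SigSub (mem_set xB).
by rewrite (valL_val _ x') (valL_val f x') (valL_val g x').
Qed.

Lemma valLZ (a : R[i]) (f : B -> R[i]) : 'valL_0 (a *: f) = a *: 'valL_0 f.
Proof.
apply/funext => x; have -> : (a *: 'valL_0 f) x = a *: 'valL_0 f x by [].
have [xB|xB] := pselect (unit_ball X x); last by rewrite !valL_out// scaler0.
pose x' : B := SigSub (mem_set xB).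
by rewrite (valL_val _ x') (valL_val f x').
Qed.

Lemma Au_restrict (g : X -> R[i]) : (forall x, differentiable g x) ->
    unif_continuous (g \o val : B -> R[i]) ->
  (g \o val : B -> R[i]) \in Au_pred.
Proof.
move=> gd gu; apply/mem_set; split => // x.
apply: near_eq_differentiable (gd (val x)).
apply: filterS (near_unit_ball x) => y yB.
exact: (valL_val _ (SigSub (mem_set yB) : B)).
Qed.

Lemma Au_cst (c : R[i]) : (cst c : B -> R[i]) \in Au_pred.
Proof.
apply: (@Au_restrict (cst c)) => [x|]; first exact: differentiable_cst.
apply/Au_unif_continuousP => e e0; exists 1 => // x y _ /=.
by rewrite subrr /modulus ComplexField.Normc.normc0.
Qed.

Lemma Au_submod_closed : submod_closed Au_pred.
Proof.
split; first exact: Au_cst.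
move=> a f g /set_mem[fd fu] /set_mem[gd gu]; apply/mem_set; split => [x|].
  rewrite (valLD (a *: f) g).
  rewrite (valLZ a f).
  apply: differentiableD; last exact: (gd x).
  exact: (differentiableZ a (fd x)).
have ma0 : 0 < modulus a + 1 by rewrite ltr_wpDl// modulus_ge0.
apply/Au_unif_continuousP => e e0.
have [|d1 d10 fd1] := (Au_unif_continuousP f).1 fu (e / 2 / (modulus a + 1)).
  by rewrite !divr_gt0.
have [|d2 d20 gd2] := (Au_unif_continuousP g).1 gu (e / 2); first by rewrite divr_gt0.
exists (Num.min d1 d2); first by rewrite lt_min d10 d20.
move=> x y xy.
have xy1 : `|val x - val y| < d1%:C by rewrite (lt_le_trans xy)// lecR ge_min lexx.
have xy2 : `|val x - val y| < d2%:C by rewrite (lt_le_trans xy)// lecR ge_min lexx orbT.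
have -> : (a *: f + g) x - (a *: f + g) y = a * (f x - f y) + (g x - g y).
  by rewrite mulrBr addrACA -opprD.
rewrite (le_lt_trans (modulusD _ _))// [ltRHS]splitr.
rewrite ler_ltD ?gd2// modulusM.
have := fd1 x y xy1; rewrite ltr_pdivlMr// => /ltW; apply: le_trans.
by rewrite mulrC ler_wpM2l ?modulus_ge0// lerDl.
Qed.

Lemma Au_mulr_closed : mulr_closed Au_pred.
Proof.
split; first exact: Au_cst.
move=> f g /set_mem[fd fu] /set_mem[gd gu]; apply/mem_set; split => [x|].
  rewrite (valLM f g); exact: (differentiableM (fd x) (gd x)).
have [M fM] := Au_bounded fu; have [N gN] := Au_bounded gu.
pose P : R := `|M| + `|N| + 1.
have P0 : 0 < P by rewrite ltr_wpDl// addr_ge0.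
have fP x : modulus (f x) <= P.
  by rewrite (le_trans (fM x))// (le_trans (ler_norm _))// /P -addrA lerDl addr_ge0.
have gP x : modulus (g x) <= P.
  by rewrite (le_trans (gN x))// (le_trans (ler_norm _))// /P addrAC lerDr addr_ge0.
apply/Au_unif_continuousP => e e0.
have e20 : 0 < e / 2 / P by rewrite !divr_gt0.
have [d1 d10 fd1] := (Au_unif_continuousP f).1 fu _ e20.
have [d2 d20 gd2] := (Au_unif_continuousP g).1 gu _ e20.
exists (Num.min d1 d2); first by rewrite lt_min d10 d20.
move=> x y xy.
have xy1 : `|val x - val y| < d1%:C by rewrite (lt_le_trans xy)// lecR ge_min lexx.
have xy2 : `|val x - val y| < d2%:C by rewrite (lt_le_trans xy)// lecR ge_min lexx orbT.
have -> : (f * g) x - (f * g) y = f x * (g x - g y) + (f x - f y) * g y.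
  by rewrite mulrBr mulrBl addrA subrK.
rewrite (le_lt_trans (modulusD _ _))// [ltRHS]splitr !modulusM ltrD//.
  have := gd2 x y xy2; rewrite ltr_pdivlMr//; apply: le_lt_trans.
  by rewrite mulrC ler_wpM2l ?modulus_ge0.
have := fd1 x y xy1; rewrite ltr_pdivlMr//; apply: le_lt_trans.
by rewrite ler_wpM2l ?modulus_ge0.
Qed.

HB.instance Definition _ := GRing.isSubmodClosed.Build _ _ Au_pred
  Au_submod_closed.
HB.instance Definition _ := GRing.isMulClosed.Build _ Au_pred Au_mulr_closed.

HB.instance Definition _ := 
  GRing.SubChoice_isSubComPzRing.Build _ _ Au (subringClosedP _).
HB.instance Definition _ := [SubZmodule_isSubLmodule of Au by <:].

Lemma dual_Au_subproof (g : dual X) : (g \o val : B -> R[i]) \in Au_pred.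
Proof.
apply: Au_restrict => [x|]; first exact/linear_differentiable/dual_continuous.
apply/Au_unif_continuousP => e e0.
have n0 : 0 < dual_norm g + 1 by rewrite ltr_wpDl// dual_norm_ge0.
exists (e / (dual_norm g + 1)); first by rewrite divr_gt0.
move=> x y xy; rewrite -ltcR -modulusE /= -linearB.
rewrite (le_lt_trans (dual_norm_bound _ _))//.
rewrite (@le_lt_trans _ _ ((dual_norm g + 1)%:C * `|val x - val y|))//.
  by rewrite ler_wpM2r// lecR lerDl.
rewrite mulrC -ltr_pdivlMr ?ltcR// (lt_le_trans xy)//.
by rewrite rmorphM/= fmorphV.
Qed.

Definition dual_Au (g : dual X) : Au := MkAu (dual_Au_subproof g).

End Au.

Section Spectrum.
Variables (R : realType) (X : normedModType R[i]).

Definition Au_norm (f : Au X) : \bar R :=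
  ereal_sup [set (modulus (f x))%:E | x in [set: set_type (unit_ball X)]].

Definition spectrum : set (Au X -> R[i]) :=
  [set phi : Au X -> R[i] |
     [/\ linear phi, {morph phi : f g / f * g} & exists f, phi f != 0]].

Definition fiber (z : bidual X) : set (Au X -> R[i]) :=
  [set phi | spectrum phi /\ forall g : dual X, phi (dual_Au g) = z g].

Definition gleason_dist (phi psi : Au X -> R[i]) : \bar R :=
  ereal_sup [set (modulus (phi f - psi f))%:E
            | f in [set f : Au X | (Au_norm f <= 1%:E)%E]].

Definition gleason_part (phi : Au X -> R[i]) : set (Au X -> R[i]) :=
  [set psi | spectrum psi /\ (gleason_dist phi psi < 2%:E)%E].

End Spectrum.

Section AronBerner.
Variables (R : realType) (X : normedModType R[i]).

Definition multilinear m (A : ('I_m -> X) -> R[i]) : Prop :=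
  forall (i : 'I_m) (v : 'I_m -> X), linear (fun x => A [eta v with i |-> x]).

Definition symmetric_form m (A : ('I_m -> X) -> R[i]) : Prop :=
  forall (s : 'S_m) (v : 'I_m -> X), A (v \o s) = A v.

(* P_m x = A m (x, .., x) is the m-homogeneous term of the Taylor series of f
   at 0 and A m its symmetric m-linear form; pointwise convergence on the unit
   ball already determines the family A *)
Definition is_taylor (f : Au X) (A : forall m, ('I_m -> X) -> R[i]) : Prop :=
  (forall m, [/\ multilinear (A m), symmetric_form (A m) &
                 continuous (fun x : X => A m (fun=> x))]) /\
  (forall x : set_type (unit_ball X),
     series (fun m => A m (fun=> val x)) @ \oo --> f x).

Definition taylor_form (f : Au X) : forall m, ('I_m -> X) -> R[i] :=
  get (is_taylor f).

(* Traces on X of the weak-star neighbourhoods of z : x -> z along this filter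
   iff g x -> z g for every g in the dual.  A net in X converges weak-star to z
   iff it is eventually in each member of the filter. *)
Definition weakstar (z : bidual X) : set_system X :=
  filter_from [set p : seq (dual X) * R | 0 < p.2]
    (fun p => [set x : X | forall g, g \in p.1 -> modulus (g x - z g) < p.2]).

Definition fcons m (x : X) (v : 'I_m -> X) : 'I_m.+1 -> X :=
  fun i => oapp v x (unlift ord0 i).

(* lim_(x_0 -> z_0) .. lim_(x_(m-1) -> z_(m-1)) A (x_0, .., x_(m-1)), the limit
   in x_0 being the outermost one *)
Fixpoint iterated_lim m : (('I_m -> X) -> R[i]) -> ('I_m -> bidual X) -> R[i] :=
  match m with
  | 0 => fun A _ => A (fun=> 0)
  | m.+1 => fun A z =>
      lim (iterated_lim (fun v => A (fcons x v)) (fun i => z (lift ord0 i))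
            @[x --> weakstar (z ord0)])
  end.

Definition aron_berner_ball (f : Au X) (z : bidual X) : R[i] :=
  limn (series (fun m => iterated_lim (taylor_form f (m := m)) (fun=> z))).

(* meaningful for `|z| <= 1 only *)
Definition aron_berner (f : Au X) (z : bidual X) : R[i] :=
  if `|z| < 1 then aron_berner_ball f z
  else lim (aron_berner_ball f w @[w --> within (unit_ball (bidual X)) (nbhs z)]).

Definition delta (z : bidual X) : Au X -> R[i] := fun f => aron_berner f z.

End AronBerner.

Definition closed_unit_ball (R : realType) (V : normedModType R[i]) : set V :=
  [set x | `|x| <= 1].
Arguments closed_unit_ball {R} V.

Definition complex_extreme (R : realType) (V : lmodType R[i]) (C : set V) : set V :=
  [set z | C z /\
    forall y : V, (forall l : R[i], `|l| <= 1 -> C (z + l *: y)) -> y = 0].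

(* Main.v *)
From HB Require Import structures.
From Stdlib Require List.
Require Import Defs.
From mathcomp Require Import all_boot all_order all_algebra all_fingroup.
From mathcomp Require Import all_classical reals topology normedtype sequences.
From mathcomp Require Import derive landau ereal.
From mathcomp Require Import complex ring lra.
Set Implicit Arguments.
Unset Strict Implicit.
Unset Printing Implicit Defensive.
Import Order.TTheory GRing.Theory Num.Theory numFieldNormedType.Exports.
Local Open Scope classical_set_scope.
Local Open Scope ring_scope.
Local Open Scope complex_scope.

(** Both parts rest on the pseudo-hyperbolic description of Gleason parts: if
    phi and psi are characters at distance less than 2, then there is rho < 1
    with |psi f - phi f| <= rho |1 - conj (phi f) psi f| for every f of norm at
    most 1 with |phi f| < 1 (pseudohyperbolic), and conversely a Schwarz estimate
    |psi f| <= rho < 1 for all such f with phi f = 0 forces the distance to be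
    less than 2 (schwarz_dist).  Both directions come from composing f with
    Moebius transforms, which stays in the algebra because a function bounded
    away from 0 is invertible there (Au_inverse).

    For (a), let phi and psi lie over z and w, in the same part.  Applied to
    f = r g, with g a functional of norm at most 1 and r tending to 1, the first
    estimate gives (1 - rho) |w g - z g| <= 2 rho (1 - |z g|).  Hence
    |z g| + k |w g - z g| <= 1 for some k > 0 not depending on g, which says that
    the disc z + l k (w - z), |l| <= 1, stays in the closed unit ball
    (same_part_disc).  If z is a complex extreme point then w = z.

    For (b), a point z that is not complex extreme is the centre of a disc
    z + l u inside the closed ball.  As a function of l the value of the
    canonical extension of f at z + l u is a uniform limit of polynomials, so
    Schwarz's lemma gives |delta (z + l u) f| <= |l| when |f| <= 1 and
    delta z f = 0 (delta_schwarz), and the second estimate applies.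

    Both arguments need that the delta z are characters lying over z.  This
    follows at once from the fact that the values of delta z at finitely many
    members of the algebra, and of z at finitely many functionals, are
    approximated simultaneously by evaluation at one point of the open ball of X
    (delta_approx).  For homogeneous polynomials this is the theorem of Davie and
    Gamelin: the point is the mean of a long sequence of points, each chosen with
    Goldstine's theorem so that a finite set of functionals built from the
    previous ones nearly takes its values at z (davie_gamelin).  It carries over
    to f in the open ball by the Taylor series of f, whose terms satisfy Cauchy's
    inequality and, by the approximation, so do their extensions (abz_cauchy);
    and it carries over to the sphere because the approximation is compatible
    with radial contractions, along which f is uniformly continuous
    (delta_radial).

    That f has a Taylor series of symmetric multilinear forms (taylor_exists) is
    obtained from the one-variable theory along complex lines.  There, Goursat's
    theorem for trapezoid sums gives Cauchy's formula on regular polygons and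
    thus power series expansions in a disc (taylor_disc).  All further
    coefficient extraction is by averaging over roots of unity of order a power
    of 2 (avgc), which is a finite sum. *)

(** * Real-valued norms *)

(** The order of R[i] is only partial; estimates are carried out in R. *)
Definition rnorm (R : realType) (V : normedModType R[i]) (x : V) : R :=
  complex.Re `|x|.

Section RealNorm.
Variables (R : realType) (V : normedModType R[i]).
Implicit Types (x y : V) (a b : R[i]).

Lemma rnormE x : `|x| = (rnorm x)%:C.
Proof. by rewrite /rnorm RRe_real// normr_real. Qed.

Lemma rnorm_leC x (M : R) : (`|x| <= M%:C) = (rnorm x <= M).
Proof. by rewrite rnormE lecR. Qed.

Lemma rnorm_ltC x (M : R) : (`|x| < M%:C) = (rnorm x < M).
Proof. by rewrite rnormE ltcR. Qed.

Lemma rnorm_le1 x : (`|x| <= 1) = (rnorm x <= 1).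
Proof. exact: rnorm_leC x 1. Qed.

Lemma rnorm_lt1 x : (`|x| < 1) = (rnorm x < 1).
Proof. exact: rnorm_ltC x 1. Qed.

Lemma rnorm_ge0 x : 0 <= rnorm x.
Proof. by rewrite -lecR -rnormE; exact: normr_ge0. Qed.

Lemma rnormD x y : rnorm (x + y) <= rnorm x + rnorm y.
Proof. by rewrite -lecR rmorphD/= -!rnormE ler_normD. Qed.

Lemma rnormN x : rnorm (- x) = rnorm x.
Proof. by rewrite /rnorm normrN. Qed.

Lemma rnormBC x y : rnorm (x - y) = rnorm (y - x).
Proof. by rewrite -rnormN opprB. Qed.

Lemma rnormB x y : rnorm (x - y) <= rnorm x + rnorm y.
Proof. by rewrite -[in leRHS](rnormN y) rnormD. Qed.

Lemma rnorm_tri x y z : rnorm (x - z) <= rnorm (x - y) + rnorm (y - z).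
Proof. by rewrite -[x - z](subrKA y) rnormD. Qed.

Lemma rnorm_subl x y : rnorm x - rnorm y <= rnorm (x - y).
Proof. by rewrite lerBlDr -[in leLHS](subrK y x) rnormD. Qed.

Lemma rnorm0 : rnorm (0 : V) = 0.
Proof. by rewrite /rnorm normr0. Qed.

Lemma rnorm_eq0 x : (rnorm x == 0) = (x == 0).
Proof.
rewrite -(normr_eq0 x) rnormE; apply/eqP/eqP => [->//|].
by move=> /complexI.
Qed.

Lemma rnorm_gt0 x : (0 < rnorm x) = (x != 0).
Proof. by rewrite lt_neqAle rnorm_ge0 andbT eq_sym rnorm_eq0. Qed.

Lemma rnorm_small_eq0 x (K : R) : 0 <= K ->
  (forall e, 0 < e -> rnorm x <= K * e) -> x = 0.
Proof.
move=> K0 H; apply/eqP; rewrite -rnorm_eq0 eq_le rnorm_ge0 andbT.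
apply/ler_addgt0Pr => e e0; rewrite add0r.
have K1 : 0 < K + 1 by lra.
have := H (e / (K + 1)) (divr_gt0 e0 K1) => /le_trans; apply.
rewrite mulrA ler_pdivrMr// mulrC ler_pM2l//; lra.
Qed.

Lemma rnorm_sum (I : Type) (r : seq I) (P : pred I) (F : I -> V) :
  rnorm (\sum_(i <- r | P i) F i) <= \sum_(i <- r | P i) rnorm (F i).
Proof.
elim/big_ind2 : _ => [|x a y b xa yb|//]; first by rewrite rnorm0.
by rewrite (le_trans (rnormD _ _))// lerD.
Qed.

End RealNorm.

Section RealNormC.
Variables (R : realType).
Implicit Types (a b : R[i]).

Lemma rnormZ (V : normedModType R[i]) a (x : V) :
  rnorm (a *: x) = rnorm a * rnorm x.
Proof. by apply: complexI; rewrite rmorphM/= -!rnormE normrZ. Qed.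

Lemma rnorm_modulus a : rnorm a = modulus a.
Proof. by []. Qed.

Lemma rnormM a b : rnorm (a * b) = rnorm a * rnorm b.
Proof. exact: modulusM. Qed.

Lemma rnorm1 : rnorm (1 : R[i]) = 1.
Proof. by rewrite /rnorm normr1. Qed.

Lemma rnormV a : rnorm a^-1 = (rnorm a)^-1.
Proof. exact: ComplexField.Normc.normcV. Qed.

Lemma rnormX a n : rnorm (a ^+ n) = rnorm a ^+ n.
Proof. by elim: n => [|n IH]; rewrite ?expr0 ?rnorm1// !exprS rnormM IH. Qed.

Lemma rnorm_real (t : R) : rnorm (t%:C : R[i]) = `|t|.
Proof. by rewrite rnorm_modulus /modulus /= expr0n addr0 sqrtr_sqr. Qed.

Lemma rnorm_pos (t : R) : 0 <= t -> rnorm (t%:C : R[i]) = t.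
Proof. by move=> t0; rewrite rnorm_real ger0_norm. Qed.

Lemma rnorm_nat n : rnorm (n%:R : R[i]) = n%:R.
Proof. by rewrite -(rmorph_nat (real_complex R)) rnorm_pos. Qed.

Lemma rnormXsqr a : rnorm a ^+ 2 = complex.Re a ^+ 2 + complex.Im a ^+ 2.
Proof.
by rewrite rnorm_modulus /modulus; case: a => u v /=; rewrite sqr_sqrtr// addr_ge0 ?sqr_ge0.
Qed.

Lemma Re_le_rnorm a : `|complex.Re a| <= rnorm a.
Proof. by rewrite -lecR -rnormE; exact: normc_ge_Re. Qed.

Lemma Im_le_rnorm a : `|complex.Im a| <= rnorm a.
Proof.
rewrite -(ler_pXn2r (n := 2))// ?nnegrE ?rnorm_ge0//.
by rewrite real_normK ?num_real// rnormXsqr lerDr sqr_ge0.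
Qed.

Lemma rnorm_le_ReIm a : rnorm a <= `|complex.Re a| + `|complex.Im a|.
Proof.
rewrite -(ler_pXn2r (n := 2))// ?nnegrE ?rnorm_ge0 ?addr_ge0//.
rewrite rnormXsqr sqrrD !real_normK ?num_real//.
by rewrite addrAC lerDl mulrn_wge0// mulr_ge0.
Qed.

Lemma rnormJ a : rnorm (a^*) = rnorm a.
Proof. by apply: complexI; rewrite -!rnormE; exact: normcJ. Qed.

End RealNormC.

(** * Limits of complex sequences *)

Section Tends.
Variable R : realType.
Implicit Types (u v : nat -> R[i]) (l : R[i]).

(** The topology of R[i] is that of this norm; tends_cvg and cvg_tends pass
    between the two notions of limit. *)
Definition tends u l := forall e : R, 0 < e ->
  exists n0, forall n, (n0 <= n)%N -> rnorm (u n - l) <= e.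

Lemma tends_unique u l l' : tends u l -> tends u l' -> l = l'.
Proof.
move=> ul ul'; apply/eqP; rewrite -subr_eq0; apply/eqP.
apply: (@rnorm_small_eq0 _ _ _ 2) => // e e0.
have [n1 H1] := ul e e0; have [n2 H2] := ul' e e0.
have /H1 h1 : (n1 <= maxn n1 n2)%N by rewrite leq_maxl.
have /H2 h2 : (n2 <= maxn n1 n2)%N by rewrite leq_maxr.
have := rnorm_tri l (u (maxn n1 n2)) l'.
rewrite (rnormBC l (u _)); lra.
Qed.

Lemma tends_lin (a : R[i]) u v l l' : tends u l -> tends v l' ->
  tends (fun n => u n + a * v n) (l + a * l').
Proof.
move=> ul vl' e e0.
have a1 : 0 < 1 + rnorm a by have := rnorm_ge0 a; lra.
have e1 : 0 < e / (1 + rnorm a) by rewrite divr_gt0.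
have [n1 H1] := ul _ e1; have [n2 H2] := vl' _ e1.
exists (maxn n1 n2) => n; rewrite geq_max => /andP[/H1 h1 /H2 h2].
have -> : u n + a * v n - (l + a * l') = (u n - l) + a * (v n - l') by ring.
rewrite (le_trans (rnormD _ _))// rnormM.
apply: le_trans (lerD h1 (ler_wpM2l (rnorm_ge0 _) h2)) _.
by rewrite -[X in X + _]mul1r -mulrDl mulrC divfK// gt_eqF.
Qed.

Lemma tends_le u l (M : R) : tends u l -> (forall n, rnorm (u n) <= M) ->
  rnorm l <= M.
Proof.
move=> ul uM; apply/ler_addgt0Pr => e e0.
have [n0 /(_ n0 (leqnn _)) H] := ul _ e0.
have := uM n0; have := rnorm_subl l (u n0); rewrite rnormBC; lra.
Qed.

Lemma tends_const l : tends (fun=> l) l.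
Proof. by move=> e e0; exists 0%N => n _; rewrite subrr rnorm0 ltW. Qed.

Lemma cauchy_tends u :
  (forall e : R, 0 < e -> exists n0, forall m n,
     (n0 <= m)%N -> (n0 <= n)%N -> rnorm (u m - u n) <= e) ->
  exists l, tends u l.
Proof.
move=> uC.
have cv (p : nat -> R) : (forall m n, `|p m - p n| <= rnorm (u m - u n)) ->
    exists l : R, forall e : R, 0 < e -> exists n0, forall n, (n0 <= n)%N ->
      `|p n - l| <= e.
  move=> pu; have pc : cauchy (p @ \oo).
    apply/cauchy_ballP => e e0.
    have [n0 H] := uC (e / 2) (divr_gt0 e0 (ltr0n _ 2)).
    exists ([set p n | n in [set n | (n0 <= n)%N]],
            [set p n | n in [set n | (n0 <= n)%N]]) => /=.
      by split; exists n0 => // n /= n0n; exists n.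
    move=> [_ _] /= [[m mn <-] [n nn <-]]; rewrite -ball_normE /=.
    have := H m n mn nn; have := pu m n; lra.
  have /cauchy_cvgP/cvg_ex[l /cvgrPdist_le pl] := pc.
  exists l => e e0; have [n0 _ H] := pl e e0.
  by exists n0 => n n0n; rewrite distrC; exact: H.
have [m n|a Ha] := cv (fun n => complex.Re (u n)).
  by rewrite -raddfB; exact: Re_le_rnorm.
have [m n|b Hb] := cv (fun n => complex.Im (u n)).
  by rewrite -raddfB; exact: Im_le_rnorm.
exists (a +i* b) => e e0.
have [n1 H1] := Ha (e / 2) (divr_gt0 e0 (ltr0n _ 2)).
have [n2 H2] := Hb (e / 2) (divr_gt0 e0 (ltr0n _ 2)).
exists (maxn n1 n2) => n; rewrite geq_max => /andP[/H1 h1 /H2 h2].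
rewrite (le_trans (rnorm_le_ReIm _))//.
have -> : complex.Re (u n - (a +i* b)) = complex.Re (u n) - a by case: (u n).
have -> : complex.Im (u n - (a +i* b)) = complex.Im (u n) - b by case: (u n).
lra.
Qed.

End Tends.

Lemma geometric_small (R : realType) (K q e : R) : 0 <= q < 1 -> 0 < e ->
  exists n0, forall n, (n0 <= n)%N -> K * q ^+ n <= e.
Proof.
move=> /andP[q0 q1] e0.
have K1 : 0 < `|K| + 1 by have := normr_ge0 K; lra.
have /cvgrPdist_le/(_ _ (divr_gt0 e0 K1))[n0 _ H] : q ^+ n @[n --> \oo] --> (0 : R).
  by apply: cvg_expr; rewrite ger0_norm.
exists n0 => n /H /=; rewrite sub0r normrN ger0_norm ?exprn_ge0// => h.
apply: (@le_trans _ _ ((`|K| + 1) * q ^+ n)).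
  by rewrite ler_wpM2r ?exprn_ge0//; have := ler_norm K; lra.
by rewrite mulrC -ler_pdivlMr.
Qed.

Lemma bernoulli (R : realType) (x : R) n : -1 <= x -> 1 + n%:R * x <= (1 + x) ^+ n.
Proof.
move=> x1; have x10 : 0 <= 1 + x by lra.
elim: n => [|n IH]; first by rewrite mul0r addr0 expr0.
rewrite exprS -natr1; apply: le_trans (ler_wpM2l x10 IH).
have : 0 <= n%:R * x ^+ 2 by rewrite mulr_ge0// sqr_ge0.
rewrite expr2; lra.
Qed.

(** * Subdivision *)

Section Bisection.
Variables (R : realType) (T : Type) (Inv G : T -> Prop).
Variables (sz : T -> R) (pt : T -> R[i]).

(** If G failed at some piece satisfying the invariant Inv, it would fail at
    one of half the size next to it, and so on; the marked points pt of these
    pieces converge to a point l near which the local hypothesis excludes the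
    failure of G. *)
Lemma bisection :
  (forall t, 0 <= sz t) ->
  (forall t, Inv t ->
     (forall t', Inv t' -> sz t' <= sz t / 2 -> rnorm (pt t' - pt t) <= sz t ->
        G t') -> G t) ->
  (forall (u : nat -> T) l, (forall n, Inv (u n)) -> tends (pt \o u) l ->
     exists2 d, 0 < d & forall t, Inv t -> sz t <= d ->
        rnorm (pt t - l) <= 2 * sz t -> G t) ->
  forall t, Inv t -> G t.
Proof.
move=> sz0 step loc t0 It0; apply: contrapT => Gt0.
pose B := {t | Inv t /\ ~ G t}.
have next (b : B) : exists b' : B, sz (sval b') <= sz (sval b) / 2 /\
    rnorm (pt (sval b') - pt (sval b)) <= sz (sval b).
  case: b => t [It Gt] /=; apply: contrapT => nb; apply/Gt/step => // t' It' h1 h2.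
  apply: contrapT => Gt'; apply: nb.
  by exists (exist _ t' (conj It' Gt')).
have [f Hf] := choice next.
pose u n := sval (iter n f (exist _ t0 (conj It0 Gt0) : B)).
have uI n : Inv (u n) by rewrite /u; case: (iter _ _ _) => ? [].
have uG n : ~ G (u n) by rewrite /u; case: (iter _ _ _) => ? [].
have us n : sz (u n.+1) <= sz (u n) / 2 by rewrite /u iterS; have [] := Hf (iter n f (exist _ t0 (conj It0 Gt0))).
have up n : rnorm (pt (u n.+1) - pt (u n)) <= sz (u n).
  by rewrite /u iterS; have [] := Hf (iter n f (exist _ t0 (conj It0 Gt0))).
have upd d : forall n, rnorm (pt (u (d + n)%N) - pt (u n)) <= 2 * sz (u n).
  elim: d => [n|d IH n]; first by rewrite add0n subrr rnorm0; have := sz0 (u n); lra.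
  have := IH n.+1; rewrite addSnnS; have := rnorm_tri (pt (u (d + n.+1)%N)) (pt (u n.+1)) (pt (u n)).
  have := up n; have := us n; lra.
have usz n : sz (u n) <= sz (u 0%N) * (2^-1) ^+ n.
  elim: n => [|n IH]; first by rewrite expr0 mulr1.
  by rewrite exprSr mulrA; have := us n; lra.
have small e : 0 < e -> exists n0, forall n, (n0 <= n)%N -> sz (u n) <= e.
  move=> e0; have [|n0 H] := @geometric_small R (sz (u 0%N)) 2^-1 e _ e0.
    by lra.
  by exists n0 => n /H; apply: le_trans.
have [l Hl] : exists l, tends (pt \o u) l.
  apply: cauchy_tends => e e0.
  have [n0 H] := small (e / 4) (divr_gt0 e0 (ltr0n _ 4)).
  exists n0 => m n hm hn /=.
  have := upd (m - n0)%N n0; have := upd (n - n0)%N n0; rewrite !subnK//.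
  have := H n0 (leqnn _).
  have := rnorm_tri (pt (u m)) (pt (u n0)) (pt (u n)).
  rewrite (rnormBC (pt (u n0)) (pt (u n))); lra.
have ul n : rnorm (pt (u n) - l) <= 2 * sz (u n).
  rewrite -rnormN opprB; apply: (@tends_le _ (fun d => pt (u (d + n)%N) - pt (u n)));
    last by move=> d; exact: upd.
  move=> e e0; have [n0 H] := Hl e e0; exists n0 => d dn0.
  rewrite opprB addrA subrK; apply: H.
  exact: leq_trans dn0 (leq_addr _ _).
have [d d0 H] := loc u l uI Hl.
have [n0 /(_ n0 (leqnn _)) H0] := small d d0.
exact: uG (H _ (uI n0) H0 (ul n0)).
Qed.

End Bisection.

(** * Dyadic trapezoid sums *)

Section Trapezoid.
Variable R : realType.
Local Notation C := R[i].
Implicit Types (k : C -> C) (a b c p : C) (U : set C).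

Definition ccont k p := forall e : R, 0 < e -> exists2 d : R, 0 < d &
  forall w, rnorm (w - p) <= d -> rnorm (k w - k p) <= e.

Definition cdiff k p := exists D : C, forall e : R, 0 < e ->
  exists2 d : R, 0 < d & forall w, rnorm (w - p) <= d ->
    rnorm (k w - k p - D * (w - p)) <= e * rnorm (w - p).

(** The trapezoid sums below only evaluate dyadic points of a segment, so
    stability under midpoints is the form of convexity that is used. *)
Definition mid_convex U := forall a b, U a -> U b -> U ((a + b) / 2).

Definition seq_closed U := forall u l, (forall n, U (u n)) -> tends u l -> U l.

(** The trapezoid rule on the 2^n equal pieces of the segment from a to b. *)
Fixpoint trap (n : nat) k a b : C :=
  if n is n'.+1 then trap n' k a ((a + b) / 2) + trap n' k ((a + b) / 2) b
  else (k a + k b) / 2 * (b - a).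

Lemma trapC n k a b : trap n k b a = - trap n k a b.
Proof.
elim: n a b => [|n IH] a b /=; first by rewrite [k b + _]addrC -mulrN opprB.
by rewrite [b + a]addrC (IH _ b) (IH a); ring.
Qed.

Lemma trap_lin n k1 k2 (x : C) a b :
  trap n (fun w => k1 w + x * k2 w) a b = trap n k1 a b + x * trap n k2 a b.
Proof. by elim: n a b => [|n IH] a b /=; [ring|rewrite !IH; ring]. Qed.

Lemma trap_affine n (x y : C) a b :
  trap n (fun w => x + y * w) a b = x * (b - a) + y * (b * b - a * a) / 2.
Proof. by elim: n a b => [|n IH] a b /=; [field|rewrite !IH; field]. Qed.

Lemma rnorm_half a : rnorm (a / 2) = rnorm a / 2.
Proof. by rewrite rnormM rnormV rnorm_nat. Qed.

Lemma mid_l a b : rnorm ((a + b) / 2 - a) = rnorm (b - a) / 2.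
Proof. by rewrite (_ : (a + b) / 2 - a = (b - a) / 2) ?rnorm_half//; field. Qed.

Lemma mid_r a b : rnorm (b - (a + b) / 2) = rnorm (b - a) / 2.
Proof. by rewrite (_ : b - (a + b) / 2 = (b - a) / 2) ?rnorm_half//; field. Qed.

Lemma trap_bound U n k (M : R) a b : mid_convex U -> U a -> U b ->
  (forall w, U w -> rnorm (k w) <= M) -> rnorm (trap n k a b) <= M * rnorm (b - a).
Proof.
move=> Uc + + kM; elim: n a b => [|n IH] a b Ua Ub /=.
  rewrite rnormM ler_wpM2r ?rnorm_ge0// rnorm_half.
  have := rnormD (k a) (k b); have := kM _ Ua; have := kM _ Ub; lra.
have Um := Uc _ _ Ua Ub.
have := IH _ _ Ua Um; have := IH _ _ Um Ub; rewrite mid_l mid_r.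
have := rnormD (trap n k a ((a + b) / 2)) (trap n k ((a + b) / 2) b); lra.
Qed.

Lemma trap_eq U n k1 k2 a b : mid_convex U -> U a -> U b ->
  (forall w, U w -> k1 w = k2 w) -> trap n k1 a b = trap n k2 a b.
Proof.
move=> Uc + + kE; elim: n a b => [|n IH] a b Ua Ub /=; first by rewrite !kE.
have Um := Uc _ _ Ua Ub; by rewrite !IH.
Qed.

Lemma mid_convex_ball p (r : R) : mid_convex [set w | rnorm (w - p) <= r].
Proof.
move=> a b /= ha hb.
have -> : (a + b) / 2 - p = (a - p) / 2 + (b - p) / 2 by field.
rewrite (le_trans (rnormD _ _))// !rnorm_half; lra.
Qed.

Lemma cdiff_ccont k p : cdiff k p -> ccont k p.
Proof.
move=> [D HD] e e0; have [d d0 Hd] := HD 1 ltr01.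
have D0 : 0 < 1 + rnorm D by have := rnorm_ge0 D; lra.
exists (Num.min d (e / (1 + rnorm D))); first by rewrite lt_min d0 divr_gt0.
move=> w; rewrite le_min => /andP[/Hd h1 h2].
have := rnormD (k w - k p - D * (w - p)) (D * (w - p)).
rewrite subrK rnormM.
move: h2; rewrite ler_pdivlMr// mulrDr; have := rnorm_ge0 (w - p); lra.
Qed.

(** By bisection: a segment both of whose halves have sums that finally
    oscillate by at most e' times their length is itself such a segment, and
    short segments near a point of continuity are. *)
Lemma trap_cauchy U k a b : mid_convex U -> seq_closed U ->
  (forall p, U p -> ccont k p) -> U a -> U b ->
  exists l, tends (fun n => trap n k a b) l.
Proof.
move=> Uc Ucl kc Ua Ub; apply: cauchy_tends => e e0.
have l1 : 0 < 1 + rnorm (b - a) by have := rnorm_ge0 (b - a); lra.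
pose e' := e / (1 + rnorm (b - a)).
have e'0 : 0 < e' by rewrite divr_gt0.
pose Inv (t : C * C) := U t.1 /\ U t.2.
pose G (t : C * C) := exists n0, forall m n, (n0 <= m)%N -> (n0 <= n)%N ->
  rnorm (trap m k t.1 t.2 - trap n k t.1 t.2) <= e' * rnorm (t.2 - t.1).
suff /(_ (a, b) (conj Ua Ub))[n0 H] : forall t, Inv t -> G t.
  exists n0 => m n hm hn; apply: le_trans (H m n hm hn) _ => /=.
  by rewrite /e' mulrAC ler_pdivrMr// ler_pM2l//; lra.
apply: (@bisection _ _ Inv G (fun t => rnorm (t.2 - t.1)) fst).
- by move=> t; exact: rnorm_ge0.
- move=> [x y] [/= Ux Uy] H; have Um := Uc _ _ Ux Uy.
  have [n1 H1] : G (x, (x + y) / 2).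
    by apply: H => /=; rewrite ?mid_l ?subrr ?rnorm0 ?rnorm_ge0.
  have [n2 H2] : G ((x + y) / 2, y).
    apply: H => /=; rewrite ?mid_r ?mid_l//.
    by have := rnorm_ge0 (y - x); lra.
  exists (maxn n1 n2).+1 => -[|m] [|n]//.
  rewrite !ltnS !geq_max => /andP[m1 m2] /andP[n1' n2'] /=.
  have := H1 m n m1 n1'; have := H2 m n m2 n2'; rewrite /= mid_l mid_r.
  set A := trap m k x _; set B := trap m k _ y; set A' := trap n k x _; set B' := trap n k _ y.
  have -> : A + B - (A' + B') = (A - A') + (B - B') by ring.
  have := rnormD (A - A') (B - B'); lra.
move=> u l uI ul; have Ul : U l by apply: (Ucl (fst \o u)) => // n; have [] := uI n.
have [d d0 Hd] := kc _ Ul (e' / 2) (divr_gt0 e'0 (ltr0n _ 2)).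
exists (d / 3); first by rewrite divr_gt0.
move=> [x y] [/= Ux Uy] xyd xl; exists 0%N => m n _ _ /=.
have tE j : trap j k x y = k l * (y - x) + trap j (fun w => k w + (-1) * k l) x y.
  rewrite (trap_lin j k (fun=> k l)).
  have := trap_affine j (k l) 0 x y; rewrite mul0r mul0r addr0 => <-.
  rewrite (@trap_eq setT j (fun w => k l + 0 * w) (fun=> k l))//.
    ring.
  by move=> w _; rewrite mul0r addr0.
have tB j : rnorm (trap j (fun w => k w + (-1) * k l) x y) <= e' / 2 * rnorm (y - x).
  apply: (@trap_bound [set w | rnorm (w - l) <= d]); first exact: mid_convex_ball.
  - by move=> /=; lra.
  - by move=> /=; have := rnorm_tri y x l; lra.
  by move=> w /Hd; rewrite mulN1r.
rewrite !tE; set A := trap m _ x y; set B := trap n _ x y.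
have -> : k l * (y - x) + A - (k l * (y - x) + B) = A - B by ring.
have := rnormB A B; have := tB m; have := tB n; rewrite -/A -/B; lra.
Qed.

End Trapezoid.

(** * Integrals along segments *)

Section Segment.
Variable R : realType.
Local Notation C := R[i].
Implicit Types (k : C -> C) (a b c p : C) (U : set C).

(** Closed convex sets; a holomorphic function on one of them has integrals
    along all its segments, with zero sum around each of its triangles. *)
Definition region U := mid_convex U /\ seq_closed U.

Definition segcv k a b := exists l, tends (fun n => trap n k a b) l.

Definition segint k a b : C := xget 0 [set l | tends (fun n => trap n k a b) l].

Lemma segintP k a b : segcv k a b -> tends (fun n => trap n k a b) (segint k a b).
Proof. by move=> [l kl]; exact: (xgetPex 0 (ex_intro _ l kl)). Qed.

Lemma segint_eq k a b l : tends (fun n => trap n k a b) l -> segint k a b = l.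
Proof. by move=> kl; apply: (tends_unique _ kl); apply: segintP; exists l. Qed.

Lemma region_segcv U k a b : region U -> (forall p, U p -> ccont k p) ->
  U a -> U b -> segcv k a b.
Proof. by move=> [Uc Us] kc Ua Ub; exact: trap_cauchy Uc Us kc Ua Ub. Qed.

Lemma segint_lin k1 k2 (x : C) a b : segcv k1 a b -> segcv k2 a b ->
  segint (fun w => k1 w + x * k2 w) a b = segint k1 a b + x * segint k2 a b.
Proof.
move=> c1 c2; apply: segint_eq.
rewrite (_ : (fun n => _) = fun n => trap n k1 a b + x * trap n k2 a b).
  by apply: tends_lin; exact: segintP.
by apply/funext => n; rewrite trap_lin.
Qed.

Lemma segintC k a b : segcv k a b -> segint k b a = - segint k a b.
Proof.
move=> c1; apply: segint_eq; rewrite -[X in tends _ X]mulN1r -[X in tends _ X]add0r.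
rewrite (_ : (fun n => _) = fun n => 0 + (-1) * trap n k a b).
  by apply: tends_lin; [exact: tends_const|exact: segintP].
by apply/funext => n; rewrite trapC mulN1r add0r.
Qed.

Lemma segint_cst (x : C) a b : segint (fun=> x) a b = x * (b - a).
Proof.
apply: segint_eq; rewrite (_ : (fun n => _) = fun=> x * (b - a)).
  exact: tends_const.
apply/funext => n; rewrite (_ : (fun=> x) = fun w => x + 0 * w) ?trap_affine.
  by rewrite !mul0r addr0.
by apply/funext => w; rewrite mul0r addr0.
Qed.

Lemma segcv_cst (x : C) a b : segcv (fun=> x) a b.
Proof.
exists (x * (b - a)); rewrite (_ : (fun n => _) = fun=> x * (b - a)).
  exact: tends_const.
apply/funext => n; rewrite (_ : (fun=> x) = fun w => x + 0 * w) ?trap_affine.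
  by rewrite !mul0r addr0.
by apply/funext => w; rewrite mul0r addr0.
Qed.

Lemma segcv_lin k1 k2 (x : C) a b : segcv k1 a b -> segcv k2 a b ->
  segcv (fun w => k1 w + x * k2 w) a b.
Proof.
move=> c1 c2; exists (segint k1 a b + x * segint k2 a b).
rewrite (_ : (fun n => _) = fun n => trap n k1 a b + x * trap n k2 a b).
  by apply: tends_lin; exact: segintP.
by apply/funext => n; rewrite trap_lin.
Qed.

Lemma segint_bound U k (M : R) a b : region U -> U a -> U b -> segcv k a b ->
  (forall w, U w -> rnorm (k w) <= M) -> rnorm (segint k a b) <= M * rnorm (b - a).
Proof.
move=> [Uc _] Ua Ub /segintP kc kM; apply: (tends_le kc) => n.
exact: trap_bound Uc Ua Ub kM.
Qed.

Lemma segint_ext U k1 k2 a b : region U -> U a -> U b ->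
  (forall w, U w -> k1 w = k2 w) -> segint k1 a b = segint k2 a b.
Proof.
move=> [Uc _] Ua Ub kE; rewrite /segint.
rewrite (_ : (fun n => trap n k1 a b) = (fun n => trap n k2 a b))//.
by apply/funext => n; exact: trap_eq Uc Ua Ub kE.
Qed.

(** Goursat's subdivision: the trapezoid rule is exact on the affine part of the
    function at the limit point, so the sum over a small triangle is of smaller
    order than its squared perimeter, a bound that survives subdivision into
    four. *)
Lemma goursat U k a b c : region U -> (forall p, U p -> cdiff k p) ->
  U a -> U b -> U c -> segint k a b + segint k b c + segint k c a = 0.
Proof.
move=> [Uc Ucl] kd Ua Ub Uc'.
pose tr n (t : C * C * C) := trap n k t.1.1 t.1.2 + trap n k t.1.2 t.2 + trap n k t.2 t.1.1.
have kc p : U p -> ccont k p by move=> /kd/cdiff_ccont.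
have cv x y : U x -> U y -> segcv k x y by exact: region_segcv.
suff S e : 0 < e -> exists n0, forall n, (n0 <= n)%N -> rnorm (tr n (a, b, c)) <= e.
  have T0 : tends (fun n => tr n (a, b, c)) 0.
    by move=> e /S[n0 H]; exists n0 => n /H; rewrite subr0.
  apply/esym/(tends_unique T0); rewrite /tr /=.
  rewrite -[segint k b c]mul1r -[segint k c a]mul1r.
  rewrite (_ : (fun n => _) = fun n => (trap n k a b + 1 * trap n k b c) + 1 * trap n k c a).
    by do ! apply: tends_lin; apply/segintP/cv.
  by apply/funext => n; rewrite !mul1r.
move=> e0; pose per (t : C * C * C) := rnorm (t.1.2 - t.1.1) + rnorm (t.2 - t.1.2) + rnorm (t.1.1 - t.2).
have per0 t : 0 <= per t by rewrite /per !addr_ge0 ?rnorm_ge0.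
pose Inv (t : C * C * C) := [/\ U t.1.1, U t.1.2 & U t.2].
pose e' := e / (1 + per (a, b, c) ^+ 2).
have p0 : 0 < 1 + per (a, b, c) ^+ 2 by rewrite ltr_wpDr ?sqr_ge0.
have e'0 : 0 < e' by rewrite divr_gt0.
pose G (t : C * C * C) := exists n0, forall n, (n0 <= n)%N -> rnorm (tr n t) <= e' * per t ^+ 2.
suff /(_ (a, b, c) (And3 Ua Ub Uc'))[n0 H] : forall t, Inv t -> G t.
  exists n0 => n hn; apply: le_trans (H n hn) _.
  by rewrite /e' mulrAC ler_pdivrMr// ler_pM2l//; lra.
apply: (@bisection _ _ Inv G per (fun t => t.1.1)) => //.
- move=> [[x y] z] [/= Ux Uy Uz] H.
  pose m1 := (x + y) / 2; pose m2 := (y + z) / 2; pose m3 := (z + x) / 2.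
  have U1 : U m1 by exact: Uc. have U2 : U m2 by exact: Uc. have U3 : U m3 by exact: Uc.
  pose p := per (x, y, z).
  have h1 : per (x, m1, m3) = p / 2.
    rewrite /p /per /= (_ : m1 - x = (y - x) / 2); last by rewrite /m1; field.
    rewrite (_ : m3 - m1 = - ((y - z) / 2)); last by rewrite /m1 /m3; field.
    rewrite (_ : x - m3 = (x - z) / 2); last by rewrite /m3; field.
    by rewrite rnormN !rnorm_half (rnormBC z y); lra.
  have h2 : per (m1, y, m2) = p / 2.
    rewrite /p /per /= (_ : y - m1 = (y - x) / 2); last by rewrite /m1; field.
    rewrite (_ : m2 - y = ((z - y) / 2)); last by rewrite /m2; field.
    rewrite (_ : m1 - m2 = (x - z) / 2); last by rewrite /m1 /m2; field.
    by rewrite !rnorm_half; lra.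
  have h3 : per (m3, m2, z) = p / 2.
    rewrite /p /per /= (_ : m2 - m3 = (y - x) / 2); last by rewrite /m2 /m3; field.
    rewrite (_ : z - m2 = ((z - y) / 2)); last by rewrite /m2; field.
    rewrite (_ : m3 - z = (x - z) / 2); last by rewrite /m3; field.
    by rewrite !rnorm_half; lra.
  have h4 : per (m2, m3, m1) = p / 2.
    rewrite /p /per /= (_ : m3 - m2 = (x - y) / 2); last by rewrite /m2 /m3; field.
    rewrite (_ : m1 - m3 = ((y - z) / 2)); last by rewrite /m1 /m3; field.
    rewrite (_ : m2 - m1 = (z - x) / 2); last by rewrite /m1 /m2; field.
    by rewrite !rnorm_half (rnormBC x y) (rnormBC y z) (rnormBC z x); lra.
  have q1 := rnorm_ge0 (y - x); have q2 := rnorm_ge0 (z - y); have q3 := rnorm_ge0 (x - z).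
  have pE : p = rnorm (y - x) + rnorm (z - y) + rnorm (x - z) by [].
  have d1 : rnorm (m1 - x) <= p by rewrite mid_l; lra.
  have d3 : rnorm (m3 - x) <= p.
    rewrite (_ : m3 - x = - ((x - z) / 2)); last by rewrite /m3; field.
    by rewrite rnormN rnorm_half; lra.
  have d2 : rnorm (m2 - x) <= p.
    rewrite (_ : m2 - x = ((y - x) - (x - z)) / 2); last by rewrite /m2; field.
    by rewrite rnorm_half; have := rnormB (y - x) (x - z); lra.
  have [n1 H1] : G (x, m1, m3) by apply: H => //=; rewrite ?h1// subrr rnorm0.
  have [n2 H2] : G (m1, y, m2) by apply: H => //=; rewrite ?h2.
  have [n3 H3] : G (m3, m2, z) by apply: H => //=; rewrite ?h3.
  have [n4 H4] : G (m2, m3, m1) by apply: H => //=; rewrite ?h4.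
  exists (maxn (maxn n1 n2) (maxn n3 n4)).+1 => -[//|n].
  rewrite ltnS !geq_max => /andP[/andP[/H1 + /H2 +] /andP[/H3 + /H4 +]].
  rewrite h1 h2 h3 h4.
  have -> : tr n.+1 (x, y, z) = tr n (x, m1, m3) + tr n (m1, y, m2) + (tr n (m3, m2, z) + tr n (m2, m3, m1)).
    rewrite /tr /= -/m1 -/m2 -/m3 (trapC n k m1 m3) (trapC n k m2 m3) (trapC n k m1 m2); ring.
  rewrite -/p; move: (tr n _) (tr n _) (tr n _) (tr n _) => t4 t3 t2 t1 k1 k2 k3 k4.
  have := rnormD (t1 + t2) (t3 + t4); have := rnormD t1 t2; have := rnormD t3 t4.
  have -> : e' * p ^+ 2 = 4 * (e' * (p / 2) ^+ 2) by field.
  move: (e' * (p / 2) ^+ 2) k1 k2 k3 k4 => q k1 k2 k3 k4; lra.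
move=> u l uI ul; have Ul : U l.
  by apply: (Ucl (fun n => (u n).1.1)) => // n; have [] := uI n.
have [D HD] := kd _ Ul; have [d d0 Hd] := HD (e' / 3) (divr_gt0 e'0 (ltr0n _ 3)).
exists (d / 3); first by rewrite divr_gt0.
move=> [[x y] z] [/= Ux Uy Uz] pd xl; exists 0%N => n _.
set p := per (x, y, z) in pd xl *.
pose rem w := k w + (-1) * ((k l - D * l) + D * w).
have q1 := rnorm_ge0 (y - x); have q2 := rnorm_ge0 (z - y); have q3 := rnorm_ge0 (x - z).
have pE : p = rnorm (y - x) + rnorm (z - y) + rnorm (x - z) by [].
have tE s t : trap n k s t = trap n rem s t + ((k l - D * l) * (t - s) + D * (t * t - s * s) / 2).
  by rewrite /rem (trap_lin n k (fun w => (k l - D * l) + D * w)) trap_affine; ring.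
have bnd w : rnorm (w - l) <= 3 * p -> rnorm (rem w) <= e' * p.
  move=> wl; rewrite /rem (_ : _ + _ = k w - k l - D * (w - l)); last by ring.
  have h : rnorm (w - l) <= d by lra.
  apply: le_trans (Hd w h) _; rewrite -mulrA ler_pM2l//; lra.
have U3 := @mid_convex_ball _ l (3 * p).
have hx : rnorm (x - l) <= 3 * p by have := per0 (x, y, z); rewrite -/p; lra.
have hy : rnorm (y - l) <= 3 * p by have := rnorm_tri y x l; lra.
have hz : rnorm (z - l) <= 3 * p by have := rnorm_tri z x l; rewrite (rnormBC z x); lra.
have b1 := @trap_bound _ _ n rem (e' * p) x y U3 hx hy bnd.
have b2 := @trap_bound _ _ n rem (e' * p) y z U3 hy hz bnd.
have b3 := @trap_bound _ _ n rem (e' * p) z x U3 hz hx bnd.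
rewrite /tr /= !tE.
set t1 := trap n rem x y in b1 *; set t2 := trap n rem y z in b2 *; set t3 := trap n rem z x in b3 *.
rewrite (_ : _ + _ = t1 + t2 + t3); last by field.
have := rnormD (t1 + t2) t3; have := rnormD t1 t2.
have : e' * p ^+ 2 = e' * p * rnorm (y - x) + e' * p * rnorm (z - y) + e' * p * rnorm (x - z).
  by rewrite -!mulrDr -pE; ring.
lra.
Qed.

End Segment.

(** * Complex differentiability and regions *)

Section ComplexDiff.
Variable R : realType.
Local Notation C := R[i].
Implicit Types (k : C -> C) (a b c p : C) (U : set C).

Lemma cdiff_cst c p : cdiff (fun=> c) p.
Proof.
exists 0 => e e0; exists 1 => // w _.
by rewrite subrr mul0r subrr rnorm0 mulr_ge0 ?rnorm_ge0// ltW.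
Qed.

Lemma cdiff_lin k1 k2 c p : cdiff k1 p -> cdiff k2 p ->
  cdiff (fun w => k1 w + c * k2 w) p.
Proof.
move=> [D1 H1] [D2 H2]; exists (D1 + c * D2) => e e0.
have c0 : 0 < 1 + rnorm c by have := rnorm_ge0 c; lra.
have e1 : 0 < e / (1 + rnorm c) by rewrite divr_gt0.
have [d1 d10 h1] := H1 _ e1; have [d2 d20 h2] := H2 _ e1.
exists (Num.min d1 d2); first by rewrite lt_min d10 d20.
move=> w; rewrite le_min => /andP[/h1 {}h1 /h2 {}h2].
rewrite [X in rnorm X <= _](_ : _ = (k1 w - k1 p - D1 * (w - p)) + c * (k2 w - k2 p - D2 * (w - p))); last by ring.
rewrite (le_trans (rnormD _ _))// rnormM.
apply: le_trans (lerD h1 (ler_wpM2l (rnorm_ge0 c) h2)) _.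
rewrite mulrA -mulrDl ler_wpM2r ?rnorm_ge0//.
by rewrite -[X in X + _]mul1r -mulrDl mulrC divfK// gt_eqF.
Qed.

Lemma cdiffM k1 k2 p : cdiff k1 p -> cdiff k2 p -> cdiff (fun w => k1 w * k2 w) p.
Proof.
move=> d1 d2; have [da da0 Ha] := cdiff_ccont d2 ltr01.
move: (d1) (d2) => [D1 H1] [D2 H2].
exists (D1 * k2 p + k1 p * D2) => e e0.
pose K := 1 + rnorm (k2 p) + rnorm D1 + rnorm (k1 p).
have K0 : 0 < K by rewrite /K; have := rnorm_ge0 (k2 p); have := rnorm_ge0 (k1 p); have := rnorm_ge0 D1; lra.
have e1 : 0 < e / K by rewrite divr_gt0.
have [db db0 Hb] := cdiff_ccont d2 e1.
have [dc dc0 Hc] := H1 _ e1; have [dd dd0 Hd] := H2 _ e1.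
exists (Num.min (Num.min da db) (Num.min dc dd)).
  by rewrite !lt_min da0 db0 dc0 dd0.
move=> w; rewrite !le_min => /andP[/andP[/Ha ha /Hb hb] /andP[/Hc hc /Hd hd]].
pose A := k1 w - k1 p - D1 * (w - p); pose B := k2 w - k2 p - D2 * (w - p).
rewrite [X in rnorm X <= _](_ : _ = A * k2 w + (D1 * (w - p) * (k2 w - k2 p) + k1 p * B)); last by rewrite /A /B; ring.
have k2w : rnorm (k2 w) <= 1 + rnorm (k2 p).
  by have := rnorm_subl (k2 w) (k2 p); lra.
have n0 := rnorm_ge0 (w - p).
have := rnormD (A * k2 w) (D1 * (w - p) * (k2 w - k2 p) + k1 p * B).
have := rnormD (D1 * (w - p) * (k2 w - k2 p)) (k1 p * B).
rewrite !rnormM.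
have hA : rnorm A * rnorm (k2 w) <= e / K * rnorm (w - p) * (1 + rnorm (k2 p)).
  by apply: ler_pM; rewrite ?rnorm_ge0.
have hB : rnorm (k1 p) * rnorm B <= rnorm (k1 p) * (e / K * rnorm (w - p)).
  by apply: ler_wpM2l; rewrite ?rnorm_ge0.
have hD : rnorm D1 * rnorm (w - p) * rnorm (k2 w - k2 p) <= rnorm D1 * rnorm (w - p) * (e / K).
  by apply: ler_wpM2l => //; rewrite mulr_ge0 ?rnorm_ge0.
have : e / K * rnorm (w - p) * (1 + rnorm (k2 p)) + (rnorm D1 * rnorm (w - p) * (e / K) + rnorm (k1 p) * (e / K * rnorm (w - p))) = e * rnorm (w - p).
  by rewrite -[in RHS](divfK (lt0r_neq0 K0) e) /K; ring.
lra.
Qed.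

Lemma cdiff_inv a p : p != a -> cdiff (fun w => (w - a)^-1) p.
Proof.
move=> pa; have pa0 : p - a != 0 by rewrite subr_eq0.
exists (- (p - a) ^- 2) => e e0.
pose m := rnorm (p - a); have m0 : 0 < m by rewrite rnorm_gt0.
exists (Num.min (m / 2) (e * m ^+ 3 / 2)).
  by rewrite lt_min !divr_gt0// mulr_gt0// exprn_gt0.
move=> w; rewrite le_min => /andP[h1 h2].
have wm : m / 2 <= rnorm (w - a).
  have := rnorm_tri p w a; rewrite (rnormBC p w) -/m; lra.
have wa0 : w - a != 0 by rewrite -rnorm_gt0; lra.
rewrite [X in rnorm X <= _](_ : _ = (w - p) * (w - p) / ((p - a) ^+ 2 * (w - a))); last first.
  by field; rewrite wa0 pa0.
rewrite !rnormM rnormV rnormM rnormX -/m -mulrA mulrC ler_wpM2r ?rnorm_ge0//.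
rewrite ler_pdivrMr; last by rewrite mulr_gt0 ?exprn_gt0// ?rnorm_gt0.
apply: le_trans h2 _; rewrite -mulrA ler_pM2l//.
rewrite exprSr -mulrA ler_pM2l ?exprn_gt0//.
Qed.

End ComplexDiff.

Section Regions.
Variable R : realType.
Local Notation C := R[i].
Implicit Types (a b c p : C) (U V : set C).

Lemma regionI U V : region U -> region V -> region (U `&` V).
Proof.
move=> [U1 U2] [V1 V2]; split=> [a b [? ?] [? ?]|u l uI ul].
  by split; [exact: U1|exact: V1].
by split; [apply: (U2 u)|apply: (V2 u)] => // n; have [] := uI n.
Qed.

Lemma region_ball c (r : R) : region [set w | rnorm (w - c) <= r].
Proof.
split; first exact: mid_convex_ball.
move=> u l ur ul /=; apply/ler_addgt0Pr => e e0.
have [n0 /(_ n0 (leqnn _)) h] := ul e e0.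
have := ur n0 => /=; have := rnorm_tri l (u n0) c; rewrite (rnormBC l (u n0)); lra.
Qed.

(** Half planes with normal direction nu keep a polygon side away from c. *)
Lemma region_half c (nu : C) (t : R) :
  region [set w | t <= complex.Re ((w - c) * nu^*)].
Proof.
split=> [a b /= ha hb|u l ur ul /=].
  rewrite (_ : ((a + b) / 2 - c) * nu^* = (1/2)%:C * ((a - c) * nu^* + (b - c) * nu^*)).
    move: ((a - c) * nu^*) ((b - c) * nu^*) ha hb => [x y] [x' y'] /=; lra.
  by rewrite rmorphM rmorph1/= fmorphV/= rmorph_nat; field.
apply/ler_addgt0Pr => e e0.
have K0 : 0 < 1 + rnorm nu by have := rnorm_ge0 nu; lra.
have [n0 /(_ n0 (leqnn _)) h] := ul _ (divr_gt0 e0 K0).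
have := ur n0 => /= h1.
have h2 : rnorm ((u n0 - l) * nu^*) <= e.
  rewrite rnormM rnormJ; move: h; rewrite ler_pdivlMr//.
  by have := rnorm_ge0 (u n0 - l); lra.
have := Re_le_rnorm ((u n0 - l) * nu^*).
have E : (u n0 - l) * nu^* = (u n0 - c) * nu^* - (l - c) * nu^* by ring.
rewrite E in h2 *; rewrite raddfB /= ler_norml => /andP[_ h3]; lra.
Qed.

Lemma Re_half_bound c (nu : C) (t : R) w : t <= complex.Re ((w - c) * nu^*) ->
  t <= rnorm (w - c) * rnorm nu.
Proof.
move=> h; rewrite -(rnormJ nu) -rnormM; apply: le_trans h _.
exact: le_trans (ler_norm _) (Re_le_rnorm _).
Qed.

Lemma Re_self (nu : C) : complex.Re (nu * nu^*) = rnorm nu ^+ 2.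
Proof. by rewrite rnormXsqr; case: nu => x y /=; ring. Qed.

(** A point mu close to nu lies well inside the half plane of inner normal nu. *)
Lemma Re_next (nu mu : C) : rnorm nu * (rnorm nu - rnorm (mu - nu)) <= complex.Re (mu * nu^*).
Proof.
have -> : mu * nu^* = nu * nu^* + (mu - nu) * nu^* by ring.
rewrite raddfD /= Re_self; have := Re_le_rnorm ((mu - nu) * nu^*).
rewrite rnormM rnormJ ler_norml => /andP[]; lra.
Qed.

End Regions.

(** * Integrals around regular polygons *)

Section Polygon.
Variable R : realType.
Local Notation C := R[i].
Implicit Types (k : C -> C) (a b c p : C).

(** Two closed polygons enclosing the same singularities: the quadrilateral
    between corresponding sides is split into two triangles, each lying in a
    region where the function is holomorphic; the contributions of the
    transversal sides telescope. *)
Lemma polygon_deform (N : nat) (w v : nat -> C) k (U : nat -> set C) :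
  (forall j, (j < N)%N -> [/\ region (U j), forall p, U j p -> cdiff k p,
     U j (w j) /\ U j (w j.+1) & U j (v j) /\ U j (v j.+1)]) ->
  w N = w 0%N -> v N = v 0%N ->
  \sum_(j < N) segint k (w j) (w j.+1) = \sum_(j < N) segint k (v j) (v j.+1).
Proof.
move=> H wN vN; apply/eqP; rewrite -subr_eq0 -sumrB; apply/eqP.
pose s j := segint k (w j) (v j).
transitivity (\sum_(j < N) (s j - s j.+1)).
  apply: eq_bigr => j _; have [Ur kd [Uw Uw'] [Uv Uv']] := H j (ltn_ord j).
  have cv x y : U j x -> U j y -> segcv k x y.
    by move=> Ux Uy; apply: (region_segcv Ur) => // p /kd/cdiff_ccont.
  have := goursat Ur kd Uw Uw' Uv'; have := goursat Ur kd Uw Uv' Uv.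
  rewrite (segintC (cv _ _ Uw Uv)) (segintC (cv _ _ Uv Uv')) (segintC (cv _ _ Uw Uv')).
  rewrite /s; move: (segint k _ _) (segint k _ _) (segint k _ _) (segint k _ _) (segint k _ _).
  move=> x1 x2 x3 x4 x5 h1 h2.
  apply/eqP; rewrite -subr_eq0; apply/eqP.
  move: (f_equal2 +%R h1 h2); rewrite addr0 => <-; ring.
rewrite -(big_mkord xpredT (fun j => s j - s j.+1)) /=.
rewrite (eq_bigr (fun j => - (s j.+1 - s j))); last by move=> j _; rewrite opprB.
by rewrite sumrN telescope_sumr// /s wN vN subrr oppr0.
Qed.

Section Roots.
Variables (om : C) (N : nat) (r eta : R).
Hypotheses (N0 : (0 < N)%N) (omN : om ^+ N = 1) (om1 : om != 1).
Hypotheses (r0 : 0 < r) (eta0 : 0 <= eta <= 4^-1) (ometa : rnorm (om - 1) <= eta).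
Hypothesis omn : rnorm om = 1.

Let eta_ge0 : 0 <= eta. Proof. by case/andP: eta0. Qed.
Let eta_le : eta <= 4^-1. Proof. by case/andP: eta0. Qed.
Let reta : 0 <= r * eta. Proof. by rewrite mulr_ge0// ltW. Qed.

Definition vtx j : C := r%:C * om ^+ j.

Lemma vtx_norm j : rnorm (vtx j) = r.
Proof. by rewrite /vtx rnormM rnorm_pos ?ltW// rnormX omn expr1n mulr1. Qed.

Lemma vtxN : vtx N = vtx 0%N.
Proof. by rewrite /vtx omN expr0. Qed.

Lemma vtx_step j : rnorm (vtx j.+1 - vtx j) = r * rnorm (om - 1).
Proof.
rewrite /vtx exprS (_ : _ - _ = r%:C * om ^+ j * (om - 1)); last by ring.
by rewrite rnormM -/(vtx j) vtx_norm.
Qed.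

Lemma vtx_step_le j : rnorm (vtx j.+1 - vtx j) <= r * eta.
Proof. by rewrite vtx_step ler_pM2l. Qed.

(** Shrinking the polygon towards a: its sides shrink in proportion to the distance
    from a, and the function grows more slowly than the inverse distance. *)
Lemma polygon_shrink k a : rnorm a < r * (1 - eta) ->
  (forall w, rnorm w <= r -> w != a -> cdiff k w) ->
  (forall e, 0 < e -> exists2 d, 0 < d & forall w, w != a -> rnorm (w - a) <= d ->
     rnorm (k w) * rnorm (w - a) <= e) ->
  \sum_(j < N) segint k (vtx j) (vtx j.+1) = 0.
Proof.
move=> ar kd ka; have a0 := rnorm_ge0 a.
pose nu j := vtx j - a; pose c0 := r * (1 - eta) - rnorm a.
have c00 : 0 < c0 by rewrite /c0; lra.
have nuc j : c0 + r * eta <= rnorm (nu j).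
  by have := rnorm_subl (vtx j) a; rewrite vtx_norm /c0 /nu; lra.
have nu2 j : rnorm (nu j) <= 2 * r.
  have := rnormB (vtx j) a; rewrite vtx_norm /nu.
  have := reta; lra.
have rn0 j : 0 < rnorm (nu j).
  by have := nuc j; have := reta; lra.
have dnu j : nu j.+1 - nu j = vtx j.+1 - vtx j by rewrite /nu; ring.
pose kap j := rnorm (nu j) * c0.
have kap0 j : 0 < kap j by rewrite mulr_gt0.
have Rej j : kap j <= complex.Re (nu j * (nu j)^*).
  rewrite Re_self expr2 ler_pM2l//; have := nuc j.
  have := reta; lra.
have Rej' j : kap j <= complex.Re (nu j.+1 * (nu j)^*).
  apply: le_trans (Re_next _ _); rewrite ler_pM2l// dnu.
  by have := nuc j; have := vtx_step_le j; lra.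
pose w (s : R) j := a + s%:C * nu j.
have wa s j : w s j - a = s%:C * nu j by rewrite /w; ring.
pose U (s : R) j := [set p | rnorm (p - 0) <= r] `&`
  [set p | s * kap j <= complex.Re ((p - a) * (nu j)^*)].
have Ureg s j : region (U s j) by apply: regionI; [exact: region_ball|exact: region_half].
have ReZ (s : R) (z : C) : complex.Re (s%:C * z) = s * complex.Re z.
  by case: z => x y /=; ring.
have wr t i : 0 <= t <= 1 -> rnorm (w t i) <= r.
  move=> /andP[t0 t1]; have -> : w t i = (1 - t)%:C * a + t%:C * vtx i.
    by rewrite /w /nu rmorphB rmorph1; ring.
  rewrite (le_trans (rnormD _ _))// (rnormM (1 - t)%:C) (rnormM t%:C) vtx_norm !rnorm_pos; try lra.
  have : (1 - t) * rnorm a <= (1 - t) * r.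
    by rewrite ler_wpM2l//; have := reta; lra.
  lra.
have wU s t j : 0 <= s <= t -> t <= 1 -> U s j (w t j) /\ U s j (w t j.+1).
  move=> /andP[s0 st] t1; have t01 : 0 <= t <= 1 by apply/andP; split; lra.
  by split; split; rewrite /= ?subr0 ?wr// wa -mulrA ReZ;
    apply: ler_pM => //; exact: ltW.
have Uc s j p : 0 < s -> U s j p -> s * c0 <= rnorm (p - a).
  move=> s0 [_ /= /Re_half_bound]; rewrite /kap mulrCA mulrC.
  by rewrite ler_pM2r.
have Ukd s j p : 0 < s -> U s j p -> cdiff k p.
  move=> s0 Up; apply: kd; first by case: Up => /=; rewrite subr0.
  rewrite -subr_eq0 -rnorm_gt0; apply: lt_le_trans (Uc _ _ _ s0 Up).
  exact: mulr_gt0.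
have w1 j : w 1 j = vtx j by rewrite /w /nu rmorph1; ring.
have wN s : w s N = w s 0%N by rewrite /w /nu vtxN.
have shr s : 0 < s <= 1 ->
    \sum_(j < N) segint k (vtx j) (vtx j.+1) = \sum_(j < N) segint k (w s j) (w s j.+1).
  move=> /andP[s0 s1].
  transitivity (\sum_(j < N) segint k (w 1 j) (w 1 j.+1)).
    by apply: eq_bigr => j _; rewrite !w1.
  apply: (@polygon_deform _ _ _ _ (U s)) => // j _; split => //.
  - by move=> p; exact: Ukd.
  - by apply: wU; rewrite ?(ltW s0) ?s1.
  - by apply: wU; rewrite ?(ltW s0) ?lexx.
have N0' : 0 < N%:R :> R by rewrite ltr0n.
apply: (@rnorm_small_eq0 _ _ _ (N%:R / c0 * (r * eta))).
  by rewrite mulr_ge0// ?divr_ge0 ?mulr_ge0 ?ltW//; lra.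
move=> e e0; have [d d0 Hd] := ka e e0.
pose s := Num.min 1 (d / (2 * r)).
have s0 : 0 < s by rewrite lt_min ltr01 divr_gt0// mulr_gt0.
have s1 : s <= 1 by rewrite ge_min lexx.
have sd : s * (2 * r) <= d by rewrite -ler_pdivlMr ?mulr_gt0// ge_min lexx orbT.
rewrite (shr s) ?s0//; apply: le_trans (rnorm_sum _ _ _) _.
apply: (@le_trans _ _ (\sum_(j < N) (e / (s * c0) * (s * (r * eta))))); last first.
  rewrite sumr_const card_ord -mulr_natl le_eqVlt; apply/orP; left; apply/eqP.
  by field; rewrite !gt_eqF.
apply: ler_sum => j _.
have [Uw Uw'] : U s j (w s j) /\ U s j (w s j.+1) by apply: wU; rewrite ?(ltW s0) ?lexx.
have cv : segcv k (w s j) (w s j.+1).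
  by apply: (region_segcv (Ureg s j)) => // p /(Ukd _ _ _ s0)/cdiff_ccont.
pose V := U s j `&` [set p | rnorm (p - a) <= d].
have Vr : region V by apply: regionI; [exact: Ureg|exact: region_ball].
have wd i : rnorm (w s i - a) <= d.
  rewrite wa rnormM rnorm_pos ?(ltW s0)//; apply: le_trans sd.
  by rewrite ler_pM2l.
have Vw : V (w s j) by split => //; exact: wd.
have Vw' : V (w s j.+1) by split => //; exact: wd.
have kV p : V p -> rnorm (k p) <= e / (s * c0).
  move=> [Up /= pd]; have h := Uc _ _ _ s0 Up.
  have sc : 0 < s * c0 by exact: mulr_gt0.
  have pa : p != a by rewrite -subr_eq0 -rnorm_gt0; lra.
  rewrite ler_pdivlMr//; apply: le_trans (Hd p pa pd).
  by rewrite ler_wpM2l ?rnorm_ge0.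
apply: le_trans (segint_bound Vr Vw Vw' cv kV) _.
rewrite ler_pM2l; last by rewrite divr_gt0// mulr_gt0.
rewrite (_ : w s j.+1 - w s j = s%:C * (vtx j.+1 - vtx j)); last first.
  by rewrite /w /nu; ring.
rewrite rnormM rnorm_pos ?(ltW s0)// ler_pM2l//; exact: vtx_step_le.
Qed.

(** Expanding the polygon: the length of its sides grows linearly, and the
    function decays quadratically. *)
Lemma polygon_expand k (B : R) : 0 <= B ->
  (forall w, r * (1 - eta) <= rnorm w -> cdiff k w) ->
  (forall w, r * (1 - eta) <= rnorm w -> rnorm (k w) <= B / rnorm w ^+ 2) ->
  \sum_(j < N) segint k (vtx j) (vtx j.+1) = 0.
Proof.
move=> B0 kd kB.
pose w (t : R) j := t%:C * vtx j; pose rho := r * (1 - eta).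
have rho0 : 0 < rho by rewrite mulr_gt0//; have := eta_le; lra.
pose U (s : R) j := [set p | s * (rho * r) <= complex.Re ((p - 0) * (vtx j)^*)].
have Ureg s j : region (U s j) by exact: region_half.
have ReZ (s : R) (z : C) : complex.Re (s%:C * z) = s * complex.Re z.
  by case: z => x y /=; ring.
have re0 := reta.
have wRe t i j : complex.Re ((w t i - 0) * (vtx j)^*) = t * complex.Re (vtx i * (vtx j)^*).
  by rewrite subr0 /w -(mulrA t%:C) ReZ.
have wU s t j : 0 <= s <= t -> U s j (w t j) /\ U s j (w t j.+1).
  move=> /andP[s0 st]; split; rewrite /U/= wRe; apply: ler_pM => //.
  - by rewrite mulr_ge0// ltW.
  - by rewrite Re_self vtx_norm expr2 ler_pM2r// /rho; lra.
  - by rewrite mulr_ge0// ltW.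
  - apply: le_trans (Re_next _ _); rewrite vtx_norm mulrC ler_pM2l// /rho.
    by have := vtx_step_le j; lra.
have Uc s j p : U s j p -> s * rho <= rnorm p.
  by rewrite /U/= => /Re_half_bound; rewrite subr0 vtx_norm mulrA ler_pM2r.
have Ukd s j p : 1 <= s -> U s j p -> cdiff k p.
  move=> s1 /Uc h; apply: kd; apply: le_trans h.
  by rewrite -/rho -[leLHS]mul1r ler_pM2r.
have w1 j : w 1 j = vtx j by rewrite /w rmorph1; ring.
have wN s : w s N = w s 0%N by rewrite /w vtxN.
have expd t : 1 <= t ->
    \sum_(j < N) segint k (vtx j) (vtx j.+1) = \sum_(j < N) segint k (w t j) (w t j.+1).
  move=> t1.
  transitivity (\sum_(j < N) segint k (w 1 j) (w 1 j.+1)).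
    by apply: eq_bigr => j _; rewrite !w1.
  apply: (@polygon_deform _ _ _ _ (U 1)) => // j _; split => //.
  - by move=> p; exact: Ukd.
  - by apply: wU; rewrite ler01 lexx.
  - by apply: wU; rewrite ler01.
pose K := N%:R * (B / rho ^+ 2 * (r * eta)).
have K0 : 0 <= K by rewrite mulr_ge0// mulr_ge0// divr_ge0// exprn_ge0// ltW.
apply: (@rnorm_small_eq0 _ _ _ K) => // e e0.
pose t := Num.max 1 e^-1.
have t1 : 1 <= t by rewrite le_max lexx.
have t0 : 0 < t by lra.
have te : t^-1 <= e by rewrite -[leRHS]invrK lef_pV2 ?posrE ?invr_gt0// le_max lexx orbT.
rewrite (expd t)//; apply: le_trans (rnorm_sum _ _ _) _.
apply: (@le_trans _ _ (\sum_(j < N) (B / (t * rho) ^+ 2 * (t * (r * eta))))); last first.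
  rewrite sumr_const card_ord -mulr_natl; apply: le_trans (ler_wpM2l K0 te).
  rewrite le_eqVlt; apply/orP; left; apply/eqP; rewrite /K.
  by field; rewrite !gt_eqF.
apply: ler_sum => j _.
have [Uw Uw'] : U t j (w t j) /\ U t j (w t j.+1) by apply: wU; rewrite ?(ltW t0) ?lexx.
have cv : segcv k (w t j) (w t j.+1).
  by apply: (region_segcv (Ureg t j)) => // p /(Ukd _ _ _ t1)/cdiff_ccont.
have kV p : U t j p -> rnorm (k p) <= B / (t * rho) ^+ 2.
  move=> /Uc h; have tr0 : 0 < t * rho by exact: mulr_gt0.
  have h' : rho <= rnorm p by apply: le_trans h; rewrite -[leLHS]mul1r ler_pM2r.
  apply: le_trans (kB p h') _; rewrite ler_wpM2l// lef_pV2 ?posrE ?exprn_gt0//; last lra.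
  by rewrite ler_pXn2r// nnegrE ?rnorm_ge0// ltW.
apply: le_trans (segint_bound (Ureg t j) Uw Uw' cv kV) _.
apply: ler_wpM2l; first by rewrite divr_ge0// exprn_ge0// mulr_ge0// ltW.
rewrite (_ : w t j.+1 - w t j = t%:C * (vtx j.+1 - vtx j)); last first.
  by rewrite /w; ring.
rewrite rnormM rnorm_pos ?(ltW t0)// ler_pM2l//; exact: vtx_step_le.
Qed.

End Roots.
End Polygon.

(** * Roots of unity close to 1 *)

Section DyadicRoots.
Variable R : realType.
Local Notation C := R[i].

(** The iterated principal square roots of -1: a primitive root of unity of
    order 2^(n+1), tending to 1. *)
Definition droot (n : nat) : C := iter n (@sqrtc R) (-1).

Lemma drootX n : droot n ^+ (2 ^ n) = -1.
Proof. by elim: n => [|n IH]; rewrite ?expr1// expnS exprM /droot iterS sqr_sqrtc. Qed.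

Lemma droot1 n : droot n ^+ (2 ^ n.+1) = 1.
Proof. by rewrite expnSr exprM drootX sqrrN expr1n. Qed.

Lemma droot_neq1 n : droot n != 1.
Proof.
apply/eqP => E; have := drootX n; rewrite E expr1n => /eqP.
by rewrite -subr_eq0 opprK -(natrD _ 1 1) pnatr_eq0.
Qed.

Lemma droot_norm n : rnorm (droot n) = 1.
Proof.
elim: n => [|n IH]; first by rewrite rnormN rnorm1.
apply/eqP; rewrite -(@eqrXn2 _ 2) ?rnorm_ge0// -rnormX /droot iterS sqr_sqrtc.
by rewrite expr1n; apply/eqP.
Qed.

Lemma Re_sqrtc_ge0 (x : C) : 0 <= complex.Re (sqrtc x).
Proof. by case: x => a b; rewrite /sqrtc /= sqrtr_ge0. Qed.

(** A principal square root w has nonnegative real part, so |w + 1|^2 >= 2 when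
    |w| = 1, and |w - 1| |w + 1| is the distance of its square from 1. *)
Lemma droot_near1 n : rnorm (droot n - 1) ^+ 2 <= 4 * 2^-1 ^+ n.
Proof.
elim: n => [|n IH].
  have -> : droot 0 - 1 = - 2%:R by rewrite /droot /=; ring.
  by rewrite expr0 mulr1 rnormN rnorm_nat; lra.
have E : (droot n.+1 - 1) * (droot n.+1 + 1) = droot n - 1.
  by rewrite -subr_sqr expr1n /droot iterS sqr_sqrtc.
have h : 2 <= rnorm (droot n.+1 + 1) ^+ 2.
  have h0 : 0 <= complex.Re (droot n.+1) by rewrite /droot iterS Re_sqrtc_ge0.
  have h1 := droot_norm n.+1; have := rnormXsqr (droot n.+1); rewrite h1 rnormXsqr.
  by case: (droot n.+1) h0 => x y /= x0; rewrite addr0 sqrrD; lra.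
have : rnorm (droot n.+1 - 1) ^+ 2 * 2 <= rnorm (droot n - 1) ^+ 2.
  by rewrite -E rnormM exprMn ler_wpM2l// sqr_ge0.
rewrite (exprSr _ n); lra.
Qed.

Lemma droot_close (eta : R) : 0 < eta -> exists n, rnorm (droot n - 1) <= eta.
Proof.
move=> e0; have [|n0 /(_ n0 (leqnn _)) H] := @geometric_small R 4 2^-1 (eta ^+ 2) _ (exprn_gt0 2 e0).
  by apply/andP; split; lra.
exists n0; rewrite -(@ler_pXn2r _ 2)// ?nnegrE ?rnorm_ge0 ?(ltW e0)//.
exact: le_trans (droot_near1 n0) H.
Qed.

Lemma droot_prim n : (2 ^ n.+1).-primitive_root (droot n).
Proof.
have [|m pm mn] := @prim_order_exists _ (2 ^ n.+1) (droot n) _ (droot1 n).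
  by rewrite expn_gt0.
have /(dvdn_pfactor m n.+1 (isT : prime 2))[e en mE] := mn; rewrite mE in pm.
suff -> : n.+1 = e by [].
apply/eqP; rewrite eqn_leq en andbT leqNgt; apply/negP => en'.
have : droot n ^+ (2 ^ n) = 1.
  apply/eqP; rewrite -(prim_order_dvd pm); apply: dvdn_exp2l; by rewrite -ltnS.
rewrite drootX => /eqP; rewrite -subr_eq0 -opprD oppr_eq0 -(natrD _ 1 1).
by rewrite pnatr_eq0.
Qed.

End DyadicRoots.

(** * Power series expansion in a disc *)

Section Cauchy.
Variable R : realType.
Local Notation C := R[i].
Implicit Types (k h : C -> C) (a b c p : C).

Section OnPolygon.
Variables (om : C) (N : nat) (r eta : R).
Hypotheses (N0 : (0 < N)%N) (omN : om ^+ N = 1) (om1 : om != 1).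
Hypotheses (r0 : 0 < r) (eta0 : 0 <= eta <= 4^-1) (ometa : rnorm (om - 1) <= eta).
Hypothesis omn : rnorm om = 1.

Let eta_ge0 : 0 <= eta. Proof. by case/andP: eta0. Qed.
Let eta_le : eta <= 4^-1. Proof. by case/andP: eta0. Qed.
Let reta : 0 <= r * eta. Proof. by rewrite mulr_ge0// ltW. Qed.
Let rho := r * (1 - eta).
Let rho0 : 0 < rho. Proof. by rewrite mulr_gt0//; have := eta_le; lra. Qed.
Local Notation v := (vtx om r).

Let annulus : set C := [set w | rho <= rnorm w <= r * (1 + eta)].
Let D j : set C := [set w | rnorm (w - v j) <= r * eta].

Let DA j w : D j w -> annulus w.
Proof.
rewrite /D /annulus/= => h; have := rnorm_subl (v j) w; have := rnorm_subl w (v j).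
rewrite (rnormBC (v j) w) (vtx_norm r0 omn) /rho; move=> h1 h2.
by apply/andP; split; lra.
Qed.

Let Dv j : D j (v j). Proof. by rewrite /D/= subrr rnorm0. Qed.
Let Dv' j : D j (v j.+1). Proof. exact: vtx_step_le. Qed.

Let L k := \sum_(j < N) segint k (v j) (v j.+1).
Let adm k := forall w, annulus w -> cdiff k w.

Let adm_cv k j : adm k -> segcv k (v j) (v j.+1).
Proof.
move=> ka; apply: (region_segcv (region_ball (v j) (r * eta))); [|exact: Dv|exact: Dv'].
by move=> p /DA/ka/cdiff_ccont.
Qed.

Let L_lin k1 k2 (x : C) : adm k1 -> adm k2 ->
  L (fun w => k1 w + x * k2 w) = L k1 + x * L k2.
Proof.
move=> a1 a2; rewrite /L mulr_sumr -big_split /=; apply: eq_bigr => j _.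
by rewrite segint_lin//; exact: adm_cv.
Qed.

Let L_ext k1 k2 : (forall w, annulus w -> k1 w = k2 w) -> L k1 = L k2.
Proof.
move=> kE; apply: eq_bigr => j _.
apply: (segint_ext (region_ball (v j) (r * eta))); [exact: Dv|exact: Dv'|].
by move=> w /DA; exact: kE.
Qed.

Let L_bound k (B : R) : adm k -> (forall w, annulus w -> rnorm (k w) <= B) ->
  rnorm (L k) <= N%:R * (B * (r * rnorm (om - 1))).
Proof.
move=> ka kB; apply: le_trans (rnorm_sum _ _ _) _.
rewrite mulr_natl -[X in _ *+ X]card_ord -sumr_const; apply: ler_sum => j _.
rewrite -(vtx_step r0 omn j).
apply: (segint_bound (region_ball (v j) (r * eta))); [exact: Dv|exact: Dv'| |].
  exact: adm_cv.
by move=> w /DA; exact: kB.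
Qed.

Let ann_gt0 w : annulus w -> 0 < rnorm w.
Proof. by move=> /andP[h _]; apply: lt_le_trans h. Qed.

Let adm_inv a : rnorm a < rho -> adm (fun w => (w - a)^-1).
Proof.
move=> ar w /andP[h _]; apply: cdiff_inv; apply/eqP => wa.
by move: h; rewrite wa leNgt ar.
Qed.

Let W := L (fun w => w^-1).

Let adm_V : adm (fun w => w^-1).
Proof.
have := @adm_inv 0; rewrite rnorm0 => /(_ rho0).
by rewrite (_ : (fun w => (w - 0)^-1) = (fun w => w^-1))//; apply/funext => w; rewrite subr0.
Qed.

(** The winding number times 2 pi i.  Each side contributes om - 1, up to a
    third of its modulus; this crude bound suffices, as W is only ever divided
    by. *)
Let winding_neq0 : N%:R * rnorm (om - 1) / 2 <= rnorm W.
Proof.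
have o0 : 0 < rnorm (om - 1) by rewrite rnorm_gt0 subr_eq0.
have E j : segint (fun w => w^-1) (v j) (v j.+1) =
    (om - 1) + segint (fun w => w^-1 + (-1) * (v j)^-1) (v j) (v j.+1).
  rewrite (@segint_lin _ (fun w => w^-1) (fun=> (v j)^-1)); first last.
  - exact: segcv_cst.
  - exact/adm_cv/adm_V.
  rewrite segint_cst; have vj : v j != 0 by rewrite -rnorm_gt0 (vtx_norm r0 omn).
  have -> : (v j)^-1 * (v j.+1 - v j) = om - 1.
    by rewrite (_ : v j.+1 = v j * om) ?/vtx ?exprSr ?mulrA// -[X in _ - X]mulr1 -mulrBr mulKf.
  ring.
have B j : rnorm (segint (fun w => w^-1 + (-1) * (v j)^-1) (v j) (v j.+1)) <= rnorm (om - 1) / 3.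
  have vj : v j != 0 by rewrite -rnorm_gt0 (vtx_norm r0 omn).
  apply: (@le_trans _ _ ((r * 3)^-1 * (r * rnorm (om - 1)))); last first.
    by rewrite le_eqVlt; apply/orP; left; apply/eqP; field; rewrite !gt_eqF.
  rewrite -(vtx_step r0 omn j).
  apply: (segint_bound (region_ball (v j) (r * eta))); [exact: Dv|exact: Dv'| |].
    apply: segcv_lin; last exact: segcv_cst.
    exact/adm_cv/adm_V.
  move=> w wD; have wA := DA wD; have w0 := ann_gt0 wA.
  have wn : w != 0 by rewrite -rnorm_gt0.
  rewrite mulN1r (_ : w^-1 - (v j)^-1 = (v j - w) * (w^-1 * (v j)^-1)); last by field; rewrite wn vj.
  rewrite rnormM rnormM !rnormV (vtx_norm r0 omn) rnormBC.
  apply: (@le_trans _ _ (r * eta * (rho^-1 * r^-1))).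
    apply: ler_pM => //; rewrite ?rnorm_ge0 ?mulr_ge0 ?invr_ge0 ?rnorm_ge0 ?(ltW r0)//.
    rewrite ler_pM2r ?invr_gt0// lef_pV2 ?posrE//.
    by case/andP: wA.
  have e1 : 0 < 1 - eta by have := eta_le; lra.
  rewrite (_ : _ * (_ * _) = eta / (1 - eta) / r); last first.
    by rewrite /rho; field; rewrite !gt_eqF.
  rewrite (_ : (r * 3)^-1 = 3^-1 / r); last by field; rewrite gt_eqF.
  rewrite ler_pM2r ?invr_gt0// ler_pdivrMr//; have := eta_le; lra.
have WE : W = N%:R * (om - 1) + \sum_(j < N) segint (fun w => w^-1 + (-1) * (v j)^-1) (v j) (v j.+1).
  rewrite mulr_natl -[X in _ *+ X]card_ord -sumr_const -big_split /=.
  by apply: eq_bigr => j _; exact: E.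
have S : rnorm (\sum_(j < N) segint (fun w => w^-1 + (-1) * (v j)^-1) (v j) (v j.+1)) <= N%:R * (rnorm (om - 1) / 3).
  apply: le_trans (rnorm_sum _ _ _) _.
  by rewrite mulr_natl -[X in _ *+ X]card_ord -sumr_const; apply: ler_sum => j _.
have := rnorm_subl (N%:R * (om - 1)) (N%:R * (om - 1) - W).
rewrite opprB addrCA subrr addr0 {1}WE opprD addrA subrr add0r rnormN rnormM rnorm_nat.
have : 0 <= N%:R * rnorm (om - 1) by rewrite mulr_ge0// rnorm_ge0.
lra.
Qed.

(** The difference of 1/(w - a) and 1/w decays quadratically, so its integral
    vanishes by expanding the polygon. *)
Let winding a : rnorm a < rho -> L (fun w => (w - a)^-1) = W.
Proof.
move=> ar; have a0 := rnorm_ge0 a.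
have E : L (fun w => (w - a)^-1 + (-1) * w^-1) = 0.
  pose B := rnorm a / (1 - rnorm a / rho).
  have q0 : 0 < 1 - rnorm a / rho by rewrite subr_gt0 ltr_pdivrMr// mul1r.
  apply: (@polygon_expand _ om N r eta omN r0 eta0 ometa omn _ B).
  - by rewrite divr_ge0// ltW.
  - move=> w wr; apply: (@cdiff_lin _ (fun w => (w - a)^-1) (fun w => w^-1)).
      by apply: cdiff_inv; apply/eqP => wa; move: wr; rewrite wa leNgt ar.
    rewrite (_ : (fun w => w^-1) = (fun w => (w - 0)^-1)); last by apply/funext => z; rewrite subr0.
    by apply: cdiff_inv; rewrite -rnorm_gt0; apply: lt_le_trans wr.
  move=> w wr; have w0 : 0 < rnorm w by apply: lt_le_trans wr.
  have wa : rnorm w * (1 - rnorm a / rho) <= rnorm (w - a).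
    apply: le_trans (rnorm_subl w a); rewrite mulrBr mulr1 lerB//.
    by rewrite mulrCA ler_peMr// ler_pdivlMr// mul1r.
  have wa0 : 0 < rnorm (w - a) by apply: lt_le_trans wa; rewrite mulr_gt0.
  rewrite mulN1r (_ : (w - a)^-1 - w^-1 = a / (w * (w - a))); last first.
    by field; rewrite -!rnorm_gt0 w0 wa0.
  rewrite rnormM rnormV rnormM /B -mulrA -invfM ler_wpM2l// lef_pV2 ?posrE ?mulr_gt0//.
    by rewrite mulrC expr2 -mulrA ler_pM2l.
have := E; rewrite (L_lin (-1) (adm_inv ar) adm_V) mulN1r => /eqP.
by rewrite subr_eq0 => /eqP.
Qed.

Variables (h : C -> C) (M : R).
Hypothesis hd : forall w, rnorm w <= r * (1 + eta) -> cdiff h w.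
Hypothesis hM : forall w, rnorm w <= r * (1 + eta) -> rnorm (h w) <= M.

Let M0 : 0 <= M.
Proof.
apply: le_trans (rnorm_ge0 (h 0)) (hM _); rewrite rnorm0; have := reta; have := ltW r0; lra.
Qed.

Let adm_h : adm h. Proof. by move=> w /andP[_ w1]; exact: hd. Qed.

(** Shrinking the polygon to a: the product of w - a with the difference quotient
    of h at a tends to 0. *)
Let cauchy_formula a : rnorm a < rho -> L (fun w => h w * (w - a)^-1) = h a * W.
Proof.
move=> ar.
have ar' : rnorm a <= r by have := ltW ar; have := reta; rewrite /rho; lra.
have ha : cdiff h a by apply: hd; have := reta; lra.
have S : L (fun w => (h w + (-1) * h a) * (w - a)^-1) = 0.
  apply: (@polygon_shrink _ om N r eta N0 omN r0 eta0 ometa omn _ a) => //.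
    move=> w wr wa; apply: cdiffM; last exact: cdiff_inv.
    by apply: (@cdiff_lin _ h (fun=> h a)); [apply: hd; have := reta; lra|exact: cdiff_cst].
  move=> e e0; have [d d0 H] := cdiff_ccont ha e0; exists d => // w wa wd.
  rewrite mulN1r rnormM rnormV divfK; last by rewrite rnorm_eq0 subr_eq0.
  exact: H.
rewrite -(winding ar); apply/eqP; rewrite -subr_eq0 -mulNr; apply/eqP.
have ah : adm (fun w => h w * (w - a)^-1).
  by move=> w wA; apply: cdiffM; [exact: adm_h|exact: adm_inv].
rewrite -(L_lin (- h a) ah (adm_inv ar)) -[RHS]S.
by apply: L_ext => w _; ring.
Qed.

Let adm_pow n : adm (fun w => h w * w^-1 ^+ n).
Proof.
move=> w wA; elim: n => [|n IH].
  rewrite (_ : (fun w => _) = h); first exact: adm_h.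
  by apply/funext => z; rewrite expr0 mulr1.
rewrite (_ : (fun w => _) = (fun z => (h z * z^-1 ^+ n) * z^-1)).
  by apply: cdiffM => //; exact: adm_V.
by apply/funext => z; rewrite exprSr mulrA.
Qed.

Let adm_powa n a : rnorm a < rho -> adm (fun w => h w * w^-1 ^+ n * (w - a)^-1).
Proof. by move=> ar w wA; apply: cdiffM; [exact: adm_pow|exact: adm_inv]. Qed.

Let W_neq0 : W != 0.
Proof.
rewrite -rnorm_gt0; apply: lt_le_trans winding_neq0.
by rewrite divr_gt0// mulr_gt0 ?ltr0n// rnorm_gt0 subr_eq0.
Qed.

(** The geometric expansion of 1/(w - a) in Cauchy's formula, with its remainder;
    the factor N |om - 1| of the remainder cancels against the lower bound on the
    winding number. *)
Lemma polygon_taylor : exists c : nat -> C, forall n a, rnorm a < rho ->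
  rnorm (h a - \sum_(l < n) c l * a ^+ l) <=
    2 * r * M / (rho - rnorm a) * (rnorm a / rho) ^+ n.
Proof.
exists (fun l => L (fun w => h w * w^-1 ^+ l.+1) / W) => n a ar.
have E : h a * W = \sum_(l < n) L (fun w => h w * w^-1 ^+ l.+1) * a ^+ l
    + a ^+ n * L (fun w => h w * w^-1 ^+ n * (w - a)^-1).
  elim: n => [|n IH].
    rewrite big_ord0 add0r expr0 mul1r -(cauchy_formula ar).
    by apply: L_ext => w _; rewrite expr0 mulr1.
  rewrite IH big_ord_recr /= -addrA; congr (_ + _).
  rewrite (@L_ext _ (fun w => h w * w^-1 ^+ n.+1 + a * (h w * w^-1 ^+ n.+1 * (w - a)^-1))).
    rewrite (L_lin _ (@adm_pow n.+1) (@adm_powa n.+1 a ar)) exprSr; ring.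
  move=> w wA; have w0 : w != 0 by rewrite -rnorm_gt0 ann_gt0.
  have wa : w - a != 0.
    by rewrite subr_eq0; apply/eqP => wa; case/andP: wA; rewrite wa leNgt ar.
  by rewrite exprSr; field; rewrite w0 wa.
have Q : h a - \sum_(l < n) L (fun w => h w * w^-1 ^+ l.+1) / W * a ^+ l =
    a ^+ n * L (fun w => h w * w^-1 ^+ n * (w - a)^-1) / W.
  apply: (mulIf W_neq0); rewrite divfK// mulrBl E addrC addrA.
  rewrite [X in X + _](_ : _ = 0) ?add0r// addrC mulr_suml -sumrB big1// => l _.
  by rewrite mulrAC divfK// subrr.
have ra0 : 0 < rho - rnorm a by lra.
have o0 : 0 < rnorm (om - 1) by rewrite rnorm_gt0 subr_eq0.
have N0' : 0 < N%:R :> R by rewrite ltr0n.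
have LB : rnorm (L (fun w => h w * w^-1 ^+ n * (w - a)^-1)) <=
    N%:R * (M * rho^-1 ^+ n / (rho - rnorm a) * (r * rnorm (om - 1))).
  apply: L_bound; first exact: adm_powa.
  move=> w wA; rewrite !rnormM rnormX !rnormV; have w0 := ann_gt0 wA.
  have /andP[w1 w2] := wA.
  apply: ler_pM; rewrite ?mulr_ge0 ?exprn_ge0 ?invr_ge0 ?rnorm_ge0//.
    apply: ler_pM; rewrite ?exprn_ge0 ?invr_ge0 ?rnorm_ge0//; first exact: hM.
    rewrite lerXn2r// ?nnegrE ?invr_ge0 ?rnorm_ge0 ?(ltW rho0)//.
    by rewrite lef_pV2 ?posrE.
  have wa := rnorm_subl w a.
  rewrite lef_pV2 ?posrE//; lra.
rewrite Q rnormM rnormV rnormM rnormX ler_pdivrMr; last by rewrite rnorm_gt0.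
have W1 := winding_neq0.
have X0 : 0 <= 2 * r * M / (rho - rnorm a) * (rnorm a / rho) ^+ n.
  by rewrite !mulr_ge0 ?exprn_ge0 ?mulr_ge0 ?invr_ge0 ?rnorm_ge0 ?(ltW ra0) ?(ltW r0) ?(ltW rho0).
apply: le_trans (ler_wpM2l X0 W1).
apply: le_trans (ler_wpM2l (exprn_ge0 n (rnorm_ge0 a)) LB) _.
rewrite le_eqVlt; apply/orP; left; apply/eqP; rewrite expr_div_n exprVn.
field; rewrite !gt_eqF//; exact: exprn_gt0.
Qed.

End OnPolygon.

Lemma taylor_disc (h : C -> C) (Rr M q : R) : 0 < Rr -> 0 <= q < 1 ->
  (forall w, rnorm w < Rr -> cdiff h w) ->
  (forall w, rnorm w < Rr -> rnorm (h w) <= M) ->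
  exists c : nat -> C, forall n a, rnorm a <= q * Rr ->
    rnorm (h a - \sum_(l < n) c l * a ^+ l) <=
      4 / (1 - q) * M * (rnorm a / ((1 + q) / 2 * Rr)) ^+ n.
Proof.
move=> Rr0 /andP[q0 q1] hd hM.
(* The annulus r (1 - eta) <= |w| <= r (1 + eta) then lies between the radii
   (1 + q) / 2 * Rr and Rr. *)
pose r := (3 + q) / 4 * Rr; pose eta := (1 - q) / 4.
have eta0 : 0 < eta by rewrite /eta; lra.
have r0 : 0 < r by rewrite mulr_gt0//; lra.
have [n on] := droot_close eta0.
have M0 : 0 <= M by apply: le_trans (rnorm_ge0 (h 0)) (hM _ _); rewrite rnorm0.
have rR : r * (1 + eta) < Rr.
  rewrite /r /eta mulrAC -[ltRHS]mul1r ltr_pM2r//.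
  have : 0 < (1 - q) ^+ 2 by rewrite exprn_gt0//; lra.
  rewrite sqrrB expr1n mul1r; rewrite expr2 => ?; nra.
have rhoR : (1 + q) / 2 * Rr <= r * (1 - eta).
  rewrite /r /eta [leRHS]mulrAC ler_pM2r//.
  have : 0 <= (1 - q) ^+ 2 by exact: sqr_ge0.
  rewrite sqrrB expr1n mul1r expr2 => ?; nra.
have [||||c Hc] := @polygon_taylor (droot R n) (2 ^ n.+1) r eta _ (droot1 R n)
   (droot_neq1 R n) r0 _ on (droot_norm R n) h M.
- by rewrite expn_gt0.
- by apply/andP; split; rewrite /eta; lra.
- by move=> w wr; apply: hd; lra.
- by move=> w wr; apply: hM; lra.
exists c => m a aq.
have qR : 0 < (1 - q) * Rr by rewrite mulr_gt0//; lra.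
have a1 : rnorm a < (1 + q) / 2 * Rr by apply: le_lt_trans aq _; rewrite ltr_pM2r//; lra.
have p0 : 0 < (1 + q) / 2 * Rr by rewrite mulr_gt0//; lra.
have a2 : rnorm a < r * (1 - eta) by lra.
apply: le_trans (Hc m a a2) _.
apply: ler_pM.
- by rewrite !mulr_ge0 ?invr_ge0 ?(ltW r0)//; lra.
- by rewrite exprn_ge0// divr_ge0 ?rnorm_ge0//; lra.
- rewrite ler_pdivrMr; last by lra.
  have : (1 - q) / 2 * Rr <= r * (1 - eta) - rnorm a by lra.
  move=> h1; have : 4 / (1 - q) * M * ((1 - q) / 2 * Rr) <= 4 / (1 - q) * M * (r * (1 - eta) - rnorm a).
    by apply: ler_wpM2l => //; rewrite mulr_ge0// divr_ge0//; lra.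
  apply: le_trans.
  have -> : 4 / (1 - q) * M * ((1 - q) / 2 * Rr) = 2 * Rr * M by field; rewrite gt_eqF//; lra.
  rewrite ler_wpM2r// ler_pM2l// /r; nra.
- rewrite lerXn2r// ?nnegrE ?divr_ge0 ?rnorm_ge0//; try lra.
  by rewrite ler_wpM2l ?rnorm_ge0// lef_pV2 ?posrE//; lra.
Qed.

End Cauchy.

(** * Coefficients by averaging over roots of unity *)

Section Coefficients.
Variable R : realType.
Local Notation C := R[i].
Implicit Types (F G h : C -> C) (a c : C) (p : {poly C}).

(** An asymptotic expansion at 0, which determines its coefficients. *)
Definition asymp h (c : nat -> C) := forall n, exists K, exists2 d : R, 0 < d &
  forall a, rnorm a <= d -> rnorm (h a - \sum_(l < n) c l * a ^+ l) <= K * rnorm a ^+ n.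

Lemma asymp_unique h (c c' : nat -> C) : asymp h c -> asymp h c' -> c =1 c'.
Proof.
move=> hc hc'; suff H n : forall l, (l < n)%N -> c l = c' l by move=> l; exact: (H l.+1).
elim: n => [//|n IH] l; rewrite ltnS leq_eqVlt => /orP[/eqP->|/IH//].
have [K [d d0 H]] := hc n.+1; have [K' [d' d'0 H']] := hc' n.+1.
apply/eqP; rewrite -subr_eq0; apply/eqP.
apply: (@rnorm_small_eq0 _ _ _ (`|K| + `|K'|)); first by rewrite addr_ge0.
move=> e e0; pose t := Num.min e (Num.min d d').
have t0 : 0 < t by rewrite !lt_min e0 d0 d'0.
have te : t <= e by rewrite ge_min lexx.
have td : rnorm (t%:C : C) <= d by rewrite rnorm_pos ?(ltW t0)// !ge_min lexx orbT.
have td' : rnorm (t%:C : C) <= d' by rewrite rnorm_pos ?(ltW t0)// !ge_min lexx !orbT.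
have {H}H := H _ td; have {H'}H' := H' _ td'.
rewrite !big_ord_recr /= in H H'.
rewrite [in X in rnorm X <= _](eq_bigr (fun l : 'I_n => c' l * t%:C ^+ l)) in H; last first.
  by move=> j _; rewrite IH.
set S := \sum_(i < n) _ in H H'.
have E : (c n - c' n) * t%:C ^+ n = (h t%:C - (S + c' n * t%:C ^+ n)) - (h t%:C - (S + c n * t%:C ^+ n)) by ring.
have : rnorm ((c n - c' n) * t%:C ^+ n) <= (`|K| + `|K'|) * t ^+ n.+1.
  rewrite E (le_trans (rnormB _ _))// mulrDl addrC.
  have e1 : K * rnorm (t%:C : C) ^+ n.+1 <= `|K| * t ^+ n.+1.
    by rewrite rnorm_pos ?(ltW t0)// ler_wpM2r ?exprn_ge0 ?(ltW t0)// ler_norm.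
  have e2 : K' * rnorm (t%:C : C) ^+ n.+1 <= `|K'| * t ^+ n.+1.
    by rewrite rnorm_pos ?(ltW t0)// ler_wpM2r ?exprn_ge0 ?(ltW t0)// ler_norm.
  lra.
rewrite rnormM rnormX rnorm_pos ?(ltW t0)// exprS mulrA ler_pM2r ?exprn_gt0// => h1.
by apply: le_trans h1 _; rewrite ler_wpM2l ?addr_ge0.
Qed.

(** The k-th Fourier coefficient over the roots of unity of order 2^(n+1). *)
Definition avgc (n k : nat) F : C := (2 ^ n.+1)%:R^-1 *
  \sum_(j < 2 ^ n.+1) F (droot R n ^+ j) * (droot R n ^+ j)^-1 ^+ k.

Lemma avgc_lin n k F G a : avgc n k (fun w => F w + a * G w) = avgc n k F + a * avgc n k G.
Proof.
rewrite /avgc !(mulrC _^-1) mulrA -mulrDl mulr_sumr -big_split /=.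
by congr (_ * _); apply: eq_bigr => j _; rewrite mulrDl mulrA.
Qed.

Lemma avgcB n k F G : avgc n k (fun w => F w - G w) = avgc n k F - avgc n k G.
Proof.
rewrite -[avgc n k G]mul1r -mulNr -avgc_lin; congr (avgc _ _ _).
by apply/funext => w; rewrite mulN1r.
Qed.

Lemma avgcZ n k a F : avgc n k (fun w => a * F w) = a * avgc n k F.
Proof.
rewrite /avgc [RHS]mulrCA; congr (_ * _); rewrite mulr_sumr.
by apply: eq_bigr => j _; rewrite mulrA.
Qed.

Lemma avgc_sum n k (I : Type) (r : seq I) (P : pred I) (F : I -> C -> C) :
  avgc n k (fun w => \sum_(i <- r | P i) F i w) = \sum_(i <- r | P i) avgc n k (F i).
Proof.
rewrite /avgc -mulr_sumr exchange_big /=; congr (_ * _).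
by apply: eq_bigr => j _; rewrite mulr_suml.
Qed.

Lemma avgc_bound n k F (B : R) : (forall w, rnorm w = 1 -> rnorm (F w) <= B) ->
  rnorm (avgc n k F) <= B.
Proof.
move=> FB; rewrite /avgc rnormM rnormV rnorm_nat mulrC ler_pdivrMr ?ltr0n ?expn_gt0//.
apply: le_trans (rnorm_sum _ _ _) _.
rewrite mulr_natr -[X in _ *+ X]card_ord -sumr_const; apply: ler_sum => j _.
have wj : rnorm (droot R n ^+ j) = 1 by rewrite rnormX droot_norm expr1n.
by rewrite rnormM rnormX rnormV wj invr1 expr1n mulr1; exact: FB.
Qed.

Lemma droot_neq0 n : droot R n != 0.
Proof. by rewrite -rnorm_gt0 droot_norm. Qed.

Lemma avgc_pow n k l :
  avgc n k (fun w => w ^+ l) = (l == k %[mod 2 ^ n.+1])%:R.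
Proof.
rewrite /avgc; set N := (2 ^ n.+1)%N; set om := droot R n.
have N0 : (0 < N)%N by rewrite expn_gt0.
have o0 := droot_neq0 n; rewrite -/om in o0.
pose z := om ^+ l * om^-1 ^+ k.
rewrite (eq_bigr (fun j : 'I_N => z ^+ j)); last first.
  by move=> j _; rewrite /z exprMn !exprVn (exprAC om j l) (exprAC om j k).
have zE : (z == 1) = (l == k %[mod N]).
  rewrite /z -(eq_prim_root_expr (droot_prim R n)) -/om exprVn.
  by rewrite -subr_eq0 -[in RHS]subr_eq0 -(mulIr_eq0 _ (mulIf (expf_neq0 k o0))) mulrBl mul1r divfK// expf_neq0.
have zN : z ^+ N = 1.
  by rewrite /z exprMn -!exprM !(mulnC _ N) !exprM exprVn droot1 invr1 !expr1n mulr1.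
rewrite -zE; have [->|z1] := eqVneq z 1.
  rewrite (eq_bigr (fun=> 1)); last by move=> j _; rewrite expr1n.
  by rewrite sumr_const card_ord mulVf// pnatr_eq0 -lt0n.
suff -> : \sum_(j < N) z ^+ j = 0 by rewrite mulr0.
by apply: (mulfI (_ : z - 1 != 0)); rewrite ?subr_eq0// -subrX1 zN subrr mulr0.
Qed.

Lemma avgc_powE n k l : (k < 2 ^ n.+1)%N -> (l < 2 ^ n.+1)%N ->
  avgc n k (fun w => w ^+ l) = (l == k)%:R.
Proof. by move=> kN lN; rewrite avgc_pow !modn_small. Qed.

Lemma avgc_poly n k p : (size p <= 2 ^ n.+1)%N -> (k < 2 ^ n.+1)%N ->
  avgc n k (fun w => p.[w]) = p`_k.
Proof.
move=> pN kN.
rewrite (_ : (fun w => p.[w]) = (fun w => \sum_(i < 2 ^ n.+1) p`_i * w ^+ i)); last first.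
  by apply/funext => w; rewrite (horner_coef_wide _ pN).
rewrite avgc_sum (bigD1 (Ordinal kN))//= big1 => [|i ik].
  by rewrite addr0 avgcZ avgc_powE// eqxx mulr1.
rewrite avgcZ avgc_powE// (_ : (i == k :> nat) = false) ?mulr0//.
by apply/negbTE; apply: contra ik => /eqP ik; apply/eqP/val_inj.
Qed.

Lemma leq_pow2 m : (m <= 2 ^ m.+1)%N.
Proof. by apply: ltnW; apply: leq_trans (ltn_expl m (isT : 1 < 2)%N) _; rewrite leq_exp2l. Qed.

(** Cauchy's inequality: the average of p over enough roots of unity is exactly
    its coefficient. *)
Lemma coef_bound p k (B : R) : (forall w, rnorm w = 1 -> rnorm p.[w] <= B) ->
  rnorm p`_k <= B.
Proof.
move=> pB; pose m := maxn (size p) k.+1.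
rewrite -(@avgc_poly m k p).
- exact: avgc_bound.
- exact: leq_trans (leq_maxl _ _) (leq_pow2 m).
- exact: leq_trans (leq_maxr _ _) (leq_pow2 m).
Qed.

(** Maximum modulus for polynomials: the coefficient estimate applied to the
    powers p^m loses only a factor linear in m. *)
Lemma poly_max_modulus p (B : R) a : (forall w, rnorm w = 1 -> rnorm p.[w] <= B) ->
  rnorm a <= 1 -> rnorm p.[a] <= B.
Proof.
move=> pB a1; have B0 : 0 <= B by apply: le_trans (rnorm_ge0 _) (pB 1 _); rewrite rnorm1.
rewrite leNgt; apply/negP => Bp; set y := rnorm p.[a] in Bp.
have y0 : 0 < y by apply: le_lt_trans Bp.
have pm m : y ^+ m <= (size p * m).+1%:R * B ^+ m.
  rewrite /y -rnormX -horner_exp horner_coef; apply: le_trans (rnorm_sum _ _ _) _.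
  apply: (@le_trans _ _ (\sum_(i < size (p ^+ m)) B ^+ m)).
    apply: ler_sum => i _; rewrite rnormM rnormX -[leRHS]mulr1.
    apply: ler_pM; rewrite ?exprn_ge0 ?rnorm_ge0 ?exprn_ile1 ?rnorm_ge0//.
    apply: coef_bound => w w1; rewrite horner_exp rnormX.
    by rewrite lerXn2r// ?nnegrE ?rnorm_ge0//; exact: pB.
  rewrite sumr_const card_ord -[leLHS]mulr_natl ler_wpM2r ?exprn_ge0// ler_nat.
  apply: leq_trans (size_poly_exp_leq p m) _; rewrite ltnS leq_mul2r leq_pred orbT//.
pose s := (y - B) / (B + 1); have s0 : 0 < s by rewrite divr_gt0//; lra.
pose d := (size p)%:R : R.
have bern m : 1 + m%:R * s <= (1 + s) ^+ m by apply: bernoulli; lra.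
have Bs : B * (1 + s) <= y.
  have -> : y = B + s * (B + 1) by rewrite /s divfK; [ring|rewrite gt_eqF//; lra].
  rewrite mulrDr mulr1 lerD2l mulrC ler_pM2l//; lra.
have key m : (1 + m%:R * s) ^+ 2 * B ^+ (m * 2) <= (2 * d * m%:R + 1) * B ^+ (m * 2).
  apply: (@le_trans _ _ (y ^+ (m * 2))).
    apply: (@le_trans _ _ ((B * (1 + s)) ^+ (m * 2))); last first.
      by rewrite lerXn2r// nnegrE ?mulr_ge0//; lra.
    rewrite exprMn mulrC ler_wpM2l ?exprn_ge0// exprM lerXn2r// nnegrE.
      by rewrite addr_ge0// mulr_ge0// ltW.
    by rewrite exprn_ge0//; lra.
  apply: le_trans (pm (m * 2)%N) _; rewrite ler_wpM2r ?exprn_ge0//.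
  by rewrite -natr1 !natrM /d; lra.
have [B00|Bn0] := eqVneq B 0.
  by have := pm 1%N; rewrite !expr1 B00 mulr0; lra.
have Bp0 : 0 < B by rewrite lt_neqAle eq_sym Bn0.
have key2 m : m%:R * s ^+ 2 <= 2 * d.
  have := key m; rewrite ler_pM2r ?exprn_gt0// => km.
  have [->|m0] := posnP m; first by rewrite mul0r mulr_ge0.
  have m0' : 0 < m%:R :> R by rewrite ltr0n.
  rewrite -(ler_pM2l m0'); have : 0 <= m%:R * s by rewrite mulr_ge0// ltW.
  move: km; rewrite !expr2; lra.
have s20 : 0 < s ^+ 2 by rewrite exprn_gt0.
have := key2 (Num.bound (2 * d / s ^+ 2)).
rewrite -ler_pdivlMr// leNgt => /negP; apply.
apply: archi_boundP. apply: divr_ge0; last exact: ltW. by apply: mulr_ge0; rewrite ?ler0n.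
Qed.

(** The averages avgc n l of the function are within e of the coefficients of
    every approximating polynomial, and hence are the coefficients of the limit. *)
Lemma poly_approx_closed n F :
  (forall (rho e : R), 0 < e -> exists p, (size p <= n)%N /\
     forall w, rnorm w <= rho -> rnorm (F w - p.[w]) <= e) ->
  exists p, (size p <= n)%N /\ forall w, F w = p.[w].
Proof.
move=> H; pose P := \poly_(l < n) avgc n l F; exists P; split; first exact: size_poly.
move=> z; apply/eqP; rewrite -subr_eq0; apply/eqP.
pose K := 1 + \sum_(l < n) rnorm z ^+ l.
apply: (@rnorm_small_eq0 _ _ _ K).
  by rewrite addr_ge0// sumr_ge0// => l _; rewrite exprn_ge0 ?rnorm_ge0.
move=> e e0; have [p [pn Hp]] := H (Num.max 1 (rnorm z)) e e0.
have pc l : (l < n)%N -> rnorm (P`_l - p`_l) <= e.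
  move=> ln; rewrite coef_poly ln.
  have l1 : (l < 2 ^ n.+1)%N by exact: leq_trans ln (leq_pow2 n).
  rewrite -(@avgc_poly n l p)//; last exact: leq_trans pn (leq_pow2 n).
  by rewrite -avgcB; apply: avgc_bound => w w1; apply: Hp; rewrite w1 le_max lexx.
have h1 : rnorm (F z - p.[z]) <= e by apply: Hp; rewrite le_max lexx orbT.
have h2 : rnorm (p.[z] - P.[z]) <= e * \sum_(l < n) rnorm z ^+ l.
  rewrite rnormBC -hornerN -hornerD (@horner_coef_wide _ n); last first.
    by rewrite (leq_trans (size_polyD _ _))// size_polyN geq_max size_poly pn.
  apply: le_trans (rnorm_sum _ _ _) _; rewrite mulr_sumr; apply: ler_sum => l _.
  by rewrite rnormM rnormX coefB ler_wpM2r ?exprn_ge0 ?rnorm_ge0// pc.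
have := rnorm_tri (F z) p.[z] P.[z]; rewrite /K; lra.
Qed.

End Coefficients.

(** * Multilinear forms *)

Section Forms.
Variables (R : realType) (V : normedModType R[i]).
Local Notation C := R[i].

Lemma fcons0 m (x : V) (v : 'I_m -> V) : fcons x v ord0 = x.
Proof. by rewrite /fcons unlift_none. Qed.

Lemma fconsS m (x : V) (v : 'I_m -> V) i : fcons x v (lift ord0 i) = v i.
Proof. by rewrite /fcons liftK. Qed.

Lemma fcons_eta m (v : 'I_m.+1 -> V) : v = fcons (v ord0) (fun i => v (lift ord0 i)).
Proof. by apply/funext => i; case: (unliftP ord0 i) => [j ->|->]; rewrite ?fconsS ?fcons0. Qed.

Lemma fcons_const m (x : V) : (fun=> x) = fcons x (fun _ : 'I_m => x).
Proof. by rewrite [LHS]fcons_eta. Qed.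

Lemma ord0_fun (v w : 'I_0 -> V) : v = w.
Proof. by apply/funext => -[]. Qed.

Definition pform m (A : ('I_m.+1 -> V) -> C) (x : V) : ('I_m -> V) -> C :=
  fun v => A (fcons x v).

Definition diag m (A : ('I_m -> V) -> C) (x : V) : C := A (fun=> x).

Lemma diagS m (A : ('I_m.+1 -> V) -> C) x : diag A x = diag (pform A x) x.
Proof. by rewrite /diag fcons_const. Qed.

(** Multilinearity, by recursion on the number of variables as in fcons. *)
Fixpoint mlin m : (('I_m -> V) -> C) -> Prop :=
  if m is m'.+1 then fun A =>
    (forall v, linear (fun x => pform A x v)) /\ (forall x, mlin (pform A x))
  else fun=> True.

Lemma multilinear_mlin m (A : ('I_m -> V) -> C) : multilinear A -> mlin A.
Proof.
elim: m A => [//|m IH] A Am; split=> [v|x].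
  move=> a x y; have E z : fcons z v = [eta fcons 0 v with ord0 |-> z].
    apply/funext => i; case: (unliftP ord0 i) => [j ->|->] /=; rewrite ?fconsS ?fcons0 ?eqxx//.
  by rewrite /pform (E (a *: x + y)) (E x) (E y); exact: Am.
apply: IH => i v a y z; have E t : fcons x [eta v with i |-> t] = [eta fcons x v with lift ord0 i |-> t].
  apply/funext => k; case: (unliftP ord0 k) => [j ->|->] /=; rewrite ?fconsS ?fcons0.
    by rewrite (inj_eq lift_inj).
  by rewrite ?fcons0.
by rewrite /pform (E (a *: y + z)) (E y) (E z); exact: Am.
Qed.

Lemma sym_swap m (A : ('I_m.+2 -> V) -> C) (x y : V) (v : 'I_m -> V) : Defs.symmetric_form A ->
  A (fcons x (fcons y v)) = A (fcons y (fcons x v)).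
Proof.
move=> As; rewrite -(As (tperm ord0 (lift ord0 ord0))); congr (A _).
apply/funext => i /=; case: (unliftP ord0 i) => [j ->|->].
  case: (unliftP ord0 j) => [k ->|->].
    by rewrite tpermD ?fconsS// ?(inj_eq lift_inj) ?neq_lift.
  by rewrite tpermR !(fconsS, fcons0).
by rewrite tpermL !(fconsS, fcons0).
Qed.

Lemma sym_pform m (A : ('I_m.+1 -> V) -> C) x : Defs.symmetric_form A ->
  Defs.symmetric_form (pform A x).
Proof.
move=> As s v; rewrite /pform -[RHS](As (lift_perm ord0 ord0 s)); congr (A _).
apply/funext => i /=; case: (unliftP ord0 i) => [j ->|->].
  by rewrite lift_perm_lift !fconsS.
by rewrite lift_perm_id !fcons0.
Qed.

Definition bnd m (A : ('I_m -> V) -> C) (K : R) :=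
  forall v, rnorm (A v) <= K * \prod_i rnorm (v i).

Lemma prod_fcons m (x : V) (v : 'I_m -> V) :
  \prod_i rnorm (fcons x v i) = rnorm x * \prod_i rnorm (v i).
Proof. by rewrite big_ord_recl fcons0; congr (_ * _); apply: eq_bigr => i _; rewrite fconsS. Qed.

Lemma bnd_pform m (A : ('I_m.+1 -> V) -> C) K x : bnd A K -> bnd (pform A x) (K * rnorm x).
Proof. by move=> AK v; apply: le_trans (AK _) _; rewrite prod_fcons mulrA. Qed.

Lemma bnd_le m (A : ('I_m -> V) -> C) K K' : K <= K' -> bnd A K -> bnd A K'.
Proof.
move=> KK AK v; apply: le_trans (AK v) _; rewrite ler_wpM2r//.
by rewrite prodr_ge0// => i _; exact: rnorm_ge0.
Qed.

Lemma bnd_diag m (A : ('I_m -> V) -> C) K x : bnd A K ->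
  rnorm (diag A x) <= K * rnorm x ^+ m.
Proof. by move=> AK; apply: le_trans (AK _) _; rewrite prodr_const card_ord. Qed.

Lemma diagZ m (A : ('I_m -> V) -> C) a x : mlin A -> diag A (a *: x) = a ^+ m * diag A x.
Proof.
elim: m A => [|m IH] A /=; first by rewrite expr0 mul1r /diag (ord0_fun (fun=> a *: x) (fun=> x)).
move=> [Al Am]; rewrite !diagS.
have L v : pform A (a *: x) v = a * pform A x v.
  have := Al v a x 0; rewrite addr0 => ->.
  have -> : pform A 0 v = 0 by have := Al v 0 0 0; rewrite scale0r addr0 => ->; rewrite scale0r add0r; have := Al v (-1) 0 0; rewrite scaler0 addr0 scaleN1r addNr.
  by rewrite addr0.
by rewrite /diag L -/(diag (pform A x) (a *: x)) IH// exprS mulrA.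
Qed.

Lemma diag_line m (A : ('I_m -> V) -> C) x y : mlin A ->
  exists p : {poly C}, (size p <= m.+1)%N /\ forall t, diag A (x + t *: y) = p.[t].
Proof.
elim: m A => [|m IH] A /=.
  move=> _; exists (A (fun=> x))%:P; rewrite size_polyC; split; first by case: (_ != 0).
  by move=> t; rewrite hornerC /diag; congr (A _); exact: ord0_fun.
move=> [Al Am]; have [p [sp Hp]] := IH _ (Am x); have [q [sq Hq]] := IH _ (Am y).
exists (p + 'X * q); split.
  rewrite (leq_trans (size_polyD _ _))// geq_max (leq_trans sp)//=.
  by rewrite (leq_trans (size_polyMleq _ _))// size_polyX.
move=> t; rewrite diagS !hornerE -Hp -Hq.
have L v : pform A (x + t *: y) v = pform A x v + t * pform A y v.
  by rewrite addrC (Al v) addrC.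
by rewrite /diag L.
Qed.

Lemma mlin_pformD m (A : ('I_m.+1 -> V) -> C) x y v : mlin A ->
  A (fcons (x + y) v) = A (fcons x v) + A (fcons y v).
Proof. by move=> [Al _]; have := Al v 1 x y; rewrite !scale1r. Qed.

Lemma mlin_pform0 m (A : ('I_m.+1 -> V) -> C) v : mlin A -> A (fcons 0 v) = 0.
Proof.
move=> Am; have := mlin_pformD 0 0 v Am; rewrite addr0 => /eqP.
by rewrite -subr_eq0 opprD addrA subrr sub0r oppr_eq0 => /eqP.
Qed.

Lemma mlin_pformZ m (A : ('I_m.+1 -> V) -> C) a x v : mlin A ->
  A (fcons (a *: x) v) = a * A (fcons x v).
Proof.
move=> Am; case: (Am) => Al _; have := Al v a x 0; rewrite addr0 /pform => ->.
by rewrite mlin_pform0// addr0.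
Qed.

Lemma mlin_pformB m (A : ('I_m.+1 -> V) -> C) x y v : mlin A ->
  A (fcons (x - y) v) = A (fcons x v) - A (fcons y v).
Proof. by move=> Am; rewrite mlin_pformD// -scaleN1r mlin_pformZ// mulN1r. Qed.

(** By symmetry the linear coefficient collects the m + 1 ways of putting y in
    one argument. *)
Lemma diag_line_sym m (A : ('I_m.+1 -> V) -> C) x y : mlin A -> Defs.symmetric_form A ->
  exists p : {poly C}, [/\ (size p <= m.+2)%N,
    (forall t, diag A (x + t *: y) = p.[t]), p`_0 = diag A x &
    p`_1 = m.+1%:R * A (fcons y (fun=> x))].
Proof.
elim: m A => [|m IH] A Am As.
  exists ((A (fcons x (fun=> x)))%:P + (A (fcons y (fun=> x))) *: 'X); split.
  - rewrite (leq_trans (size_polyD _ _))// geq_max size_polyC (leq_trans (leq_b1 _))//=.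
    by rewrite (leq_trans (size_scale_leq _ _))// size_polyX.
  - move=> t; rewrite diagS /diag /pform mlin_pformD// mlin_pformZ// !hornerE.
    by rewrite (ord0_fun (fun=> x + t *: y) (fun=> x)) [t * _]mulrC.
  - by rewrite coefD coefC coefZ coefX mulr0 addr0 diagS.
  - by rewrite coefD coefC coefZ coefX/= add0r mulr1 mul1r.
case: (Am) => Al Am'.
have [p [sp Hp p0 p1]] := IH _ (Am' x) (sym_pform x As).
have [q [sq Hq q0 _]] := IH _ (Am' y) (sym_pform y As).
exists (p + 'X * q); split.
- rewrite (leq_trans (size_polyD _ _))// geq_max (leq_trans sp)//=.
  by rewrite (leq_trans (size_polyMleq _ _))// size_polyX.
- move=> t; rewrite diagS !hornerE -Hp -Hq /diag /pform.
  by rewrite mlin_pformD// mlin_pformZ.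
- by rewrite coefD coefXM /= addr0 p0 [RHS]diagS.
- rewrite coefD coefXM/= p1 q0 /pform sym_swap// -(fcons_const m x) /diag.
  by rewrite -[m.+2%:R]natr1 mulrDl mul1r.
Qed.

(** Cauchy's inequality for the linear coefficient along the line x + t y. *)
Lemma polar1 m (A : ('I_m.+1 -> V) -> C) M x y : mlin A -> Defs.symmetric_form A -> 0 <= M ->
  (forall x, rnorm (diag A x) <= M * rnorm x ^+ m.+1) ->
  rnorm (A (fcons y (fun=> x))) <= M * (rnorm x + rnorm y) ^+ m.+1.
Proof.
move=> Am As M0 AM; have [p [sp Hp p0 p1]] := diag_line_sym x y Am As.
have : rnorm p`_1 <= M * (rnorm x + rnorm y) ^+ m.+1.
  apply: coef_bound => w w1; rewrite -Hp; apply: le_trans (AM _) _.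
  rewrite ler_wpM2l// lerXn2r// ?nnegrE ?addr_ge0 ?rnorm_ge0//.
  by rewrite (le_trans (rnormD _ _))// rnormZ w1 mul1r.
rewrite p1 rnormM rnorm_nat; apply: le_trans.
by rewrite ler_peMl ?rnorm_ge0// ler1n.
Qed.

(** A symmetric form is bounded in terms of its diagonal: by polar1, freezing one
    argument leaves a form whose diagonal is again bounded.  Rescaling y to the
    norm of x makes the bound homogeneous. *)
Lemma polar_bnd m : exists2 K : R, 0 <= K & forall (A : ('I_m -> V) -> C) M,
  mlin A -> Defs.symmetric_form A -> 0 <= M ->
  (forall x, rnorm (diag A x) <= M * rnorm x ^+ m) -> bnd A (K * M).
Proof.
elim: m => [|m [K K0 IH]].
  exists 1 => // A M _ _ M0 AM v; have := AM 0; rewrite /diag (ord0_fun (fun=> 0) v).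
  by rewrite expr0 big_ord0 mul1r.
exists (K * 2 ^+ m.+1); first by rewrite mulr_ge0// exprn_ge0.
move=> A M Am As M0 AM v; rewrite [v]fcons_eta prod_fcons.
set y := v ord0; set w := fun i => _.
have := IH (pform A y) (2 ^+ m.+1 * M * rnorm y) (Am.2 y) (sym_pform y As).
have h0 : 0 <= 2 ^+ m.+1 * M * rnorm y by rewrite !mulr_ge0 ?exprn_ge0 ?rnorm_ge0.
move=> /(_ h0); rewrite /bnd => B.
have -> : K * 2 ^+ m.+1 * M * (rnorm y * \prod_i rnorm (w i)) =
  K * (2 ^+ m.+1 * M * rnorm y) * \prod_i rnorm (w i) by ring.
apply: B => x; rewrite /diag /pform.
have [->|y0] := eqVneq y 0; first by rewrite mlin_pform0// !rnorm0 mulr0 mul0r.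
have ry0 : 0 < rnorm y by rewrite rnorm_gt0.
have [x0|x0] := eqVneq x 0.
  have [m0|m0] := posnP m.
    apply: le_trans (polar1 x y Am As M0 AM) _; rewrite x0 rnorm0 add0r.
    have -> : rnorm y ^+ m.+1 = rnorm y by rewrite m0 expr1.
    have -> : (2 : R) ^+ m.+1 = 2 by rewrite m0 expr1.
    have -> : (0 : R) ^+ m = 1 by rewrite m0 expr0.
    by have := mulr_ge0 M0 (ltW ry0); lra.
  have -> : A (fcons y (fun=> x)) = diag (pform A y) x by [].
  rewrite x0 -[X in diag _ X](scale0r (0 : V)) diagZ; last exact: Am.2.
  by rewrite expr0n (gtn_eqF m0) mul0r !rnorm0 expr0n (gtn_eqF m0) mulr0.
have rx0 : 0 < rnorm x by rewrite rnorm_gt0.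
pose t := rnorm x / rnorm y; have t0 : 0 < t by rewrite divr_gt0.
have := polar1 x (t%:C *: y) Am As M0 AM.
rewrite mlin_pformZ// rnormM rnormZ rnorm_pos ?(ltW t0)// /t divfK ?gt_eqF//.
rewrite -ler_pdivlMl ?divr_gt0// => h; apply: le_trans h _.
rewrite le_eqVlt; apply/orP; left; apply/eqP.
have -> : rnorm x + rnorm x = 2 * rnorm x by ring.
rewrite exprMn (exprS (rnorm x)); field.
by rewrite !gt_eqF.
Qed.

Lemma diag_lip m (A : ('I_m -> V) -> C) (K rho : R) x y : mlin A -> bnd A K -> 0 <= K ->
  rnorm x <= rho -> rnorm y <= rho ->
  rnorm (diag A x - diag A y) <= K * m%:R * rho ^+ m.-1 * rnorm (x - y).
Proof.
move=> + + + xr yr; have r0 : 0 <= rho by apply: le_trans (rnorm_ge0 x) xr.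
elim: m A K => [|m IH] A K Am AK K0.
  by rewrite /diag (ord0_fun (fun=> x) (fun=> y)) subrr rnorm0 mulr0 !mul0r.
rewrite !diagS.
have -> : diag (pform A x) x - diag (pform A y) y =
   (diag (pform A x) x - diag (pform A x) y) + diag (pform A (x - y)) y.
  by rewrite /diag /pform mlin_pformB//; ring.
apply: le_trans (rnormD _ _) _.
have h1 := IH (pform A x) (K * rnorm x) (Am.2 x) (bnd_pform x AK) (mulr_ge0 K0 (rnorm_ge0 x)).
have h2 := bnd_diag y (bnd_pform (x - y) AK).
have d0 := rnorm_ge0 (x - y).
have h3 : K * rnorm x * m%:R * rho ^+ m.-1 * rnorm (x - y) <= K * m%:R * rho ^+ m * rnorm (x - y).
  rewrite ler_wpM2r//; case: (m) => [|n]; first by rewrite !mulr0 !mul0r.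
  rewrite [rho ^+ n.+1]exprS /=.
  have -> : K * rnorm x * n.+1%:R * rho ^+ n = K * n.+1%:R * rho ^+ n * rnorm x by ring.
  have -> : K * n.+1%:R * (rho * rho ^+ n) = K * n.+1%:R * rho ^+ n * rho by ring.
  by rewrite ler_wpM2l// !mulr_ge0// exprn_ge0.
have h4 : K * rnorm (x - y) * rnorm y ^+ m <= K * rnorm (x - y) * rho ^+ m.
  by rewrite ler_wpM2l ?mulr_ge0// lerXn2r// nnegrE rnorm_ge0.
rewrite /= -natr1 mulrDr mulr1 !mulrDl; lra.
Qed.

Lemma diag_continuous m (B : ('I_m -> V) -> C) K : mlin B -> bnd B K -> 0 <= K ->
  continuous (diag B).
Proof.
move=> Bm BK K0 x; apply/cvgrPdist_le => e e0.
have e0' : 0 < complex.Re e by rewrite -ltcR gt0_RRe.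
pose rho := rnorm x + 1; pose L := K * m%:R * rho ^+ m.-1.
have x0 := rnorm_ge0 x.
have L0 : 0 <= L by rewrite !mulr_ge0 ?exprn_ge0// /rho; lra.
have L1 : 0 < L + 1 by lra.
pose d := Num.min 1 (complex.Re e / (L + 1)).
have d0 : 0 < d by rewrite lt_min ltr01 divr_gt0.
apply/nbhs_ballP; exists d%:C; first by rewrite /= ltcR.
move=> y; rewrite -ball_normE /= rnorm_ltC lt_min => /andP[h1 h2].
rewrite -(gt0_RRe e0) rnorm_leC.
apply: le_trans (diag_lip Bm BK K0 (_ : rnorm x <= rho) (_ : rnorm y <= rho)) _.
- by rewrite /rho; lra.
- by rewrite /rho; have := rnorm_subl y x; rewrite rnormBC; lra.
rewrite -/L; move: h2; rewrite ltr_pdivlMr// => h2.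
by have := rnorm_ge0 (x - y); lra.
Qed.

(** Splitting x + y in the first argument leaves the forms with that argument
    frozen at x, where the diagonal is Lipschitz, and at y, where induction
    applies; by symmetry the first-order terms agree. *)
Lemma diag_taylor2 m (A : ('I_m.+1 -> V) -> C) (K : R) x y : mlin A ->
  Defs.symmetric_form A -> bnd A K -> 0 <= K ->
  rnorm x <= 1 -> rnorm y <= 1 -> rnorm (x + y) <= 1 ->
  rnorm (diag A (x + y) - diag A y - m.+1%:R * A (fcons x (fun=> y))) <=
    K * m.+1%:R ^+ 2 * rnorm x ^+ 2.
Proof.
move=> + + + + x1 y1 xy1; elim: m A K => [|m IH] A K Am As AK K0.
  rewrite !diagS /diag /pform (ord0_fun (fun=> x + y) (fun=> y)) mlin_pformD//.
  by rewrite mul1r addrK subrr rnorm0 !mulr_ge0 ?exprn_ge0 ?rnorm_ge0.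
rewrite (diagS A (x + y)) (diagS A y).
set Ax := pform A x; set Ay := pform A y.
have -> : diag (pform A (x + y)) (x + y) = diag Ax (x + y) + diag Ay (x + y).
  by rewrite /diag /Ax /Ay /pform mlin_pformD.
have E : A (fcons x (fun=> y)) = diag Ax y by [].
have E2 : A (fcons x (fun=> y)) = Ay (fcons x (fun=> y)).
  by rewrite /Ay /pform sym_swap// -fcons_const.
have -> : diag Ax (x + y) + diag Ay (x + y) - diag Ay y - m.+2%:R * A (fcons x (fun=> y)) =
  (diag Ax (x + y) - diag Ax y) + (diag Ay (x + y) - diag Ay y - m.+1%:R * Ay (fcons x (fun=> y))).
  by rewrite -E2 -E -[m.+2%:R]natr1; ring.
apply: le_trans (rnormD _ _) _.
have x0 := rnorm_ge0 x.
have h1 := @diag_lip _ Ax (K * rnorm x) 1 (x + y) y (Am.2 x) (bnd_pform x AK) (mulr_ge0 K0 x0) xy1 y1.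
rewrite addrK expr1n mulr1 in h1.
have h2 := IH Ay (K * rnorm y) (Am.2 y) (sym_pform y As) (bnd_pform y AK) (mulr_ge0 K0 (rnorm_ge0 y)).
have h3 : K * rnorm y * m.+1%:R ^+ 2 * rnorm x ^+ 2 <= K * m.+1%:R ^+ 2 * rnorm x ^+ 2.
  by rewrite ler_wpM2r ?exprn_ge0// ler_wpM2r ?exprn_ge0// ler_piMr.
have h4 : 0 <= K * rnorm x ^+ 2 * (m.+1%:R + 1) by rewrite mulr_ge0 ?mulr_ge0 ?exprn_ge0 ?addr_ge0.
have -> : K * m.+2%:R ^+ 2 * rnorm x ^+ 2 = K * rnorm x ^+ 2 * (m.+1%:R + 1) + (K * rnorm x * m.+1%:R * rnorm x + K * m.+1%:R ^+ 2 * rnorm x ^+ 2).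
  rewrite -[m.+2%:R]natr1; ring.
lra.
Qed.

End Forms.

(** * Duality *)

Section Duality.
Variables (R : realType).
Local Notation C := R[i].

Lemma rnorm_dual (V : normedModType C) (g : dual V) : rnorm g = dual_norm g.
Proof. by []. Qed.

Lemma dual_bound (V : normedModType C) (g : dual V) (x : V) :
  rnorm (g x) <= rnorm g * rnorm x.
Proof.
by rewrite -lecR rmorphM/= -!rnormE; exact: dual_norm_bound.
Qed.

Lemma dualZE (V : normedModType C) (a : C) (g : dual V) x : (a *: g) x = a * g x.
Proof. by []. Qed.

Lemma dualDE (V : normedModType C) (g h : dual V) x : (g + h) x = g x + h x.
Proof. by []. Qed.

Lemma dual_sumE (V : normedModType C) (I : Type) (r : seq I) (F : I -> dual V) x :
  (\sum_(i <- r) F i) x = \sum_(i <- r) F i x.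
Proof.
elim: r => [|i r IH]; first by rewrite !big_nil.
by rewrite !big_cons dualDE IH.
Qed.

Lemma dual_lin (V : normedModType C) (g : dual V) a x y : g (a *: x + y) = a * g x + g y.
Proof. exact: dual_linear. Qed.

Lemma dualD (V : normedModType C) (g : dual V) x y : g (x + y) = g x + g y.
Proof. by rewrite -[x]scale1r dual_lin mul1r scale1r. Qed.

Lemma dual0 (V : normedModType C) (g : dual V) : g 0 = 0.
Proof. exact: linear0. Qed.

Lemma dualZ (V : normedModType C) (g : dual V) a x : g (a *: x) = a * g x.
Proof. by rewrite -[a *: x]addr0 dual_lin dual0 addr0. Qed.

Lemma dualB (V : normedModType C) (g : dual V) x y : g (x - y) = g x - g y.
Proof. by rewrite dualD -scaleN1r dualZ mulN1r. Qed.

Lemma dual_sum (V : normedModType C) (g : dual V) (I : Type) (r : seq I) (F : I -> V) :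
  g (\sum_(i <- r) F i) = \sum_(i <- r) g (F i).
Proof.
elim: r => [|i r IH]; first by rewrite !big_nil dual0.
by rewrite !big_cons dualD IH.
Qed.

Lemma dual_exists (V : normedModType C) (g : V -> C) (K : R) : linear g ->
  (forall x, rnorm (g x) <= K * rnorm x) -> exists G : dual V, forall x, G x = g x.
Proof.
move=> gl gK.
have gm : g \in @dual_pred R V.
  apply/mem_set; split => //.
  pose gL : {linear V -> C} := HB.pack g (GRing.isLinear.Build C V C *:%R g gl).
  apply/(@linear_bounded_continuous _ _ _ gL)/linear_boundedP.
  exists K%:C; split; first by apply/complex_realP; exists K.
  move=> M KM x; rewrite !rnormE; apply: le_trans (_ : (K * rnorm x)%:C <= _).
    by rewrite lecR; exact: gK.
  by rewrite rmorphM/= ler_wpM2r ?(ltW KM)// lecR rnorm_ge0.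
by exists (Dual gm).
Qed.

(** Goldstine's theorem in quantitative form: the squared distance from the
    finitely many prescribed values is nearly minimised at some x in the ball;
    the first-order condition at x, read on the functional G whose coefficients
    are the conjugate defects, contradicts the norm bound on z unless the
    distance is small. *)
Lemma goldstine (X : normedModType C) (z : bidual X) (s e : R) (gs : seq (dual X)) :
  rnorm z <= s -> 0 < s -> 0 < e ->
  exists x : X, rnorm x <= s /\ forall g, g \in gs -> rnorm (g x - z g) <= e.
Proof.
move=> zs s0 e0.
pose E x := \sum_(g <- gs) rnorm (g x - z g) ^+ 2.
have E0 x : 0 <= E x by apply: sumr_ge0 => g _; exact: sqr_ge0.
suff [x [xs Ex]] : exists x, rnorm x <= s /\ E x <= e ^+ 2.
  exists x; split => // g gg; rewrite -(@ler_pXn2r _ 2)// ?nnegrE ?rnorm_ge0 ?(ltW e0)//.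
  apply: le_trans Ex; rewrite /E (big_rem g)//= lerDl.
  by apply: sumr_ge0 => h _; exact: sqr_ge0.
apply: contrapT => nE.
have En x : rnorm x <= s -> e ^+ 2 < E x.
  by move=> xs; rewrite ltNge; apply/negP => Ex; apply: nE; exists x.
pose S := [set E x | x in [set x | rnorm x <= s]].
have Sinf : has_inf S.
  split; first by exists (E 0), 0 => //=; rewrite rnorm0 ltW.
  by exists 0 => _ [x _ <-].
(* D bounds the second-order term of E along segments in the ball, and t is the
   length of the step along them. *)
pose D := \sum_(g <- gs) (rnorm g * (2 * s)) ^+ 2.
have D0 : 0 <= D by apply: sumr_ge0 => g _; exact: sqr_ge0.
pose t := Num.min 1 (e ^+ 2 / (1 + D)).
have t0 : 0 < t by rewrite lt_min ltr01 divr_gt0 ?exprn_gt0//; lra.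
have t1 : t <= 1 by rewrite ge_min lexx.
have te : t * (1 + D) <= e ^+ 2 by rewrite -ler_pdivlMr ?ge_min ?lexx ?orbT//; lra.
have [_ [x /= xs <-] Ex] := inf_adherent (exprn_gt0 2 t0) Sinf.
have Emin x' : rnorm x' <= s -> E x <= E x' + t ^+ 2.
  move=> xs'; have : inf S <= E x' by apply: ge_inf; [case: Sinf|exists x'].
  lra.
pose G := \sum_(g <- gs) (g x - z g)^* *: g.
have GE y : G y = \sum_(g <- gs) (g x - z g)^* * g y by rewrite dual_sumE.
have zG : z G = G x - (E x)%:C.
  rewrite GE dual_sum /E raddf_sum /= -sumrB; apply: eq_bigr => g _.
  have -> : (rnorm (g x - z g) ^+ 2)%:C = (g x - z g) * (g x - z g)^*.
    by rewrite -sqr_normc rnormE rmorphXn.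
  by rewrite dualZ; ring.
have var x' : rnorm x' <= s -> - (t * (1 + D) / 2) <= complex.Re (G x' - G x).
  move=> xs'; pose y := x + t%:C *: (x' - x).
  have ys : rnorm y <= s.
    have -> : y = (1 - t)%:C *: x + t%:C *: x'.
      by rewrite /y rmorphB rmorph1 scalerBl scale1r scalerBr addrA addrAC.
    apply: le_trans (rnormD _ _) _; rewrite !rnormZ !rnorm_pos ?(ltW t0)//; last lra.
    have h1 : (1 - t) * rnorm x <= (1 - t) * s by rewrite ler_wpM2l//; lra.
    have h2 : t * rnorm x' <= t * s by rewrite ler_wpM2l// ltW.
    lra.
  have := Emin y ys.
  have -> : E y = E x + 2 * t * complex.Re (G x' - G x) + t ^+ 2 * \sum_(g <- gs) rnorm (g (x' - x)) ^+ 2.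
    rewrite -dualB GE raddf_sum /E !mulr_sumr -!big_split /=; apply: eq_bigr => g _.
    rewrite /y dualD dualZ; move: (g x) (z g) (g (x' - x)) => [a1 b1] [a2 b2] [a3 b3].
    by rewrite !rnormXsqr /=; ring.
  have : \sum_(g <- gs) rnorm (g (x' - x)) ^+ 2 <= D.
    apply: ler_sum => g _; rewrite lerXn2r// ?nnegrE ?rnorm_ge0 ?mulr_ge0 ?rnorm_ge0//; first lra.
    apply: le_trans (dual_bound _ _) _; rewrite ler_wpM2l ?rnorm_ge0//.
    by have := rnormB x' x; lra.
  move=> hD h; have hD' : t ^+ 2 * \sum_(g <- gs) rnorm (g (x' - x)) ^+ 2 <= t ^+ 2 * D.
    by rewrite ler_wpM2l ?exprn_ge0// ltW.
  rewrite -(ler_pM2l t0); rewrite expr2 in h hD'; lra.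
have GB : s * rnorm G <= t * (1 + D) / 2 - complex.Re (G x).
  rewrite rnorm_dual mulrC -ler_pdivlMr//; apply: dual_norm_le => x0.
  rewrite rnorm_le1 => x01; rewrite ler_pdivlMr// -rnorm_modulus.
  have [->|c0] := eqVneq (G x0) 0.
    by have := var 0; rewrite rnorm0 (ltW s0) => /(_ isT); rewrite dual0 rnorm0 mul0r sub0r raddfN; lra.
  set c := G x0 in c0 *; have nc : 0 < rnorm c by rewrite rnorm_gt0.
  pose x' := (- (s / rnorm c)%:C * c^*) *: x0.
  have xs' : rnorm x' <= s.
    rewrite rnormZ rnormM rnormN rnorm_pos; last by rewrite divr_ge0 ?ltW.
    by rewrite rnormJ divfK ?gt_eqF// ler_piMr// ltW.
  have := var x' xs'; rewrite raddfB /= /x' dualZ -/c.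
  have -> : - (s / rnorm c)%:C * c^* * c = (- (s * rnorm c))%:C.
    rewrite -mulrA [c^* * c]mulrC -sqr_normc rnormE -rmorphXn -rmorphN -rmorphM /=.
    by congr (_%:C); field; rewrite gt_eqF.
  by rewrite /=; lra.
have zGB : rnorm (z G) <= s * rnorm G.
  by apply: le_trans (dual_bound _ _) _; rewrite ler_wpM2r ?rnorm_ge0.
have := Re_le_rnorm (z G); rewrite zG raddfB /= ler_norml => /andP[h1 _].
rewrite -zG in h1; have := En x xs; have := sqr_ge0 e; lra.
Qed.

End Duality.

(** * Iterated weak-star limits *)

Section IteratedLim.
Variables (R : realType) (X : normedModType R[i]).
Local Notation C := R[i].
Implicit Types (z : bidual X).

Lemma weakstar_proper z : ProperFilter (weakstar z).
Proof.
apply: filter_from_proper; first apply: filter_from_filter.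
- by exists ([::], 1) => /=.
- move=> [gs e] [hs d] /= e0 d0; exists (gs ++ hs, Num.min e d) => /=.
    by rewrite lt_min e0 d0.
  move=> x H; split=> g gg; have := H g; rewrite mem_cat gg ?orbT lt_min => /(_ isT) /andP[].
    by [].
  by move=> _.
move=> [gs e] /= e0.
have [||| x [_ xg]] := @goldstine R X z (rnorm z + 1) (e / 2) gs.
- lra.
- by have := rnorm_ge0 z; lra.
- lra.
by exists x => g gg; have := xg g gg; rewrite rnorm_modulus; lra.
Qed.

Lemma weakstar_lim z (g : dual X) : lim (g x @[x --> weakstar z]) = z g.
Proof.
have F := weakstar_proper z.
apply: cvg_lim; first exact: norm_hausdorff.
apply/cvgrPdist_lt => e e0; exists ([:: g], complex.Re e) => /=.
  by rewrite -ltcR gt0_RRe.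
move=> x /= /(_ g); rewrite mem_head => /(_ isT).
by rewrite -ltcR gt0_RRe// -modulusE distrC.
Qed.

(** The bounded multilinear forms, those with iterated weak-star limits. *)
Definition good m (A : ('I_m -> X) -> C) (K : R) := [/\ mlin A, bnd A K & 0 <= K].

Lemma good_pform m (A : ('I_m.+1 -> X) -> C) K x : good A K -> good (pform A x) (K * rnorm x).
Proof. by move=> [Am AK K0]; split; [exact: Am.2|exact: bnd_pform|rewrite mulr_ge0 ?rnorm_ge0]. Qed.

Lemma iterated_lim_dual_step m (A : ('I_m.+1 -> X) -> C) K (zs : 'I_m -> bidual X) :
  (forall (B B' : ('I_m -> X) -> C) a L L', good B L -> good B' L' ->
     iterated_lim (fun v => a * B v + B' v) zs = a * iterated_lim B zs + iterated_lim B' zs) ->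
  (forall (B : ('I_m -> X) -> C) L, good B L ->
     rnorm (iterated_lim B zs) <= L * \prod_i rnorm (zs i)) ->
  good A K -> exists G : dual X, forall x, G x = iterated_lim (pform A x) zs.
Proof.
move=> lin bd Ag; apply: (@dual_exists _ _ _ (K * \prod_i rnorm (zs i))).
  move=> a x y; rewrite -(lin _ _ a _ _ (good_pform x Ag) (good_pform y Ag)).
  congr (iterated_lim _ _); apply/funext => v; case: Ag => Am _ _.
  by rewrite /pform mlin_pformD// mlin_pformZ.
by move=> x; apply: le_trans (bd _ _ (good_pform x Ag)) _; rewrite mulrAC.
Qed.

Lemma iterated_limS m (A : ('I_m.+1 -> X) -> C) (zs : 'I_m.+1 -> bidual X) (G : dual X) :
  (forall x, G x = iterated_lim (pform A x) (fun i => zs (lift ord0 i))) ->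
  iterated_lim A zs = zs ord0 G.
Proof.
move=> HG; rewrite -weakstar_lim.
suff -> : dual_val G = fun x => iterated_lim (pform A x) (fun i => zs (lift ord0 i)) by [].
exact/funext.
Qed.

(** Linearity in the form and boundedness are proved together: they make the
    inner iterated limit a bounded functional of the outermost variable, on which
    the weak-star limit is evaluation of z. *)
Lemma iterated_lim_theory m :
  (forall (A B : ('I_m -> X) -> C) a K L zs, good A K -> good B L ->
     iterated_lim (fun v => a * A v + B v) zs = a * iterated_lim A zs + iterated_lim B zs) /\
  (forall (A : ('I_m -> X) -> C) K zs, good A K ->
     rnorm (iterated_lim A zs) <= K * \prod_i rnorm (zs i)).
Proof.
elim: m => [|m [lin bd]].
  split=> // A K zs [_ AK _] /=; apply: le_trans (AK _) _.
  by rewrite !big_ord0.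
have ex A K zs : good A K -> exists G : dual X, forall x, G x = @iterated_lim R X m (pform A x) zs.
  by move=> Ag; apply: (iterated_lim_dual_step _ _ Ag) => [B B' a L L'|B L]; [exact: lin|exact: bd].
split=> [A B a K L zs Ag Bg|A K zs Ag].
  pose tl i := zs (lift ord0 i).
  have [G HG] := ex A K tl Ag; have [H HH] := ex B L tl Bg.
  rewrite (iterated_limS HG) (iterated_limS HH).
  rewrite (@iterated_limS _ _ zs (a *: G + H)); first by rewrite dualD dualZ.
  move=> x; rewrite dualDE dualZE HG HH.
  by rewrite -(lin _ _ a _ _ tl (good_pform x Ag) (good_pform x Bg)).
pose tl i := zs (lift ord0 i).
have [G HG] := ex A K tl Ag; rewrite (iterated_limS HG).
apply: le_trans (dual_bound _ _) _; rewrite big_ord_recl mulrCA ler_wpM2l ?rnorm_ge0//.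
rewrite rnorm_dual; apply: dual_norm_le => x; rewrite rnorm_le1 => x1.
rewrite -rnorm_modulus HG; apply: le_trans (bd _ _ _ (good_pform x Ag)) _.
case: Ag => _ _ K0; rewrite mulrAC ler_piMr// mulr_ge0//.
by apply: prodr_ge0 => i _; exact: rnorm_ge0.
Qed.

Lemma iterated_lim_dual m (A : ('I_m.+1 -> X) -> C) K (zs : 'I_m -> bidual X) :
  good A K -> exists G : dual X, (forall x, G x = iterated_lim (pform A x) zs) /\
    forall z, iterated_lim A (fcons z zs) = z G.
Proof.
move=> Ag; have [lin bd] := iterated_lim_theory m.
have [|B L|G HG] := @iterated_lim_dual_step m A K zs _ _ Ag.
- by move=> B B' a L L'; exact: lin.
- exact: bd.
exists G; split => // z; rewrite (@iterated_limS _ _ (fcons z zs) G) ?fcons0//.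
by move=> x; rewrite HG; congr (iterated_lim _ _); apply/funext => i; rewrite fconsS.
Qed.

Lemma iterated_lim_bnd m (A : ('I_m -> X) -> C) K : good A K -> bnd (iterated_lim A) K.
Proof. by move=> Ag zs; exact: (iterated_lim_theory m).2. Qed.

(** In the inner variables, linearity is that of the functional of which the
    outermost limit is the value at z0. *)
Lemma iterated_lim_mlin m (A : ('I_m -> X) -> C) K : good A K -> mlin (iterated_lim A).
Proof.
move=> Ag; apply: multilinear_mlin.
elim: m A K Ag => [|m IH] A K Ag; first by move=> [].
move=> i zs a w w'; pose z0 := zs ord0; pose tl (j : 'I_m) := zs (lift ord0 j).
have -> : zs = fcons z0 tl by exact: fcons_eta.
case: (unliftP ord0 i) => [j ->|->]; last first.
  have E (w1 : bidual X) : [eta fcons z0 tl with ord0 |-> w1] = fcons w1 tl :> ('I_m.+1 -> bidual X).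
    by apply/funext => k; case: (unliftP ord0 k) => [j ->|->] /=; rewrite ?fconsS ?fcons0.
  have [G [_ HG]] := iterated_lim_dual tl Ag.
  by rewrite !E !HG.
have E (w1 : bidual X) : [eta fcons z0 tl with lift ord0 j |-> w1] = fcons z0 [eta tl with j |-> w1] :> ('I_m.+1 -> bidual X).
  apply/funext => k; case: (unliftP ord0 k) => [l ->|->] /=; rewrite ?fconsS ?fcons0//.
rewrite !E.
have [G1 [H1 ->]] := iterated_lim_dual [eta tl with j |-> a *: w + w'] Ag.
have [G2 [H2 ->]] := iterated_lim_dual [eta tl with j |-> w] Ag.
have [G3 [H3 ->]] := iterated_lim_dual [eta tl with j |-> w'] Ag.
rewrite -[RHS](dual_lin z0); congr (z0 _); apply: dual_ext => x.
rewrite dualDE dualZE H1 H2 H3; exact: (IH _ _ (good_pform x Ag)).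
Qed.

(** The canonical extension of the polynomial diag A. *)
Definition abz m (A : ('I_m -> X) -> C) z : C := iterated_lim A (fun=> z).

Lemma abz_dual m (A : ('I_m.+1 -> X) -> C) K z : good A K ->
  exists G : dual X, (forall x, G x = abz (pform A x) z) /\ abz A z = z G.
Proof.
move=> Ag; have [G [HG E]] := iterated_lim_dual (fun=> z) Ag.
by exists G; split => //; rewrite -E /abz (fcons_const m z).
Qed.

Lemma abz_bound m (A : ('I_m -> X) -> C) K z : good A K -> rnorm (abz A z) <= K * rnorm z ^+ m.
Proof. by move=> Ag; exact: (bnd_diag z (iterated_lim_bnd Ag)). Qed.

End IteratedLim.

(** * Approximation of canonical extensions by values *)

Section DavieGamelin.
Variables (R : realType) (X : normedModType R[i]).
Local Notation C := R[i].
Local Notation form := {m : nat & ('I_m -> X) -> C}.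

Lemma pow_taylor2 (m : nat) (u h : R) : 0 <= u -> 0 <= h -> u + h <= 1 ->
  `|(u + h) ^+ m.+1 - u ^+ m.+1 - m.+1%:R * (h * u ^+ m)| <= m.+1%:R ^+ 2 * h ^+ 2.
Proof.
move=> u0 h0 uh; have u1 : u <= 1 by lra.
have lip k : `|(u + h) ^+ k - u ^+ k| <= k%:R * h.
  elim: k => [|k IH]; first by rewrite !expr0 subrr normr0 mul0r.
  have -> : (u + h) ^+ k.+1 - u ^+ k.+1 = (u + h) * ((u + h) ^+ k - u ^+ k) + h * u ^+ k by rewrite !exprS; ring.
  apply: le_trans (ler_normD _ _) _; rewrite !normrM (ger0_norm h0) (ger0_norm (addr_ge0 u0 h0)).
  rewrite -natr1 (mulrDl k%:R) mul1r lerD//; last by rewrite ler_piMr// ger0_norm ?exprn_ge0 ?exprn_ile1.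
  by apply: le_trans IH; rewrite ler_piMl.
elim: m => [|m IH].
  rewrite (_ : _ - _ = 0); last by rewrite expr0 mulr1; ring.
  by rewrite normr0 mulr_ge0 ?sqr_ge0.
have -> : (u + h) ^+ m.+2 - u ^+ m.+2 - m.+2%:R * (h * u ^+ m.+1) =
  h * ((u + h) ^+ m.+1 - u ^+ m.+1) + u * ((u + h) ^+ m.+1 - u ^+ m.+1 - m.+1%:R * (h * u ^+ m)).
  by rewrite -[m.+2%:R]natr1 !(exprS _ m.+1) [u ^+ m.+1]exprS; ring.
apply: le_trans (ler_normD _ _) _; rewrite !normrM (ger0_norm h0) (ger0_norm u0).
have h1 : h * `|(u + h) ^+ m.+1 - u ^+ m.+1| <= h * (m.+1%:R * h) by rewrite ler_wpM2l.
have h2 : u * `|(u + h) ^+ m.+1 - u ^+ m.+1 - m.+1%:R * (h * u ^+ m)| <= m.+1%:R ^+ 2 * h ^+ 2.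
  by apply: le_trans IH; rewrite ler_piMl.
have h3 : 0 <= h * h * (m.+1%:R + 1) by rewrite !mulr_ge0.
rewrite -[m.+2%:R]natr1; move: h1 h2 h3; rewrite !expr2; lra.
Qed.

(** As if xs were an end segment of a sequence converging weak-star to z: along
    every subsequence of xs, fixing its points one by one as arguments of A changes
    the iterated limit at z by at most eps each time. *)
Fixpoint generic (eps : R) (z : bidual X) (xs : seq X) :
    forall m, (('I_m -> X) -> C) -> Prop :=
  if xs is x :: xs' then fun m =>
    if m is k.+1 then fun A => [/\ generic eps z xs' A,
      rnorm (abz (pform A x) z - abz A z) <= eps & generic eps z xs' (pform A x)]
    else fun=> True
  else fun _ _ => True.

Lemma good_le m (A : ('I_m -> X) -> C) K K' : K <= K' -> good A K -> good A K'.
Proof. by move=> KK [Am AK K0]; split=> //; [exact: bnd_le AK|exact: le_trans KK]. Qed.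

Lemma good_pform1 m (A : ('I_m.+1 -> X) -> C) K x : rnorm x <= 1 -> good A K ->
  good (pform A x) K.
Proof.
move=> x1 Ag; apply: good_le (good_pform x Ag); case: Ag => _ _ K0.
by rewrite ler_piMr.
Qed.

Definition next_form (x : X) (mA : form) : form :=
  match mA with
  | existT 0 A => existT (fun m => ('I_m -> X) -> C) 0%N A
  | existT k.+1 A => existT (fun m => ('I_m -> X) -> C) k (pform A x)
  end.

(** By abz_dual, the condition on one more point of a generic sequence concerns
    the values at it of finitely many functionals. *)
Lemma next_functionals (z : bidual X) (K : R) (L : seq form) :
  (forall mA, List.In mA L -> good (projT2 mA) K) ->
  exists gs : seq (dual X), forall (x : X) (eps : R),
    (forall g, g \in gs -> rnorm (g x - z g) <= eps) ->
    forall mA, List.In mA L -> 0 <= eps ->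
      rnorm (abz (projT2 (next_form x mA)) z - abz (projT2 mA) z) <= eps.
Proof.
elim: L => [|[m A] L IH] LK; first by exists [::].
have [|gs Hgs] := IH; first by move=> mA mAL; apply: LK; right.
have Ag : good A K by apply: (LK (existT _ m A)); left.
case: m A Ag {LK IH} => [|m] A Ag.
  exists gs => x eps xg mA [<-|mAL] e0; last exact: Hgs.
  by rewrite /= subrr rnorm0.
have [G [HG AG]] := abz_dual z Ag.
exists (G :: gs) => x eps xg mA [<-|mAL] e0.
  by rewrite /= AG -HG; apply: xg; rewrite mem_head.
by apply: Hgs => // g gg; apply: xg; rewrite in_cons gg orbT.
Qed.

Lemma generic_exists (z : bidual X) (K s eps : R) (n : nat) (L : seq form) :
  rnorm z <= s -> 0 < s -> s <= 1 -> 0 < eps ->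
  (forall mA, List.In mA L -> good (projT2 mA) K) ->
  exists xs : seq X, [/\ size xs = n, (forall x, x \in xs -> rnorm x <= s) &
    forall mA, List.In mA L -> generic eps z xs (projT2 mA)].
Proof.
move=> zs s0 s1 e0; elim: n L => [|n IH] L LK.
  by exists [::]; split=> // -[m A].
have [gs Hgs] := next_functionals z LK.
have [x [xs xg]] := goldstine gs zs s0 e0.
have [|ys [ysn yss ysg]] := IH (L ++ map (next_form x) L).
  move=> mA /(List.in_app_iff _ _ _)[/LK//|/List.in_map_iff[[m A] [<- mAL]]].
  have := LK _ mAL; case: m A mAL => [//|m] A mAL /=.
  by apply: good_pform1; exact: le_trans xs s1.
exists (x :: ys); split; first by rewrite /= ysn.
  by move=> y; rewrite in_cons => /orP[/eqP->//|/yss].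
move=> mA mAL; have nx := Hgs x eps xg _ mAL (ltW e0).
have := ysg mA; have := ysg (next_form x mA).
case: mA mAL nx => -[//|m] A mAL nx /= h1 h2; split => //.
  by apply: h2; apply/List.in_app_iff; left.
apply: h1; apply/List.in_app_iff; right; apply/List.in_map_iff.
by exists (existT _ m.+1 A).
Qed.

(** Add the points of the sequence to the mean one by one, t being the proportion
    already added.  By diag_taylor2 a new point changes the diagonal by (m + 1)/N
    times the form with that point frozen; by induction on the degree this form
    has value about t^m abz A z at the partial mean, and (m + 1) t^m integrates to
    t^(m+1).  The factor t in the error bound sums the errors of the steps. *)
Lemma generic_average (K : R) (m : nat) : 0 <= K -> exists2 M : R, 0 <= M &
  forall (A : ('I_m -> X) -> C) (z : bidual X) (N : nat) (eps : R) (xs : seq X),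
  good A K -> Defs.symmetric_form A -> rnorm z <= 1 -> (0 < N)%N -> 0 <= eps ->
  (size xs <= N)%N -> (forall x, x \in xs -> rnorm x <= 1) -> generic eps z xs A ->
  rnorm (diag A (N%:R^-1 *: \sum_(x <- xs) x) - ((size xs)%:R / N%:R) ^+ m * abz A z) <=
    M * ((size xs)%:R / N%:R) * (N%:R^-1 + eps).
Proof.
move=> K0; elim: m => [|m [M M0 IH]].
  exists 0 => // A z N eps xs _ _ _ _ _ _ _ _.
  by rewrite /diag /abz /= (ord0_fun (fun=> _ *: _) (fun=> 0)) expr0 mul1r subrr rnorm0 !mul0r.
exists (m.+1%:R * M + m.+1%:R + 2 * (K * m.+1%:R ^+ 2)).
  by rewrite !addr_ge0 ?mulr_ge0 ?exprn_ge0.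
move=> A z N eps xs Ag As z1 N0 e0.
have N0' : 0 < N%:R :> R by rewrite ltr0n.
elim: xs => [|x xs IHx] /= sN xs1 gen.
  rewrite big_nil scaler0 !mul0r mulr0 mul0r /diag (fcons_const m 0) mlin_pform0; last by case: Ag.
  by rewrite exprS !mul0r subrr rnorm0.
have [gen1 gen2 gen3] := gen.
have x1 : rnorm x <= 1 by apply: xs1; rewrite mem_head.
have xs1' y : y \in xs -> rnorm y <= 1 by move=> yx; apply: xs1; rewrite in_cons yx orbT.
have sN' := ltnW sN.
have I1 := IHx sN' xs1' gen1.
have I2 := IH (pform A x) z N eps xs (good_pform1 x1 Ag) (sym_pform x As) z1 N0 e0 sN' xs1' gen3.
pose y := N%:R^-1 *: \sum_(x <- xs) x; pose t : R := (size xs)%:R / N%:R; pose tau : R := N%:R^-1.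
rewrite -/y -/t -/tau in I1 I2 *.
have tau0 : 0 < tau by rewrite invr_gt0.
have t0 : 0 <= t by rewrite divr_ge0.
have tt : t + tau <= 1 by rewrite /t /tau -[X in _ + X]mul1r -mulrDl natr1 ler_pdivrMr// mul1r ler_nat.
have sE : (size xs).+1%:R / N%:R = t + tau by rewrite -natr1 mulrDl mul1r.
have nN k : (k%:R / N%:R : C) = (k%:R / N%:R : R)%:C by rewrite rmorphM fmorphV !rmorph_nat.
have nNs (v : X) : N%:R^-1 *: v = (tau%:C : C) *: v by rewrite /tau fmorphV rmorph_nat.
rewrite big_cons scalerDr -/y nNs !nN sE; rewrite !nN -/t in I1 I2.
have ny : rnorm y <= t.
  rewrite /y nNs rnormZ rnorm_pos ?(ltW tau0)// mulrC /t ler_pM2r//.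
  apply: le_trans (rnorm_sum _ _ _) _.
  rewrite big_seq_cond; apply: (@le_trans _ _ (\sum_(v <- xs | (v \in xs) && true) 1)).
    by apply: ler_sum => v /andP[vx _]; exact: xs1'.
  by rewrite -big_seq_cond big_const_seq count_predT iter_addr_0.
have nx : rnorm (tau%:C *: x) <= tau.
  by rewrite rnormZ rnorm_pos ?(ltW tau0)// ler_piMr// ltW.
have nxy : rnorm (tau%:C *: x + y) <= 1 by have := rnormD (tau%:C *: x) y; lra.
case: (Ag) => Am AK _.
have nx1 : rnorm (tau%:C *: x) <= 1 by lra.
have ny1 : rnorm y <= 1 by lra.
have T2 := diag_taylor2 Am As AK K0 nx1 ny1 nxy.
rewrite mlin_pformZ// in T2.
set a := abz A z in I1 gen2 *; set b := abz (pform A x) z in I2 gen2.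
set S := diag A (_ + y) in T2 *; set D := diag A y in I1 T2 *.
have AE : A (fcons x (fun=> y)) = diag (pform A x) y by [].
rewrite AE in T2; set E := diag (pform A x) y in I2 T2 *.
have m0 : (0 : R) <= m.+1%:R by [].
have aK : rnorm a <= K.
  apply: le_trans (abz_bound z Ag) _; by rewrite ler_piMr// exprn_ile1// rnorm_ge0.
have P2 := pow_taylor2 m t0 (ltW tau0) tt.
set P := ((t + tau) ^+ m.+1 - t ^+ m.+1 - m.+1%:R * (tau * t ^+ m)) in P2.
have PE : ((t + tau)%:C ^+ m.+1 : C) = P%:C + t%:C ^+ m.+1 + m.+1%:R * (tau%:C * t%:C ^+ m).
  by rewrite /P !(rmorphB, rmorphD, rmorphM, rmorphXn, rmorph_nat) /=; ring.
have -> : S - (t + tau)%:C ^+ m.+1 * a =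
   (S - D - m.+1%:R * (tau%:C * E)) + (D - t%:C ^+ m.+1 * a)
   + (m.+1%:R * tau%:C * (E - t%:C ^+ m * b) + (m.+1%:R * tau%:C * t%:C ^+ m * (b - a) - P%:C * a)).
  by rewrite PE; ring.
have T2' : rnorm (S - D - m.+1%:R * (tau%:C * E)) <= K * m.+1%:R ^+ 2 * tau ^+ 2.
  apply: le_trans T2 _.
  rewrite ler_wpM2l ?mulr_ge0 ?exprn_ge0// lerXn2r// nnegrE ?rnorm_ge0//; exact: ltW.
have q1 : rnorm (m.+1%:R * tau%:C * (E - t%:C ^+ m * b)) <= m.+1%:R * tau * (M * (tau + eps)).
  rewrite !rnormM rnorm_nat rnorm_pos ?(ltW tau0)// ler_wpM2l ?mulr_ge0 ?(ltW tau0)//.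
  apply: le_trans I2 _; rewrite ler_wpM2r ?addr_ge0 ?(ltW tau0)// ler_piMr//; lra.
have q2 : rnorm (m.+1%:R * tau%:C * t%:C ^+ m * (b - a)) <= m.+1%:R * tau * eps.
  rewrite !rnormM rnormX rnorm_nat !rnorm_pos ?(ltW tau0)//.
  rewrite -mulrA ler_wpM2l ?mulr_ge0 ?(ltW tau0)//.
  by apply: le_trans gen2; rewrite ler_piMl ?rnorm_ge0// exprn_ile1//; lra.
have q3 : rnorm (P%:C * a) <= m.+1%:R ^+ 2 * tau ^+ 2 * K.
  by rewrite rnormM rnorm_real; apply: ler_pM; rewrite ?rnorm_ge0.
move: T2' I1 q1 q2 q3.
set v1 := (S - D - _); set v2 := (D - _); set v3 := m.+1%:R * tau%:C * (E - _).
set v4 := m.+1%:R * tau%:C * t%:C ^+ m * (b - a); set v5 := P%:C * a => T2' I1 q1 q2 q3.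
have := rnormD (v1 + v2) (v3 + (v4 - v5)); have := rnormD v1 v2.
have := rnormD v3 (v4 - v5); have := rnormB v4 v5.
have p1 : 0 <= m.+1%:R * tau * tau by rewrite !mulr_ge0// ltW.
have p2 : 0 <= K * m.+1%:R ^+ 2 * (tau * eps) by rewrite !mulr_ge0 ?exprn_ge0// ltW.
have -> : (m.+1%:R * M + m.+1%:R + 2 * (K * m.+1%:R ^+ 2)) * (t + tau) * (tau + eps) =
  (m.+1%:R * M + m.+1%:R + 2 * (K * m.+1%:R ^+ 2)) * t * (tau + eps) +
  (m.+1%:R * tau * (M * (tau + eps)) + m.+1%:R * tau * eps + m.+1%:R * tau * tau
   + 2 * (K * m.+1%:R ^+ 2 * tau ^+ 2) + 2 * (K * m.+1%:R ^+ 2 * (tau * eps))) by ring.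
lra.
Qed.

(** The theorem of Davie and Gamelin.  The point x is the mean of a long sequence
    that is generic for all members of L. *)
Lemma davie_gamelin (z : bidual X) (s e : R) (L : seq form) :
  rnorm z <= s -> 0 < s -> s <= 1 -> 0 < e ->
  (forall mA, List.In mA L -> Defs.symmetric_form (projT2 mA) /\ exists K, good (projT2 mA) K) ->
  exists x : X, rnorm x <= s /\
    forall mA, List.In mA L -> rnorm (diag (projT2 mA) x - abz (projT2 mA) z) <= e.
Proof.
move=> zs s0 s1 e0 LK.
have [K K0 Lg] : exists2 K, 0 <= K & forall mA, List.In mA L -> good (projT2 mA) K.
  elim: L LK => [|mA L IH] LK; first by exists 0.
  have [|K K0 HK] := IH; first by move=> mB mBL; apply: LK; right.
  have [_ [K' HK']] := LK mA (or_introl erefl).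
  exists (Num.max K K'); first by rewrite le_max K0.
  move=> mB [<-|/HK h]; first by apply: (good_le _ HK'); rewrite le_max lexx orbT.
  by apply: (good_le _ h); rewrite le_max lexx.
have [M M0 HM] : exists2 M : R, 0 <= M & forall mA, List.In mA L ->
   forall (N : nat) (eps : R) (xs : seq X), (0 < N)%N -> 0 <= eps -> size xs = N ->
   (forall x, x \in xs -> rnorm x <= 1) -> generic eps z xs (projT2 mA) ->
   rnorm (diag (projT2 mA) (N%:R^-1 *: \sum_(x <- xs) x) - abz (projT2 mA) z) <= M * (N%:R^-1 + eps).
  elim: L LK Lg => [|mA L IH] LK Lg; first by exists 0.
  have [|mB mBL|M M0 HM] := IH; [by move=> mB mBL; apply: LK; right|by apply: Lg; right|].
  have [M' M'0 HM'] := @generic_average K (projT1 mA) K0.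
  exists (M + M'); first exact: addr_ge0.
  move=> mB [<-|mBL] N eps xs N0 ep0 sx x1 gen.
    have [As _] := LK mA (or_introl erefl); have Ag := Lg mA (or_introl erefl).
    have := HM' (projT2 mA) z N eps xs Ag As (le_trans zs s1) N0 ep0 _ x1 gen.
    rewrite sx leqnn !divff ?pnatr_eq0 -?lt0n// expr1n mul1r mulr1 => /(_ isT) h.
    by apply: le_trans h _; rewrite ler_wpM2r ?addr_ge0 ?invr_ge0// lerDr.
  apply: le_trans (HM mB mBL N eps xs N0 ep0 sx x1 gen) _.
  by rewrite ler_wpM2r ?addr_ge0 ?invr_ge0// lerDl.
pose eps := e / (2 * (M + 1)).
have M1 : 0 < 2 * (M + 1) by lra.
have eps0 : 0 < eps by rewrite divr_gt0.
pose N := (Num.truncn eps^-1).+1.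
have NE : N%:R^-1 <= eps.
  rewrite -[leRHS]invrK lef_pV2 ?posrE ?invr_gt0 ?ltr0n//; apply: ltW; exact: truncnS_gt.
have [xs [sx xs1 gen]] := generic_exists N zs s0 s1 eps0 Lg.
exists (N%:R^-1 *: \sum_(x <- xs) x); split.
  rewrite rnormZ rnormV rnorm_nat mulrC ler_pdivrMr ?ltr0n//.
  apply: le_trans (rnorm_sum _ _ _) _.
  rewrite big_seq_cond; apply: (@le_trans _ _ (\sum_(v <- xs | (v \in xs) && true) s)).
    by apply: ler_sum => v /andP[vx _]; exact: xs1.
  by rewrite -big_seq_cond big_const_seq count_predT iter_addr_0 sx mulr_natr.
move=> mA mAL; apply: le_trans (HM mA mAL N eps xs isT (ltW eps0) sx _ (gen _ mAL)) _.
  by move=> x /xs1 xs'; exact: le_trans xs' s1.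
have : M * (N%:R^-1 + eps) <= M * (eps + eps) by rewrite ler_wpM2l// lerD2r.
move=> h; apply: le_trans h _; have -> : e = eps * (2 * (M + 1)) by rewrite /eps divfK// gt_eqF.
have := ltW eps0; lra.
Qed.

End DavieGamelin.

(** * Polarization *)

Section Polarization.
Variables (R : realType) (V : normedModType R[i]).
Local Notation C := R[i].
Implicit Types (P Q : V -> C) (x y w h : V).

(** Polynomials in the sense of Frechet: polynomial along every line. *)
Definition line_poly (n : nat) P := forall x y, exists p : {poly C},
  (size p <= n)%N /\ forall t, P (x + t *: y) = p.[t].

Variable m : nat.
Local Notation N := (2 ^ m.+2)%N.

Let mN : (m.+1 + m.+1 <= N)%N.
Proof.
rewrite addnn -mul2n expnS leq_mul2l /=; exact: (leq_trans (leqnSn _) (ltn_expl m.+1 (isT : 1 < 2)%N)).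
Qed.

Let mN1 : (m.+1 <= N)%N. Proof. exact: leq_trans (leq_addr _ _) mN. Qed.

(** The coefficient of t in Q (w + t y), that is, the derivative of Q in the
    direction y; as an average it is visibly linear in Q, and the exchange of two
    derivatives is an exchange of finite sums. *)
Definition dirder y Q w : C := avgc m.+1 1 (fun t => Q (w + t *: y)).

Lemma line_poly_coef Q x y t : line_poly m.+1 Q ->
  Q (x + t *: y) = \sum_(l < m.+1) avgc m.+1 l (fun s => Q (x + s *: y)) * t ^+ l.
Proof.
move=> /(_ x y)[p [sp Hp]]; rewrite Hp (horner_coef_wide _ sp).
apply: eq_bigr => l _; rewrite (_ : (fun s => _) = (fun s => p.[s])); last exact/funext.
by rewrite avgc_poly; [|exact: leq_trans sp mN1|exact: leq_trans (ltn_ord l) mN1].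
Qed.

Lemma line_poly2 Q w y h s t : line_poly m.+1 Q ->
  Q (w + s *: y + t *: h) = \sum_(k < m.+1) \sum_(l < m.+1)
    avgc m.+1 k (fun s => avgc m.+1 l (fun t => Q (w + s *: y + t *: h))) * s ^+ k * t ^+ l.
Proof.
move=> Ql; rewrite addrAC line_poly_coef//; apply: eq_bigr => k _.
rewrite (_ : (fun s => _) = (fun s => \sum_(l < m.+1)
   avgc m.+1 l (fun t => Q (w + s *: y + t *: h)) * t ^+ l)); last first.
  by apply/funext => s'; rewrite addrAC line_poly_coef.
rewrite avgc_sum mulr_suml; apply: eq_bigr => l _.
rewrite (_ : (fun s => _) = (fun s' => t ^+ l * avgc m.+1 l (fun t => Q (w + s' *: y + t *: h)))).
  by rewrite avgcZ; ring.
by apply/funext => s'; rewrite mulrC.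
Qed.

(** Q (w + s y + t h) is a polynomial in s and t; of its substitutions s = a t
    and t, the terms of total degree 1 are linear in a. *)
Lemma dirder_linear Q w a y h : line_poly m.+1 Q ->
  dirder (a *: y + h) Q w = a * dirder y Q w + dirder h Q w.
Proof.
move=> Ql; pose q k l := avgc m.+1 k (fun s => avgc m.+1 l (fun t => Q (w + s *: y + t *: h))).
have E (u v : C -> C) (al be : C) : (forall t, u t = al * t) -> (forall t, v t = be * t) ->
    avgc m.+1 1 (fun t => Q (w + u t *: y + v t *: h)) =
    \sum_(k < m.+1) \sum_(l < m.+1) q k l * al ^+ k * be ^+ l * (k + l == 1)%N%:R.
  move=> uE vE.
  rewrite (_ : (fun t => _) = (fun t => \sum_(k < m.+1) \sum_(l < m.+1)
     (q k l * al ^+ k * be ^+ l * t ^+ (k + l)))); last first.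
    apply/funext => t; rewrite line_poly2//; apply: eq_bigr => k _; apply: eq_bigr => l _.
    by rewrite uE vE -/(q k l) !exprMn exprD; ring.
  rewrite avgc_sum; apply: eq_bigr => k _; rewrite avgc_sum; apply: eq_bigr => l _.
  rewrite avgcZ avgc_powE//.
  - by rewrite expnS -{1}[1%N]muln1; apply: (@leq_trans (2 * 1)) => //; rewrite leq_mul2l expn_gt0.
  - by apply: leq_trans mN; rewrite -addSn leq_add// ltnW.
rewrite /dirder.
rewrite (_ : (fun t => _) = (fun t => Q (w + (a * t) *: y + (1 * t) *: h))); last first.
  by apply/funext => t; rewrite scalerDr addrA scalerA mulrC mul1r.
rewrite [X in _ = a * avgc _ _ X + _](_ : _ = (fun t => Q (w + (1 * t) *: y + (0 * t) *: h))); last first.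
  by apply/funext => t; rewrite mul1r mul0r scale0r addr0.
rewrite [X in _ = _ + avgc _ _ X](_ : _ = (fun t => Q (w + (0 * t) *: y + (1 * t) *: h))); last first.
  by apply/funext => t; rewrite mul1r mul0r scale0r addr0.
rewrite (E (fun t => a * t) (fun t => 1 * t) a 1)// (E (fun t => 1 * t) (fun t => 0 * t) 1 0)//.
rewrite (E (fun t => 0 * t) (fun t => 1 * t) 0 1)//.
rewrite mulr_sumr -big_split; apply: eq_bigr => k _ /=.
rewrite mulr_sumr -big_split; apply: eq_bigr => l _ /=.
case: (nat_of_ord l) (nat_of_ord k) => [|[|l']] [|[|k']]; rewrite ?addn0 ?add0n ?addnS ?addSn /=;
  rewrite ?expr0 ?expr1 ?expr1n ?(exprS 0) ?mul0r ?mulr0 ?mulr1 ?mul1r ?addr0 ?add0r//; ring.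
Qed.

Lemma dirder_line_poly y Q : line_poly m.+1 Q -> line_poly m.+1 (dirder y Q).
Proof.
move=> Ql w h.
exists (\poly_(l < m.+1) avgc m.+1 1 (fun s => avgc m.+1 l (fun t => Q (w + s *: y + t *: h)))).
split=> [|t]; first exact: size_poly.
rewrite horner_poly /dirder.
rewrite (_ : (fun s => _) = (fun s => \sum_(l < m.+1)
   avgc m.+1 l (fun t => Q (w + s *: y + t *: h)) * t ^+ l)); last first.
  by apply/funext => s'; rewrite addrAC line_poly_coef.
rewrite avgc_sum; apply: eq_bigr => l _.
rewrite (_ : (fun s => _) = (fun s' => t ^+ l * avgc m.+1 l (fun t => Q (w + s' *: y + t *: h)))).
  by rewrite avgcZ mulrC.
by apply/funext => s'; rewrite mulrC.
Qed.

Lemma dirderC x y Q : dirder x (dirder y Q) = dirder y (dirder x Q).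
Proof.
apply/funext => w; rewrite /dirder /avgc.
rewrite [LHS]mulr_sumr [RHS]mulr_sumr.
transitivity (\sum_(i < N) \sum_(j < N) N%:R^-1 * (N%:R^-1 *
  (Q (w + droot R m.+1 ^+ i *: x + droot R m.+1 ^+ j *: y) *
    (droot R m.+1 ^+ j)^-1 * (droot R m.+1 ^+ i)^-1))).
  by apply: eq_bigr => i _; rewrite mulr_sumr mulr_suml mulr_sumr; apply: eq_bigr => j _; rewrite !expr1; ring.
rewrite exchange_big /=; apply: eq_bigr => i _.
rewrite mulr_sumr mulr_suml mulr_sumr; apply: eq_bigr => j _.
rewrite !expr1 [w + _ + _]addrAC; ring.
Qed.

Definition dirders (s : seq V) P : V -> C := foldr dirder P s.

Lemma dirders_perm s1 s2 P : perm_eq s1 s2 -> dirders s1 P = dirders s2 P.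
Proof.
have mv x a b : dirders (a ++ x :: b) P = dirders (x :: a ++ b) P.
  elim: a => [//|y a IH]; rewrite /dirders /= -/(dirders _ P) IH /=.
  exact: dirderC.
elim: s1 s2 => [|x s1 IH] s2 s12.
  by move: s12; rewrite perm_sym => /perm_nilP ->.
have xs2 : x \in s2 by rewrite -(perm_mem s12) mem_head.
case/splitPr: xs2 s12 => a b; rewrite perm_sym perm_catC /= perm_cons perm_catC perm_sym => s12.
by rewrite mv /dirders /= -/(dirders _ P) (IH _ s12).
Qed.

Lemma dirders_line_poly s P : line_poly m.+1 P -> line_poly m.+1 (dirders s P).
Proof. by move=> Pl; elim: s => [//|y s IH]; exact: dirder_line_poly. Qed.

(** Euler's identity, iterated. *)
Lemma dirders_nseq j x P (u : C) : (forall a y, P (a *: y) = a ^+ m * P y) -> (j <= m)%N ->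
  dirders (nseq j x) P (u *: x) = (m ^_ j)%:R * u ^+ (m - j) * P x.
Proof.
move=> PZ; elim: j u => [|j IH] u jm; first by rewrite /= PZ ffactn0 mul1r subn0.
rewrite /dirders /= -/(dirders (nseq j x) P) /dirder.
rewrite (_ : (fun t => _) = (fun t => (m ^_ j)%:R * P x * (('X + u%:P) ^+ (m - j)).[t])); last first.
  apply/funext => t; rewrite -scalerDl IH ?(ltnW jm)// horner_exp !hornerE [u + t]addrC; ring.
rewrite avgcZ avgc_poly.
- rewrite -[_`_1]mulr1n -coef_deriv deriv_exp derivD derivX derivC addr0 mul1r.
  rewrite coefMn -horner_coef0 horner_exp !hornerE ffactnSr natrM subnS.
  by rewrite -mulr_natr; ring.
- rewrite (leq_trans (size_poly_exp_leq _ _))// size_XaddC /= mul1n.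
  by apply: leq_trans mN; rewrite addSn ltnS; exact: leq_trans (leq_subr _ _) (leq_addr _ _).
- by rewrite expnS -{1}[1%N]muln1; apply: (@leq_trans (2 * 1)) => //; rewrite leq_mul2l expn_gt0.
Qed.

(** The polarization formula in terms of derivatives: symmetry is then the exchange
    of derivatives, and multilinearity their linearity in the direction. *)
Definition polar P (v : 'I_m -> V) : C := m`!%:R^-1 * dirders [seq v i | i <- enum 'I_m] P 0.

Lemma polar_diag P x : (forall a y, P (a *: y) = a ^+ m * P y) -> polar P (fun=> x) = P x.
Proof.
move=> PZ; rewrite /polar.
have -> : [seq x | _ <- enum 'I_m] = nseq m x by apply: (@eq_from_nth _ 0) => [|i]; rewrite ?size_nseq size_map size_enum_ord// => im; rewrite nth_nseq im (nth_map (Ordinal im)) ?size_enum_ord.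
rewrite -(scale0r x) dirders_nseq// subnn expr0 mulr1 ffactnn mulKf//.
Qed.

Lemma polar_sym P : Defs.symmetric_form (polar P).
Proof.
move=> s v; rewrite /polar; congr (_ * _).
rewrite (@dirders_perm _ [seq v i | i <- enum 'I_m])//.
rewrite (map_comp v s); apply: perm_map; apply: uniq_perm.
- by rewrite map_inj_uniq ?enum_uniq//; exact: perm_inj.
- exact: enum_uniq.
- move=> i; rewrite mem_enum; apply/mapP; exists (s^-1%g i); first by rewrite mem_enum.
  by rewrite permKV.
Qed.

Lemma polar_multilinear P : line_poly m.+1 P -> multilinear (polar P).
Proof.
move=> Pl i v a x y.
have E z : polar P [eta v with i |-> z] =
    m`!%:R^-1 * dirder z (dirders [seq v j | j <- rem i (enum 'I_m)] P) 0.
  rewrite /polar; congr (_ * _).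
  rewrite (@dirders_perm _ (z :: [seq v j | j <- rem i (enum 'I_m)]))//.
  have ie : i \in enum 'I_m by rewrite mem_enum.
  rewrite (perm_trans (perm_map _ (perm_to_rem ie)))//= eqxx.
  rewrite (_ : map _ _ = [seq v j | j <- rem i (enum 'I_m)])//.
  apply/eq_in_map => j; rewrite mem_rem_uniq ?enum_uniq// inE => /andP[ji _] /=.
  by rewrite (negbTE ji).
rewrite !E dirder_linear; last exact: dirders_line_poly.
by rewrite mulrDr; congr (_ + _); rewrite /GRing.scale/=; ring.
Qed.

End Polarization.

(** * Taylor series of uniformly continuous holomorphic functions *)

Lemma tends_cvg (R : realType) (u : nat -> R[i]) l : tends u l -> u @ \oo --> l.
Proof.
move=> ul; apply/cvgrPdist_le => e e0.
have e0' : 0 < complex.Re e by rewrite -ltcR gt0_RRe.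
have [n0 H] := ul _ e0'; exists n0 => // n /= n0n.
by rewrite distrC -(gt0_RRe e0) rnorm_leC; exact: H.
Qed.

Lemma cvg_tends (R : realType) (u : nat -> R[i]) l : u @ \oo --> l -> tends u l.
Proof.
move=> /cvgrPdist_le ul e e0; have e0' : 0 < e%:C by rewrite ltcR.
have [n0 _ H] := ul _ e0'; exists n0 => n n0n.
by rewrite -rnorm_leC distrC; exact: H.
Qed.

Section TaylorAu.
Variables (R : realType) (X : normedModType R[i]) (f : Au X).
Local Notation C := R[i].
Implicit Types (x y v : X) (a t : C).

Let F : X -> C := 'valL_0 (Au_val f).

Lemma Au_line_cdiff x y t : rnorm (x + t *: y) < 1 -> cdiff (fun t => F (x + t *: y)) t.
Proof.
move=> xt; have xB : unit_ball X (x + t *: y) by rewrite /unit_ball/= rnorm_lt1.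
have fd : differentiable F (x + t *: y).
  case: f @F => g /= /set_mem[gd _]; exact: (gd (SigSub (mem_set xB))).
exists ('d F (x + t *: y) y) => e e0.
have y1 : 0 < 1 + rnorm y by have := rnorm_ge0 y; lra.
have e1 : 0 < (e / (1 + rnorm y))%:C by rewrite ltcR divr_gt0.
have /eqaddoP/(_ (e / (1 + rnorm y))%:C e1)/nbhs_ballP[d /= d0 Hd] := diff_locally fd.
have d0' : 0 < complex.Re d by rewrite -ltcR gt0_RRe.
exists (complex.Re d / (2 * (1 + rnorm y))); first by rewrite divr_gt0// mulr_gt0.
move=> w wd; have n0 := rnorm_ge0 (w - t); have y0 := rnorm_ge0 y.
have hb : ball 0 d ((w - t) *: y).
  rewrite -ball_normE /= sub0r normrN -(gt0_RRe d0) rnorm_ltC rnormZ.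
  have : rnorm (w - t) * (1 + rnorm y) <= complex.Re d / 2.
    by move: wd; rewrite invfM mulrA ler_pdivlMr.
  lra.
have := Hd _ hb.
have -> : (F \o shift (x + t *: y) - (cst (F (x + t *: y)) + 'd F (x + t *: y))) ((w - t) *: y) =
   F (x + w *: y) - F (x + t *: y) - 'd F (x + t *: y) y * (w - t).
  have -> : x + w *: y = (w - t) *: y + (x + t *: y).
    by rewrite scalerBl addrACA addNr addr0 addrC.
  have -> : (F \o shift (x + t *: y) - (cst (F (x + t *: y)) + 'd F (x + t *: y))) ((w - t) *: y)
    = F ((w - t) *: y + (x + t *: y)) - (F (x + t *: y) + 'd F (x + t *: y) ((w - t) *: y)) by [].
  rewrite linearZ /= opprD addrA; congr (_ - _); exact: mulrC.
rewrite !rnormE -rmorphM lecR rnormZ => h; apply: le_trans h _.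
rewrite mulrA mulrAC ler_wpM2r// mulrAC ler_pdivrMr// ler_wpM2l ?(ltW e0)//; lra.
Qed.

Lemma Au_bound_exists : exists2 M : R, 0 <= M & forall x, rnorm (F x) <= M.
Proof.
have [M HM] : exists M : R, forall b, modulus (Au_val f b) <= M.
  by apply: Au_bounded; case: f => g /= /set_mem[].
exists `|M| => // x; have [xB|xB] := pselect (unit_ball X x); last first.
  by rewrite /F valL_out// rnorm0.
have -> : F x = f (SigSub (mem_set xB)) by exact: (valL_val f (SigSub (mem_set xB))).
exact: le_trans (HM _) (ler_norm _).
Qed.

Let bd := cid2 Au_bound_exists.
Let M := sval bd.
Let M0 : 0 <= M. Proof. by rewrite /M; case: bd. Qed.
Let FM x : rnorm (F x) <= M. Proof. by rewrite /M; case: bd. Qed.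

Lemma line_expansion x y (Rr q : R) : 0 < Rr -> rnorm x < 1 ->
  rnorm x + Rr * rnorm y <= 1 -> 0 <= q < 1 ->
  exists c : nat -> C, forall n a, rnorm a <= q * Rr ->
    rnorm (F (x + a *: y) - \sum_(l < n) c l * a ^+ l) <=
      4 / (1 - q) * M * (rnorm a / ((1 + q) / 2 * Rr)) ^+ n.
Proof.
move=> R0 x1 xy q01; apply: taylor_disc => // w wR; apply: Au_line_cdiff.
apply: le_lt_trans (rnormD _ _) _; rewrite rnormZ.
have [->|y0] := eqVneq y 0; first by rewrite rnorm0 mulr0 addr0.
by apply: lt_le_trans xy; rewrite ltrD2l ltr_pM2r// rnorm_gt0.
Qed.

Lemma expansion_asymp (h : C -> C) (c : nat -> C) (Rr K : R) (q b : R) : 0 < q * Rr ->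
  (forall n a, rnorm a <= q * Rr ->
    rnorm (h a - \sum_(l < n) c l * a ^+ l) <= K * (rnorm a / b) ^+ n) -> asymp h c.
Proof.
move=> qR H n; exists (K * b^-1 ^+ n), (q * Rr) => // a aq.
by apply: le_trans (H n a aq) _; rewrite exprMn mulrA mulrAC.
Qed.

Lemma hom_exists x : exists c, asymp (fun t => F (t *: x)) c.
Proof.
have x0 : 0 < rnorm x + 1 by have := rnorm_ge0 x; lra.
have [||||c Hc] := @line_expansion 0 x (rnorm x + 1)^-1 2^-1.
- by rewrite invr_gt0.
- by rewrite rnorm0.
- by rewrite rnorm0 add0r mulrC ler_pdivrMr// mul1r; lra.
- lra.
exists c; apply: expansion_asymp (_ : 0 < 2^-1 * (rnorm x + 1)^-1) _; first by rewrite mulr_gt0 ?invr_gt0.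
by move=> n a /Hc; rewrite add0r.
Qed.

(** The homogeneous terms of the Taylor series of f at 0; that they are polynomials
    on X is P_line. *)
Let P (k : nat) (x : X) : C := sval (cid (hom_exists x)) k.

Let P_asymp x : asymp (fun t => F (t *: x)) (P ^~ x).
Proof. by rewrite /P; case: cid. Qed.

Let P_expansion x (Rr q : R) : 0 < Rr -> Rr * rnorm x <= 1 -> 0 < q < 1 ->
  forall n a, rnorm a <= q * Rr ->
    rnorm (F (a *: x) - \sum_(l < n) P l x * a ^+ l) <=
      4 / (1 - q) * M * (rnorm a / ((1 + q) / 2 * Rr)) ^+ n.
Proof.
move=> R0 Rx /andP[q0 q1].
have [|||c Hc] := @line_expansion 0 x Rr q R0; rewrite ?rnorm0 ?add0r//.
  by rewrite (ltW q0).
have cP : c =1 P ^~ x.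
  apply: asymp_unique (P_asymp x).
  apply: expansion_asymp (_ : 0 < q * Rr) _; first exact: mulr_gt0.
  by move=> n a /Hc; rewrite add0r.
move=> n a aq; have := Hc n a aq; rewrite add0r.
by under eq_bigr do rewrite cP.
Qed.

Let PZ k a x : P k (a *: x) = a ^+ k * P k x.
Proof.
suff H : asymp (fun t => F (t *: (a *: x))) (fun k => a ^+ k * P k x).
  by rewrite (asymp_unique (P_asymp (a *: x)) H).
move=> n; have [K [d d0 H]] := P_asymp x n.
have a1 : 0 < 1 + rnorm a by have := rnorm_ge0 a; lra.
exists (K * rnorm a ^+ n), (d / (1 + rnorm a)); first by rewrite divr_gt0.
move=> t td; have ta : rnorm (t * a) <= d.
  rewrite rnormM; move: td; rewrite ler_pdivlMr//.
  by have := rnorm_ge0 t; lra.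
have := H (t * a) ta; rewrite scalerA rnormM [(rnorm t * _) ^+ n]exprMn.
rewrite [_ ^+ n * _ ^+ n]mulrC mulrA.
rewrite (eq_bigr (fun l : 'I_n => a ^+ l * P l x * t ^+ l))// => l _.
by rewrite exprMn; ring.
Qed.

Let P_bound k : exists2 Ck, 0 <= Ck & forall x, rnorm (P k x) <= Ck * rnorm x ^+ k.
Proof.
pose Ck := 2 ^+ k * (16 * M).
have C0 : 0 <= Ck by rewrite !mulr_ge0 ?exprn_ge0.
exists Ck => // x.
have B1 y : rnorm y <= 1 -> rnorm (P k y) <= Ck.
  move=> y1; have q01 : 0 < (2^-1 : R) < 1 by lra.
  have R1 : 1 * rnorm y <= 1 by rewrite mul1r.
  pose a : C := (2^-1 : R)%:C.
  have ra : rnorm a = 2^-1 by rewrite rnorm_pos.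
  have aq : rnorm a <= 2^-1 * 1 by rewrite ra mulr1.
  have h1 := P_expansion ltr01 R1 q01 k aq.
  have h2 := P_expansion ltr01 R1 q01 k.+1 aq.
  rewrite ra in h1; rewrite big_ord_recr /= ra in h2.
  set S := \sum_(l < k) _ in h1 h2.
  pose b : R := 2^-1 / ((1 + 2^-1) / 2 * 1).
  have b0 : 0 <= b by rewrite /b divr_ge0//; lra.
  have b1 : b <= 1 by rewrite /b ler_pdivrMr; lra.
  have hh j : 4 / (1 - 2^-1) * M * b ^+ j <= 8 * M.
    have -> : 4 / (1 - 2^-1) * M = 8 * M by field.
    by rewrite ler_piMr ?exprn_ile1// mulr_ge0.
  have := hh k; have := hh k.+1; rewrite /b => h3 h4.
  have : rnorm (P k y * a ^+ k) <= 16 * M.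
    have -> : P k y * a ^+ k = (F (a *: y) - S) - (F (a *: y) - (S + P k y * a ^+ k)) by ring.
    have := rnormB (F (a *: y) - S) (F (a *: y) - (S + P k y * a ^+ k)); lra.
  rewrite rnormM rnormX ra exprVn ler_pdivrMr ?exprn_gt0// => h.
  by rewrite /Ck mulrC.
have [->|x0] := eqVneq x 0.
  rewrite rnorm0; case: k @Ck C0 B1 => [|k] Ck C0 B1.
    by rewrite expr0 mulr1; apply: B1; rewrite rnorm0.
  by rewrite -(scale0r (0 : X)) PZ exprS !mul0r rnorm0 exprS mul0r mulr0.
have rx : 0 < rnorm x by rewrite rnorm_gt0.
have -> : x = (rnorm x)%:C *: ((rnorm x)^-1%:C *: x).
  by rewrite scalerA -rmorphM divff ?gt_eqF// rmorph1 scale1r.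
set u := _^-1%:C *: x; rewrite PZ rnormM rnormX rnormZ.
have ru : rnorm u = 1 by rewrite rnormZ rnorm_pos ?invr_ge0 ?(ltW rx)// mulVf ?gt_eqF.
rewrite ru mulr1 mulrC rnorm_pos ?(ltW rx)// ler_wpM2r ?exprn_ge0 ?(ltW rx)//.
by apply: B1; rewrite ru.
Qed.

(** P k is recovered from f near 0 by averaging over a fixed set of roots of
    unity on a circle of radius r; as r tends to 0 the line x + t y may be
    followed over larger and larger discs, in which f is a polynomial of degree
    at most k up to an error of smaller order than r^k. *)
Let P_line k : line_poly k.+1 (P k).
Proof.
move=> x y; apply: poly_approx_closed => rho e e0.
pose rho' := `|rho|; pose V := 1 + rnorm x + rho' * rnorm y; pose Y := 1 + rnorm y.
have x0 := rnorm_ge0 x; have y0 := rnorm_ge0 y; have r'0 : 0 <= rho' by exact: normr_ge0.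
have ry0 : 0 <= rho' * rnorm y by exact: mulr_ge0.
have V0 : 0 < V by rewrite /V; lra.
have Y0 : 0 < Y by rewrite /Y; lra.
pose N := (2 ^ k.+1)%N.
have kN : (k < N)%N by apply: leq_trans (ltn_expl k (isT : 1 < 2)%N) _; rewrite leq_exp2l.
pose C1 := 8 * M * (4 * V / 3) ^+ N; pose C2 := 8 * M * (8 * rho' * Y / 3) ^+ k.+1.
have C10 : 0 <= C1 by rewrite mulr_ge0 ?mulr_ge0// exprn_ge0// divr_ge0// mulr_ge0// ltW.
have C20 : 0 <= C2 by rewrite mulr_ge0 ?mulr_ge0// exprn_ge0// divr_ge0// !mulr_ge0// ltW.
have c1 : 0 < C1 + C2 + 1 by lra.
have c2 : 0 < 4 * rho' * Y + 1 by have := mulr_ge0 (mulr_ge0 (ler0n R 4) r'0) (ltW Y0); lra.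
(* By rV and rY the expansions below take place inside the ball; by rE their
   errors, of order r^(k+1), are at most e r^k. *)
pose r := Num.min (Num.min 1 (2 * V)^-1) (Num.min (4 * rho' * Y + 1)^-1 (e / (C1 + C2 + 1))).
have r0 : 0 < r by rewrite !lt_min ltr01 !invr_gt0 mulr_gt0//= c2 divr_gt0.
have r1 : r <= 1 by rewrite !ge_min lexx.
have rV : r * (2 * V) <= 1 by rewrite -ler_pdivlMr ?mulr_gt0// div1r !ge_min lexx orbT.
have rY : r * (4 * rho' * Y + 1) <= 1 by rewrite -ler_pdivlMr// div1r !ge_min lexx !orbT.
have rE : r * (C1 + C2 + 1) <= e by rewrite -ler_pdivlMr// !ge_min lexx !orbT.
have q01 : 0 < (2^-1 : R) < 1 by lra.
have q01' : 0 <= (2^-1 : R) < 1 by lra.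
have rk0 : 0 < r ^+ k by exact: exprn_gt0.
have E1 v : rnorm v <= V ->
    rnorm (avgc k k (fun w => F ((r%:C * w) *: v)) - P k v * r%:C ^+ k) <= C1 * r ^+ k.+1.
  move=> vV.
  pose p := \poly_(l < N) (P l v * r%:C ^+ l).
  have -> : P k v * r%:C ^+ k = avgc k k (fun w => p.[w]).
    by rewrite avgc_poly ?size_poly// coef_poly kN.
  rewrite -avgcB; apply: avgc_bound => w w1.
  have Vv : V^-1 * rnorm v <= 1 by rewrite mulrC ler_pdivrMr// mul1r.
  have nw : rnorm (r%:C * w) = r by rewrite rnormM w1 mulr1 rnorm_pos// ltW.
  have aq : rnorm (r%:C * w) <= 2^-1 * V^-1.
    by rewrite nw -invfM -[leRHS]div1r ler_pdivlMr// mulr_gt0.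
  have Vi0 : 0 < V^-1 by rewrite invr_gt0.
  have := P_expansion Vi0 Vv q01 N aq; rewrite nw.
  rewrite (_ : \sum_(l < N) P l v * (r%:C * w) ^+ l = p.[w]); last first.
    by rewrite horner_poly; apply: eq_bigr => l _; rewrite exprMn mulrA.
  move=> h; apply: le_trans h _.
  have -> : 4 / (1 - 2^-1) * M * (r / ((1 + 2^-1) / 2 / V)) ^+ N = C1 * r ^+ N.
    rewrite /C1 -[RHS]mulrA -exprMn; congr (_ * _); first by field.
    by congr (_ ^+ _); field; rewrite gt_eqF.
  rewrite ler_wpM2l// -(subnK kN) exprD ler_piMl ?exprn_ge0 ?exprn_ile1// ltW//.
pose R' := (2 * r * Y)^-1.
have R'0 : 0 < R' by rewrite invr_gt0 !mulr_gt0.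
have ex w : exists c : nat -> C, rnorm w = 1 -> forall n t, rnorm t <= 2^-1 * R' ->
    rnorm (F ((r%:C * w) *: (x + t *: y)) - \sum_(l < n) c l * t ^+ l) <=
      4 / (1 - 2^-1) * M * (rnorm t / ((1 + 2^-1) / 2 * R')) ^+ n.
  have [w1|w1] := eqVneq (rnorm w) 1; last by exists (fun=> 0) => w1'; rewrite w1' eqxx in w1.
  have nw : rnorm (r%:C * w) = r by rewrite rnormM w1 mulr1 rnorm_pos// ltW.
  have h2 : r * rnorm x <= r * V by rewrite ler_pM2l// /V; lra.
  have [||c Hc] := @line_expansion ((r%:C * w) *: x) ((r%:C * w) *: y) R' 2^-1 R'0 _ _ q01'.
  - by rewrite (rnormZ _ x) nw; lra.
  - rewrite (rnormZ _ x) (rnormZ _ y) nw.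
    have h1 : R' * (r * rnorm y) <= 2^-1.
      rewrite /R' mulrC ler_pdivrMr ?mulr_gt0// /Y.
      have : 0 <= r * (1 + rnorm y) - r * rnorm y by rewrite -mulrBr addrK mulr1 ltW.
      lra.
    lra.
  exists c => _ n t tR.
  have -> : (r%:C * w) *: (x + t *: y) = (r%:C * w) *: x + t *: ((r%:C * w) *: y).
    by rewrite scalerDr !scalerA [t * _]mulrC.
  exact: Hc.
have [c Hc] := choice ex.
exists (\poly_(l < k.+1) (r%:C ^- k * avgc k k (fun w => c w l))); split; first exact: size_poly.
move=> t trho; have tr : rnorm t <= rho' by apply: le_trans trho (ler_norm _).
have vV : rnorm (x + t *: y) <= V.
  apply: le_trans (rnormD _ _) _; rewrite rnormZ /V.
  by have := ler_wpM2r y0 tr; lra.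
have {}E1 := E1 _ vV.
have tR : rnorm t <= 2^-1 * R'.
  apply: le_trans tr _; rewrite /R' -invfM -[leRHS]div1r ler_pdivlMr ?mulr_gt0//; lra.
have E2 : rnorm (avgc k k (fun w => F ((r%:C * w) *: (x + t *: y))) -
    \sum_(l < k.+1) avgc k k (fun w => c w l) * t ^+ l) <= C2 * r ^+ k.+1.
  have -> : \sum_(l < k.+1) avgc k k (fun w => c w l) * t ^+ l =
      avgc k k (fun w => \sum_(l < k.+1) c w l * t ^+ l).
    rewrite avgc_sum; apply: eq_bigr => l _.
    by rewrite mulrC -avgcZ; congr (avgc _ _ _); apply/funext => w; rewrite mulrC.
  rewrite -avgcB; apply: avgc_bound => w w1.
  apply: le_trans (Hc w w1 k.+1 t tR) _.
  have -> : rnorm t / ((1 + 2^-1) / 2 * R') = 8 * rnorm t * Y / 3 * r.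
    by rewrite /R'; field; rewrite !gt_eqF.
  rewrite exprMn mulrA ler_wpM2r ?exprn_ge0 ?(ltW r0)// /C2.
  have -> : 4 / (1 - 2^-1) * M = 8 * M by field.
  rewrite ler_wpM2l ?mulr_ge0// lerXn2r// ?nnegrE ?divr_ge0 ?mulr_ge0 ?rnorm_ge0 ?(ltW Y0)//.
  by rewrite ler_pM2r ?invr_gt0// ler_pM2r// ler_pM2l.
rewrite horner_poly.
have -> : \sum_(l < k.+1) r%:C ^- k * avgc k k (fun w => c w l) * t ^+ l =
   r%:C ^- k * \sum_(l < k.+1) avgc k k (fun w => c w l) * t ^+ l.
  by rewrite mulr_sumr; apply: eq_bigr => l _; rewrite [RHS]mulrA.
move: E1 E2; set A := avgc k k _; set S := \sum_(l < k.+1) _ => E1 E2.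
have rC0 : r%:C ^+ k != 0 :> C by rewrite -rmorphXn; apply/eqP => /complexI/eqP; rewrite gt_eqF.
have -> : P k (x + t *: y) - r%:C ^- k * S =
   r%:C ^- k * ((A - S) - (A - P k (x + t *: y) * r%:C ^+ k)).
  by rewrite opprB addrCA addrA [_ * _ + _]addrC; field.
rewrite rnormM rnormV rnormX rnorm_pos ?(ltW r0)// mulrC ler_pdivrMr//.
apply: le_trans (rnormB _ _) _.
have : r * (C1 + C2 + 1) * r ^+ k <= e * r ^+ k by rewrite ler_pM2r.
rewrite exprS in E1 E2; have := mulr_ge0 (ltW r0) (ltW rk0).
lra.
Qed.

Let A (m : nat) : ('I_m -> X) -> C := polar (P m).

Let A_diag m x : diag (@A m) x = P m x.
Proof. by apply: polar_diag => a y; exact: PZ. Qed.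

Lemma taylor_exists : is_taylor f A.
Proof.
split=> [m|x].
  have Aml : multilinear (@A m) by exact/polar_multilinear/P_line.
  have As : Defs.symmetric_form (@A m) by exact: polar_sym.
  split=> //; have [Cm C0 PC] := P_bound m; have [K K0 HK] := polar_bnd X m.
  apply: (@diag_continuous _ _ m (@A m) (K * Cm)); rewrite ?mulr_ge0//.
    exact: multilinear_mlin.
  by apply: HK => //; [exact: multilinear_mlin|move=> x; rewrite A_diag].
apply: tends_cvg; pose Rr : R := 2 / (1 + rnorm (val x)).
have x1 : rnorm (val x) < 1 by rewrite -rnorm_lt1; exact: unit_ballP.
have x0 := rnorm_ge0 (val x).
have d0 : 0 < 1 + rnorm (val x) by lra.
have R1 : 1 < Rr by rewrite ltr_pdivlMr//; lra.
have Rx : Rr * rnorm (val x) <= 1 by rewrite /Rr mulrAC ler_pdivrMr//; lra.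
have q01 : 0 < Rr^-1 < 1 by rewrite invr_gt0 invf_lt1; lra.
have b1 : 0 <= ((1 + Rr^-1) / 2 * Rr)^-1 < 1.
  have -> : (1 + Rr^-1) / 2 * Rr = (1 + Rr) / 2 by field; rewrite gt_eqF//; lra.
  by rewrite invr_ge0 invf_lt1; lra.
move=> e e0.
have [n0 H] := @geometric_small _ (4 / (1 - Rr^-1) * M) _ e b1 e0.
exists n0 => n n0n.
have Rr0 : 0 < Rr by lra.
have a1 : rnorm (1 : C) <= Rr^-1 * Rr by rewrite rnorm1 mulVf// gt_eqF.
have := P_expansion Rr0 Rx q01 n a1; rewrite scale1r rnorm1 div1r => h.
have -> : f x = F (val x) by rewrite /F valL_val.
have -> : series (fun m => @A m (fun=> val x)) n = \sum_(l < n) P l (val x) * 1 ^+ l.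
  by rewrite seriesEord; apply: eq_bigr => l _; rewrite expr1n mulr1 -A_diag.
rewrite rnormBC; exact: le_trans h (H n n0n).
Qed.

End TaylorAu.

(** * The canonical extension to the open ball *)

Section GeometricSeries.
Variable R : realType.
Local Notation C := R[i].
Implicit Types (u : nat -> C).

Lemma geometric_partial u (B q : R) n k : 0 <= q < 1 ->
  (forall l, rnorm (u l) <= B * q ^+ l) -> 0 <= B ->
  rnorm (\sum_(l < n + k) u l - \sum_(l < n) u l) <= B * q ^+ n / (1 - q).
Proof.
move=> /andP[q0 q1] uB B0; have q1' : 0 < 1 - q by lra.
suff H : rnorm (\sum_(l < n + k) u l - \sum_(l < n) u l) <= B * q ^+ n * (1 - q ^+ k) / (1 - q).
  apply: le_trans H _; rewrite ler_pM2r ?invr_gt0// ler_piMr//.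
    by rewrite mulr_ge0// exprn_ge0.
  by have := exprn_ge0 k q0; lra.
elim: k => [|k IH].
  by rewrite addn0 subrr rnorm0 expr0 subrr mulr0 mul0r.
rewrite addnS big_ord_recr /= addrAC; apply: le_trans (rnormD _ _) _.
apply: le_trans (lerD IH (uB _)) _; rewrite exprD exprS.
rewrite le_eqVlt; apply/orP; left; apply/eqP; field; rewrite gt_eqF//.
Qed.

Lemma geometric_tends u (B q : R) : 0 <= q < 1 -> 0 <= B ->
  (forall l, rnorm (u l) <= B * q ^+ l) -> exists S, tends (fun n => \sum_(l < n) u l) S.
Proof.
move=> q01 B0 uB; have q1' : 0 < 1 - q by case/andP: q01 => q0 q1; lra.
apply: cauchy_tends => e e0.
have [n0 H] := @geometric_small _ (B / (1 - q)) q (e / 2) q01 (divr_gt0 e0 (ltr0n _ 2)).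
have D n : (n0 <= n)%N -> rnorm (\sum_(l < n) u l - \sum_(l < n0) u l) <= e / 2.
  move=> n0n; rewrite -(subnKC n0n); apply: le_trans (geometric_partial _ _ q01 uB B0) _.
  by rewrite mulrAC; exact: H.
exists n0 => m n /D h1 /D h2.
have := rnorm_tri (\sum_(l < m) u l) (\sum_(l < n0) u l) (\sum_(l < n) u l).
rewrite (rnormBC (\sum_(l < n0) u l)); lra.
Qed.

Lemma geometric_tail u (B q : R) S n : 0 <= q < 1 -> 0 <= B ->
  (forall l, rnorm (u l) <= B * q ^+ l) -> tends (fun n => \sum_(l < n) u l) S ->
  rnorm (S - \sum_(l < n) u l) <= B * q ^+ n / (1 - q).
Proof.
move=> q01 B0 uB uS; apply: (@tends_le _ (fun k => \sum_(l < n + k) u l - \sum_(l < n) u l)).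
  move=> e /uS[n0 H]; exists n0 => k kn0.
  rewrite [X in rnorm X <= _](_ : _ = \sum_(l < n + k) u l - S); last by ring.
  by apply: H; apply: leq_trans kn0 (leq_addl _ _).
by move=> k; exact: geometric_partial.
Qed.

Lemma tends_terms_bounded u S : tends (fun n => \sum_(l < n) u l) S ->
  exists2 B : R, 0 <= B & forall l, rnorm (u l) <= B.
Proof.
move=> uS; have [n0 H] := uS 1 ltr01.
exists (2 + \sum_(l < n0) rnorm (u l)).
  by rewrite addr_ge0// sumr_ge0// => l _; exact: rnorm_ge0.
move=> l; have [ln|nl] := ltnP l n0.
  rewrite (bigD1 (Ordinal ln))//=.
  have : 0 <= \sum_(i < n0 | i != Ordinal ln) rnorm (u i).
    by apply: sumr_ge0 => i _; exact: rnorm_ge0.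
  lra.
have := H l nl; have := H l.+1 (leqW nl); rewrite big_ord_recr /= => h1 h2.
have : 0 <= \sum_(l < n0) rnorm (u l) by apply: sumr_ge0 => i _; exact: rnorm_ge0.
have := rnormB (\sum_(i < l) u i + u l - S) (\sum_(i < l) u i - S).
rewrite [X in rnorm X <= _](_ : _ = u l); last by ring.
lra.
Qed.

End GeometricSeries.

Section Extension.
Variables (R : realType) (X : normedModType R[i]).
Local Notation C := R[i].
Implicit Types (f : Au X) (z : bidual X).

(** Extension by 0 outside the ball, which makes f a function on X. *)
Definition ext0 f : X -> C := 'valL_0 (Au_val f).

Lemma ext0E f (b : set_type (unit_ball X)) : ext0 f (val b) = f b.
Proof. exact: valL_val. Qed.

Lemma ext0P f x (P : C -> Prop) : rnorm x < 1 -> (forall b, P (f b)) -> P (ext0 f x).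
Proof.
move=> x1 H; have xB : unit_ball X x by rewrite /unit_ball/= rnorm_lt1.
by rewrite (_ : ext0 f x = f (SigSub (mem_set xB)))//; exact: (ext0E f (SigSub (mem_set xB))).
Qed.

Lemma taylor_formP f : is_taylor f (@taylor_form R X f).
Proof. apply: getPex; exact: ex_intro _ _ (taylor_exists f). Qed.

Local Notation tf := (@taylor_form R X).

Lemma taylor_mlin f m : mlin (@tf f m).
Proof. by apply: multilinear_mlin; have [/(_ m)[]] := taylor_formP f. Qed.

Lemma taylor_sym f m : Defs.symmetric_form (@tf f m).
Proof. by have [/(_ m)[]] := taylor_formP f. Qed.

Lemma taylor_tends f x : rnorm x < 1 -> tends (fun n => \sum_(l < n) diag (@tf f l) x) (ext0 f x).
Proof.
move=> x1; have xB : unit_ball X x by rewrite /unit_ball/= rnorm_lt1.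
have [_ /(_ (SigSub (mem_set xB)))/cvg_tends] := taylor_formP f.
rewrite -ext0E /= => H e /H[n0 {}H]; exists n0 => n /H.
by rewrite seriesEord.
Qed.

(** Cauchy's inequality for the homogeneous terms: averaging f (s w y) over roots
    of unity w isolates the term of degree m of a Taylor polynomial of f of high
    degree; then s tends to 1. *)
Lemma taylor_cauchy f (M : R) m x : (forall x, rnorm x < 1 -> rnorm (ext0 f x) <= M) ->
  rnorm (diag (@tf f m) x) <= M * rnorm x ^+ m.
Proof.
move=> fM; have M0 : 0 <= M by apply: le_trans (rnorm_ge0 (ext0 f 0)) (fM _ _); rewrite rnorm0.
have key y s : rnorm y <= 1 -> 0 < s < 1 -> rnorm (diag (@tf f m) y) * s ^+ m <= M.
  move=> y1 /andP[s0 s1]; pose s' := (1 + s) / 2.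
  have s'0 : 0 < s' by rewrite /s'; lra.
  have s'1 : s' < 1 by rewrite /s'; lra.
  have ss' : 0 <= s / s' < 1 by rewrite divr_ge0 ?(ltW s0) ?(ltW s'0)//= ltr_pdivrMr// mul1r /s'; lra.
  have sy (t : C) : rnorm t < 1 -> rnorm (t *: y) < 1.
    by move=> t1; rewrite rnormZ; apply: le_lt_trans t1; rewrite ler_piMr ?rnorm_ge0.
  have s'n : rnorm (s'%:C : C) = s' by rewrite rnorm_pos// ltW.
  have sn : rnorm (s%:C : C) = s by rewrite rnorm_pos// ltW.
  have [B B0 HB] : exists2 B, 0 <= B & forall l, rnorm (diag (@tf f l) y) * s' ^+ l <= B.
    have s'y : rnorm (s'%:C *: y) < 1 by apply: sy; rewrite s'n.
    have [B B0 HB] := @tends_terms_bounded _ (fun l => diag (@tf f l) (s'%:C *: y)) _ (taylor_tends f s'y).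
    exists B => // l; have := HB l.
    by rewrite diagZ ?rnormM ?rnormX ?s'n 1?mulrC//; exact: taylor_mlin.
  apply/ler_addgt0Pr => e e0.
  have q0 : 0 < 1 - s / s' by case/andP: ss' => _; lra.
  have [n0 H] := @geometric_small _ (B / (1 - s / s')) (s / s') e ss' e0.
  pose n := maxn n0 m.
  have mN : (m < 2 ^ n.+1)%N.
    apply: leq_ltn_trans (leq_maxr n0 m) _; apply: leq_trans (ltn_expl n (isT : 1 < 2)%N) _.
    by rewrite leq_exp2l.
  have nN : (n0 <= 2 ^ n.+1)%N.
    apply: leq_trans (leq_maxl n0 m) _; exact: leq_pow2.
  pose p := \poly_(l < 2 ^ n.+1) (diag (@tf f l) y * s%:C ^+ l).
  have pm : diag (@tf f m) y * s%:C ^+ m = avgc n m (fun w => p.[w]).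
    by rewrite avgc_poly ?size_poly// coef_poly mN.
  have hs : rnorm (diag (@tf f m) y) * s ^+ m = rnorm (avgc n m (fun w => p.[w])).
    by rewrite -pm rnormM rnormX sn.
  rewrite hs; have A1 : rnorm (avgc n m (fun w => ext0 f ((s%:C * w) *: y))) <= M.
    by apply: avgc_bound => w w1; apply/fM/sy; rewrite rnormM w1 mulr1 sn.
  have A2 : rnorm (avgc n m (fun w => ext0 f ((s%:C * w) *: y)) - avgc n m (fun w => p.[w])) <= e.
    rewrite -avgcB; apply: avgc_bound => w w1.
    have swn : rnorm (s%:C * w) = s by rewrite rnormM w1 mulr1 sn.
    have dE l : diag (@tf f l) ((s%:C * w) *: y) = diag (@tf f l) y * s%:C ^+ l * w ^+ l.
      by rewrite diagZ; [rewrite exprMn; ring|exact: taylor_mlin].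
    have -> : p.[w] = \sum_(l < 2 ^ n.+1) diag (@tf f l) ((s%:C * w) *: y).
      by rewrite horner_poly; apply: eq_bigr => l _; rewrite dE.
    have swy : rnorm ((s%:C * w) *: y) < 1 by apply: sy; rewrite swn.
    apply: le_trans (@geometric_tail _ (fun l => diag (@tf f l) ((s%:C * w) *: y)) B (s / s') _ _ ss' B0 _ (taylor_tends f swy)) _.
    - move=> l; rewrite dE !rnormM !rnormX w1 expr1n mulr1 sn.
      rewrite expr_div_n mulrA ler_pdivlMr ?exprn_gt0// mulrAC.
      by rewrite ler_wpM2r ?exprn_ge0// ltW.
    - by rewrite mulrAC; exact: H.
  have := rnorm_subl (avgc n m (fun w => p.[w])) (avgc n m (fun w => ext0 f ((s%:C * w) *: y))).
  rewrite rnormBC; lra.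
have key1 y : rnorm y <= 1 -> rnorm (diag (@tf f m) y) <= M.
  move=> y1; apply/ler_addgt0Pr => e e0; have d0 := rnorm_ge0 (diag (@tf f m) y).
  pose d := rnorm (diag (@tf f m) y).
  have [d00|dn0] := eqVneq d 0; first by rewrite -/d d00; lra.
  have dp : 0 < d by rewrite lt_neqAle eq_sym dn0.
  pose t := Num.min 2^-1 (e / ((m%:R + 1) * d)).
  have md : 0 < (m%:R + 1) * d by rewrite mulr_gt0// ltr_wpDl.
  have t0 : 0 < t by rewrite lt_min invr_gt0 ltr0n/= divr_gt0.
  have t1 : t <= 2^-1 by rewrite ge_min lexx.
  have te : t * ((m%:R + 1) * d) <= e by rewrite -ler_pdivlMr// ge_min lexx orbT.
  have s01 : 0 < 1 - t < 1 by apply/andP; split; lra.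
  have t1' : -1 <= - t by lra.
  have h1 := key y (1 - t) y1 s01; have h2 := ler_wpM2l (ltW dp) (bernoulli m t1').
  rewrite -/d in h1 *.
  have : 0 <= t * d by rewrite mulr_ge0// ltW.
  lra.
have [->|x0] := eqVneq x 0.
  have [m00|m0] := posnP m.
    have -> : rnorm (0 : X) ^+ m = 1 by rewrite m00 expr0.
    by rewrite mulr1; apply: key1; rewrite rnorm0.
  rewrite -[X in diag _ X](scale0r (0 : X)) diagZ; last exact: taylor_mlin.
  by rewrite expr0n (gtn_eqF m0) mul0r !rnorm0 expr0n (gtn_eqF m0) mulr0.
have rx : 0 < rnorm x by rewrite rnorm_gt0.
rewrite [in diag _ x](_ : x = (rnorm x)%:C *: ((rnorm x)^-1%:C *: x)); last first.
  by rewrite scalerA -rmorphM divff ?gt_eqF// rmorph1 scale1r.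
set u := _^-1%:C *: x; rewrite diagZ; last exact: taylor_mlin.
have ru : rnorm u = 1 by rewrite rnormZ rnorm_pos ?invr_ge0 ?(ltW rx)// mulVf ?gt_eqF.
rewrite rnormM rnormX rnorm_pos ?(ltW rx)// mulrC ler_wpM2r ?exprn_ge0 ?(ltW rx)//.
by apply: key1; rewrite ru.
Qed.

Lemma ext0_bound f : exists2 M : R, 0 <= M & forall x, rnorm x < 1 -> rnorm (ext0 f x) <= M.
Proof. by have [M M0 HM] := Au_bound_exists f; exists M => // x _; exact: HM. Qed.

Lemma taylor_good f m : exists K, good (@tf f m) K.
Proof.
have [M M0 HM] := ext0_bound f; have [K K0 HK] := polar_bnd X m.
exists (K * M); split; [exact: taylor_mlin| |exact: mulr_ge0].
apply: HK => //; [exact: taylor_mlin|exact: taylor_sym|by move=> x; exact: taylor_cauchy].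
Qed.

(** The extension obeys the same inequality, its value at z being approximated by
    values at points of norm at most s. *)
Lemma abz_cauchy f (M : R) m z s : (forall x, rnorm x < 1 -> rnorm (ext0 f x) <= M) ->
  rnorm z <= s -> 0 < s -> s <= 1 -> rnorm (abz (@tf f m) z) <= M * s ^+ m.
Proof.
move=> fM zs s0 s1; have M0 : 0 <= M by apply: le_trans (rnorm_ge0 (ext0 f 0)) (fM _ _); rewrite rnorm0.
apply/ler_addgt0Pr => e e0.
pose A : {m : nat & ('I_m -> X) -> C} := existT _ m (@tf f m).
have [|x [xs Hx]] := @davie_gamelin R X z s e [:: A] zs s0 s1 e0.
  by move=> _ [<-|//]; split; [exact: taylor_sym|exact: taylor_good].
have h1 := Hx A (or_introl erefl); rewrite /= in h1.
have h2 := @taylor_cauchy f M m x fM.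
have : M * rnorm x ^+ m <= M * s ^+ m.
  by rewrite ler_wpM2l// lerXn2r// ?nnegrE ?rnorm_ge0// ltW.
have := rnorm_subl (abz (@tf f m) z) (diag (@tf f m) x); rewrite rnormBC; lra.
Qed.

Lemma aron_berner_ball_tends f z : rnorm z < 1 ->
  tends (fun n => \sum_(l < n) abz (@tf f l) z) (aron_berner_ball f z).
Proof.
move=> z1; have [M M0 HM] := ext0_bound f.
pose s := (1 + rnorm z) / 2; have z0 := rnorm_ge0 z.
have [S HS] : exists S, tends (fun n => \sum_(l < n) abz (@tf f l) z) S.
  apply: (@geometric_tends _ (fun l => abz (@tf f l) z) M s) => //; first by rewrite /s; apply/andP; split; lra.
  by move=> l; apply: abz_cauchy => //; rewrite /s; lra.
rewrite /aron_berner_ball; suff -> : limn (series (fun m => iterated_lim (@tf f m) (fun=> z))) = S by [].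
apply: cvg_lim; first exact: norm_hausdorff.
apply: tends_cvg => e /HS[n0 H]; exists n0 => n /H.
by rewrite seriesEord.
Qed.

Lemma abzZ f m z (r : C) : abz (@tf f m) (r *: z) = r ^+ m * abz (@tf f m) z.
Proof. by have [K Ag] := taylor_good f m; exact: (diagZ r z (iterated_lim_mlin Ag)). Qed.

End Extension.

(** * Boundary values *)

Section Approximation.
Variables (R : realType) (X : normedModType R[i]).
Local Notation C := R[i].
Local Notation form := {m : nat & ('I_m -> X) -> C}.
Local Notation tf := (@taylor_form R X).
Local Notation ab := (@aron_berner_ball R X).
Implicit Types (f : Au X) (z : bidual X).

(** Functionals as forms of degree 1, to be approximated along with the others. *)
Definition dual_form (g : dual X) : ('I_1 -> X) -> C := fun v => g (v ord0).

Lemma dual_form_good g : good (dual_form g) (rnorm g).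
Proof.
split; last exact: rnorm_ge0.
  by split=> // v a x y; rewrite /pform /dual_form !fcons0 dual_lin.
by move=> v; rewrite big_ord1; exact: dual_bound.
Qed.

Lemma dual_form_sym g : Defs.symmetric_form (dual_form g).
Proof. by move=> s v; rewrite /dual_form /= ord1. Qed.

Lemma abz_dual_form g z : abz (dual_form g) z = z g.
Proof.
have [G [HG ->]] := abz_dual z (dual_form_good g); congr (z _).
by apply: dual_ext => x; rewrite HG /abz /= /pform /dual_form fcons0.
Qed.

Lemma In_map (I : eqType) (h : I -> form) (s : seq I) i : i \in s -> List.In (h i) (map h s).
Proof.
elim: s => [//|j s IH]; rewrite in_cons => /orP[/eqP->|/IH]; first by left.
by right.
Qed.

Lemma In_mapP (I : eqType) (h : I -> form) (s : seq I) A :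
  List.In A (map h s) -> exists2 i, i \in s & A = h i.
Proof.
elim: s => [//|j s IH] /= [<-|/IH[i si ->]]; first by exists j; rewrite ?mem_head.
by exists i; rewrite // in_cons si orbT.
Qed.

Lemma common_bound (fs : seq (Au X)) : exists2 M : R, 0 <= M &
  forall f, f \in fs -> forall x, rnorm x < 1 -> rnorm (ext0 f x) <= M.
Proof.
elim: fs => [|f fs [M M0 IH]]; first by exists 0.
have [M' M'0 H] := ext0_bound f; exists (M + M'); first exact: addr_ge0.
move=> h; rewrite in_cons => /orP[/eqP->|hfs] x x1.
  by have := H x x1; lra.
by have := IH h hfs x x1; lra.
Qed.

(** The Taylor polynomials of the members of fs are approximated by the theorem of
    Davie and Gamelin, the remainders by Cauchy's inequality.  Both are compatible
    with multiplication of x and z by a common r. *)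
Lemma approx_ball (fs : seq (Au X)) (gs : seq (dual X)) z (e : R) :
  rnorm z < 1 -> 0 < e -> exists x : X, [/\ rnorm x < 1,
    (forall f, f \in fs -> forall r : R, 0 <= r <= 1 ->
       rnorm (ext0 f (r%:C *: x) - ab f (r%:C *: z)) <= e) &
    forall g, g \in gs -> rnorm (g x - z g) <= e].
Proof.
move=> z1 e0; have [M M0 HM] := common_bound fs.
have z0 := rnorm_ge0 z; pose s := (1 + rnorm z) / 2.
have s0 : 0 < s by rewrite /s; lra.
have s1 : s < 1 by rewrite /s; lra.
have zs : rnorm z <= s by rewrite /s; lra.
have s01 : 0 <= s < 1 by rewrite (ltW s0).
have [n0 /(_ n0 (leqnn _)) Hn] := @geometric_small _ (M / (1 - s)) s (e / 3) s01 (divr_gt0 e0 (ltr0n _ 3)).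
pose e' := e / (3 * n0.+1%:R).
have n3 : 0 < 3 * n0.+1%:R :> R by rewrite mulr_gt0.
have e'0 : 0 < e' by rewrite divr_gt0.
have e'n : n0%:R * e' <= e / 3.
  rewrite /e' mulrCA ler_pM2l// ler_pdivrMr// mulrA mulVf// mul1r ler_nat//.
pose h1 (p : Au X * nat) : form := existT _ p.2 (@tf p.1 p.2).
pose h2 (g : dual X) : form := existT _ 1%N (dual_form g).
pose prs := [seq (f, m) | f <- fs, m <- iota 0 n0].
have [|x [xs Hx]] := @davie_gamelin R X z s e' (map h1 prs ++ map h2 gs) zs s0 (ltW s1) e'0.
  move=> A /(List.in_app_iff _ _ _)[/In_mapP[[f m] _ ->]|/In_mapP[g _ ->]] /=.
    by split; [exact: taylor_sym|exact: taylor_good].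
  split; [exact: dual_form_sym|by exists (rnorm g); exact: dual_form_good].
exists x; split; first by apply: le_lt_trans xs s1.
  move=> f ffs r /andP[r0 r1].
  have D l : (l < n0)%N -> rnorm (diag (@tf f l) x - abz (@tf f l) z) <= e'.
    move=> ln; have := Hx (h1 (f, l)); apply; apply/List.in_app_iff; left; apply: In_map.
    by apply/allpairsP; exists (f, l); rewrite /= ffs mem_iota.
  have rn : rnorm (r%:C : C) = r by rewrite rnorm_pos.
  have rx : rnorm (r%:C *: x) <= s.
    by rewrite rnormZ rn; apply: le_trans xs; rewrite ler_piMl// rnorm_ge0.
  have rz : rnorm (r%:C *: z) <= s.
    by rewrite rnormZ rn; apply: le_trans zs; rewrite ler_piMl// rnorm_ge0.
  have T1 : rnorm (ext0 f (r%:C *: x) - \sum_(l < n0) diag (@tf f l) (r%:C *: x)) <= e / 3.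
    apply: le_trans (@geometric_tail _ (fun l => diag (@tf f l) (r%:C *: x)) M s _ _ s01 M0 _ (taylor_tends f (le_lt_trans rx s1))) _.
      move=> l; apply: le_trans (taylor_cauchy _ _ (HM f ffs)) _.
      by rewrite ler_wpM2l// lerXn2r// ?nnegrE ?rnorm_ge0// ltW.
    by rewrite mulrAC.
  have T2 : rnorm (ab f (r%:C *: z) - \sum_(l < n0) abz (@tf f l) (r%:C *: z)) <= e / 3.
    apply: le_trans (@geometric_tail _ (fun l => abz (@tf f l) (r%:C *: z)) M s _ _ s01 M0 _ (aron_berner_ball_tends f (le_lt_trans rz s1))) _.
      by move=> l; apply: abz_cauchy (HM f ffs) rz s0 (ltW s1).
    by rewrite mulrAC.
  have T3 : rnorm (\sum_(l < n0) diag (@tf f l) (r%:C *: x) - \sum_(l < n0) abz (@tf f l) (r%:C *: z)) <= e / 3.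
    rewrite -sumrB; apply: le_trans (rnorm_sum _ _ _) _; apply: le_trans e'n.
    rewrite mulr_natl -[X in _ *+ X]card_ord -sumr_const; apply: ler_sum => l _.
    rewrite abzZ diagZ; last exact: taylor_mlin.
    rewrite -mulrBr rnormM rnormX rn; apply: le_trans (D l (ltn_ord l)).
    by rewrite ler_piMl ?rnorm_ge0// exprn_ile1.
  have := rnorm_tri (ext0 f (r%:C *: x)) (\sum_(l < n0) diag (@tf f l) (r%:C *: x)) (ab f (r%:C *: z)).
  have := rnorm_tri (\sum_(l < n0) diag (@tf f l) (r%:C *: x)) (\sum_(l < n0) abz (@tf f l) (r%:C *: z)) (ab f (r%:C *: z)).
  rewrite (rnormBC (\sum_(l < n0) abz (@tf f l) (r%:C *: z))); lra.
move=> g ggs; have := Hx (h2 g); rewrite /= abz_dual_form => H.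
apply: le_trans (H _) _.
  by apply/List.in_app_iff; right; exact: In_map.
rewrite /e' ler_pdivrMr// ler_peMr ?(ltW e0)//.
by have : (1 : R) <= n0.+1%:R; [rewrite ler1n|lra].
Qed.

Lemma ab_partial_lip f n : exists2 L : R, 0 <= L & forall w w', rnorm w <= 1 -> rnorm w' <= 1 ->
  rnorm (\sum_(l < n) abz (@tf f l) w - \sum_(l < n) abz (@tf f l) w') <= L * rnorm (w - w').
Proof.
elim: n => [|n [L L0 IH]].
  by exists 0 => // w w' _ _; rewrite !big_ord0 subrr rnorm0 mul0r.
have [K Kg] := taylor_good f n; have K0 : 0 <= K by case: Kg.
exists (L + K * n%:R); first by rewrite addr_ge0// mulr_ge0.
move=> w w' w1 w1'; rewrite !big_ord_recr /= opprD addrACA mulrDl.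
apply: le_trans (rnormD _ _) _; rewrite lerD ?IH//.
have := diag_lip (iterated_lim_mlin Kg) (iterated_lim_bnd Kg) K0 w1 w1'.
by rewrite expr1n mulr1.
Qed.

Lemma ab_continuous f w0 (e : R) : rnorm w0 < 1 -> 0 < e -> exists2 d : R, 0 < d &
  forall w, rnorm (w - w0) <= d -> rnorm w < 1 /\ rnorm (ab f w - ab f w0) <= e.
Proof.
move=> w1 e0; have [M M0 HM] := ext0_bound f.
have z0 := rnorm_ge0 w0; pose s := (1 + rnorm w0) / 2.
have s0 : 0 < s by rewrite /s; lra.
have s1 : s < 1 by rewrite /s; lra.
have s01 : 0 <= s < 1 by rewrite (ltW s0).
have [n0 /(_ n0 (leqnn _)) Hn] := @geometric_small _ (M / (1 - s)) s (e / 3) s01 (divr_gt0 e0 (ltr0n _ 3)).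
have [L L0 HL] := ab_partial_lip f n0.
have L1 : 0 < 3 * (L + 1) by lra.
exists (Num.min ((1 - rnorm w0) / 2) (e / (3 * (L + 1)))).
  by rewrite lt_min !divr_gt0//; lra.
move=> w; rewrite le_min => /andP[h1 h2].
have ws : rnorm w <= s by have := rnorm_subl w w0; rewrite /s; lra.
have w1' : rnorm w < 1 by lra.
split=> //.
have T v : rnorm v <= s -> rnorm (ab f v - \sum_(l < n0) abz (@tf f l) v) <= e / 3.
  move=> vs; apply: le_trans (@geometric_tail _ (fun l => abz (@tf f l) v) M s _ _ s01 M0 _ (aron_berner_ball_tends f (le_lt_trans vs s1))) _.
    by move=> l; apply: abz_cauchy HM vs s0 (ltW s1).
  by rewrite mulrAC.
have T1 := T w ws; have T2 : rnorm (ab f w0 - \sum_(l < n0) abz (@tf f l) w0) <= e / 3.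
  by apply: T; rewrite /s; lra.
have := HL w w0 (ltW w1') (ltW w1).
have : L * rnorm (w - w0) <= e / 3.
  move: h2; rewrite ler_pdivlMr// => h2; have := rnorm_ge0 (w - w0); lra.
have := rnorm_tri (ab f w) (\sum_(l < n0) abz (@tf f l) w) (ab f w0).
have := rnorm_tri (\sum_(l < n0) abz (@tf f l) w) (\sum_(l < n0) abz (@tf f l) w0) (ab f w0).
rewrite (rnormBC (\sum_(l < n0) abz (@tf f l) w0)); lra.
Qed.

Lemma ext0_radial f (e : R) : 0 < e -> exists2 d : R, 0 < d < 1 &
  forall r, 1 - d <= r <= 1 -> forall x, rnorm x < 1 -> rnorm (ext0 f x - ext0 f (r%:C *: x)) <= e.
Proof.
move=> e0; have fu : unif_continuous (Au_val f : set_type (unit_ball X) -> C).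
  by case: f => g /= /set_mem[].
have [d d0 H] := (Au_unif_continuousP _).1 fu e e0.
exists (Num.min (d / 2) 2^-1).
  by apply/andP; split; [rewrite lt_min; apply/andP; split; lra|rewrite gt_min; apply/orP; right; lra].
move=> r /andP[r1 r2] x x1.
have rd : 1 - r <= d / 2.
  have : Num.min (d / 2) 2^-1 <= d / 2 by rewrite ge_min lexx.
  lra.
have r0 : 0 <= r.
  have : Num.min (d / 2) 2^-1 <= 2^-1 by rewrite ge_min lexx orbT.
  lra.
have rx1 : rnorm (r%:C *: x) < 1.
  by rewrite rnormZ rnorm_pos//; apply: le_lt_trans x1; rewrite ler_piMl// rnorm_ge0.
have xB : unit_ball X x by rewrite /unit_ball/= rnorm_lt1.
have rxB : unit_ball X (r%:C *: x) by rewrite /unit_ball/= rnorm_lt1.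
rewrite (ext0E f (SigSub (mem_set xB))) (ext0E f (SigSub (mem_set rxB))) rnorm_modulus ltW//.
apply: H => /=; rewrite rnorm_ltC.
have -> : x - r%:C *: x = (1 - r)%:C *: x by rewrite rmorphB rmorph1 scalerBl scale1r.
rewrite rnormZ rnorm_pos; last lra.
have : (1 - r) * rnorm x <= (1 - r) * 1 by rewrite ler_wpM2l//; lra.
lra.
Qed.

(** Uniform continuity of the extension along radii; on the sphere it makes the
    radial limits exist, with the same d. *)
Definition radial_modulus f (e d : R) := 0 < d < 1 /\
  forall r, 1 - d <= r <= 1 -> forall z, rnorm z < 1 ->
    rnorm (ab f z - ab f (r%:C *: z)) <= e.

(** Uniform continuity of f passes to its extension along radii, since the
    approximating points may be chosen for z and all its multiples at once. *)
Lemma ab_radial f (e : R) : 0 < e -> exists d, radial_modulus f e d.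
Proof.
move=> e0; have e3 : 0 < e / 3 by lra.
have [d d0 H] := ext0_radial f e3; exists d; split=> // r rd z z1.
have [x [x1 Hx _]] := approx_ball [:: f] [::] z1 e3.
have r01 : 0 <= r <= 1 by case/andP: d0 => ? ?; case/andP: rd => ? ?; apply/andP; split; lra.
have h1 := Hx f (mem_head _ _) r r01.
have h2 := Hx f (mem_head _ _) 1; rewrite rmorph1 !scale1r ler01 lexx in h2; have {}h2 := h2 isT.
have h3 := H r rd x x1.
have := rnorm_tri (ab f z) (ext0 f x) (ab f (r%:C *: z)).
have := rnorm_tri (ext0 f x) (ext0 f (r%:C *: x)) (ab f (r%:C *: z)).
rewrite (rnormBC (ab f z) (ext0 f x)); lra.
Qed.

Lemma radial_segment f (e d t t' : R) z : radial_modulus f e d -> rnorm z <= 1 ->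
  1 - d <= t -> t <= t' -> t' < 1 -> rnorm (ab f (t'%:C *: z) - ab f (t%:C *: z)) <= e.
Proof.
move=> [/andP[d0 d1] H] z1 td tt t'1; have t0 : 0 < t by lra.
have t'0 : 0 < t' by lra.
have -> : t%:C *: z = (t / t')%:C *: (t'%:C *: z).
  by rewrite scalerA -rmorphM divfK// gt_eqF.
apply: H; last first.
  by rewrite rnormZ rnorm_pos ?(ltW t'0)//; apply: le_lt_trans t'1; rewrite ler_piMr// ltW.
rewrite ler_pdivlMr// ler_pdivrMr// mul1r tt andbT.
have : (1 - d) * t' <= (1 - d) * 1 by rewrite ler_wpM2l//; lra.
lra.
Qed.

Lemma radial_limit f z : rnorm z <= 1 -> exists L : C, forall e d t,
  radial_modulus f e d -> 1 - d <= t -> t < 1 -> rnorm (L - ab f (t%:C *: z)) <= e.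
Proof.
move=> z1; pose rn (n : nat) : R := 1 - 2^-1 ^+ n.+1.
have rn1 n : rn n < 1 by rewrite /rn gtrBl exprn_gt0.
have rn_big d : 0 < d -> exists n0, forall n, (n0 <= n)%N -> 1 - d <= rn n.
  move=> d0; have [|n0 Hn0] := @geometric_small R 1 2^-1 d _ d0; first by apply/andP; split; lra.
  exists n0 => n n0n; have := Hn0 n.+1 (leqW n0n); rewrite mul1r /rn; lra.
have [L HL] : exists L, tends (fun n => ab f ((rn n)%:C *: z)) L.
  apply: cauchy_tends => e e0; have [d rd] := ab_radial f e0.
  have [n0 Hn0] : exists n0, forall n, (n0 <= n)%N -> 1 - d <= rn n.
    by apply: rn_big; case: rd => /andP[].
  exists n0 => m n mn nn.
  have [le|/ltW le] := leP (rn n) (rn m); first exact: radial_segment rd z1 (Hn0 n nn) le (rn1 m).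
  by rewrite rnormBC; exact: radial_segment rd z1 (Hn0 m mn) le (rn1 n).
exists L => e d t rd td t1; apply/ler_addgt0Pr => e2 e20.
have [n1 /(_ (maxn n1 _) (leq_maxl _ _)) h1] := HL _ e20.
have t1' : 0 < 1 - t by lra.
have [n2 /(_ (maxn n1 n2) (leq_maxr _ _)) h2] := rn_big _ t1'.
have tl : t <= rn (maxn n1 n2) by lra.
have := radial_segment rd z1 td tl (rn1 _); have {h1} := h1 n2.
have := rnorm_tri L (ab f ((rn (maxn n1 n2))%:C *: z)) (ab f (t%:C *: z)).
rewrite (rnormBC L (ab f ((rn _)%:C *: z))); lra.
Qed.

Lemma near_sphere_proper z : rnorm z = 1 ->
  ProperFilter (within (unit_ball (bidual X)) (nbhs z)).
Proof.
move=> zE; apply: within_nbhs_proper => B /nbhs_ballP[d /= d0 dB].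
have d0' : 0 < complex.Re d by rewrite -ltcR gt0_RRe.
pose t := Num.max (1 - complex.Re d / 2) 2^-1.
have t0 : 0 <= t by rewrite /t le_max; apply/orP; right; lra.
have t1 : t < 1 by rewrite /t gt_max; apply/andP; split; lra.
exists (t%:C *: z); split.
  by rewrite /unit_ball/= rnorm_lt1 rnormZ rnorm_pos// zE mulr1.
apply: dB; rewrite -ball_normE /= -(gt0_RRe d0) rnorm_ltC.
have -> : z - t%:C *: z = (1 - t)%:C *: z by rewrite rmorphB rmorph1 scalerBl scale1r.
rewrite rnormZ zE mulr1 rnorm_pos; last lra.
have : 1 - complex.Re d / 2 <= t by rewrite /t le_max lexx.
lra.
Qed.

(** The radial limit is also the limit from within the ball: near z one pulls
    both points back by the same factor, to a point where the extension is
    continuous. *)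
Lemma delta_sphere f z L : rnorm z = 1 -> (forall e d t,
    radial_modulus f e d -> 1 - d <= t -> t < 1 -> rnorm (L - ab f (t%:C *: z)) <= e) ->
  delta z f = L.
Proof.
move=> zE radL; rewrite /delta /aron_berner rnorm_lt1 zE ltxx.
have Pz := near_sphere_proper zE.
apply: cvg_lim; first exact: norm_hausdorff.
apply/cvgrPdist_le => eC eC0.
have e0 : 0 < complex.Re eC / 3 by rewrite divr_gt0// -ltcR gt0_RRe.
have [d rd] := ab_radial f e0; case: (rd) => /andP[d0 d1] H.
pose t := 1 - d.
have t0 : 0 < t by rewrite /t; lra.
have t1 : t < 1 by rewrite /t; lra.
have tz1 : rnorm (t%:C *: z) < 1 by rewrite rnormZ rnorm_pos ?(ltW t0)// zE mulr1.
have [d2 d20 Hd2] := ab_continuous f tz1 e0.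
rewrite /fmap/= /within/=; apply/nbhs_ballP; exists d2%:C; first by rewrite /= ltcR.
move=> w; rewrite -ball_normE /= rnorm_ltC => zw wB.
have w1 : rnorm w < 1 by rewrite -rnorm_lt1.
rewrite -(gt0_RRe eC0) rnorm_leC.
have h1 := radL _ _ t rd (lexx _) t1.
have h2 : rnorm (ab f w - ab f (t%:C *: w)) <= complex.Re eC / 3.
  by apply: H => //; rewrite lexx ltW.
have [_ h3] : rnorm (t%:C *: w) < 1 /\ rnorm (ab f (t%:C *: w) - ab f (t%:C *: z)) <= complex.Re eC / 3.
  apply: Hd2; rewrite -scalerBr rnormZ rnorm_pos ?(ltW t0)// rnormBC.
  by apply: le_trans (ltW zw); rewrite ler_piMl ?rnorm_ge0// ltW.
have := rnorm_tri L (ab f (t%:C *: z)) (ab f w).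
have := rnorm_tri (ab f (t%:C *: z)) (ab f (t%:C *: w)) (ab f w).
rewrite (rnormBC (ab f (t%:C *: z)) (ab f (t%:C *: w))) (rnormBC (ab f (t%:C *: w)) (ab f w)); lra.
Qed.

Lemma delta_radial f (e : R) : 0 < e -> exists2 d : R, 0 < d < 1 &
  forall r, 1 - d <= r < 1 -> forall z, rnorm z <= 1 ->
    rnorm (delta z f - ab f (r%:C *: z)) <= e.
Proof.
move=> e0; have [d rd] := ab_radial f e0; case: (rd) => d01 H.
exists d => // r /andP[dr r1] z z1.
have [zlt|zge] := boolP (`|z| < 1).
  rewrite /delta /aron_berner zlt; apply: H; last by rewrite -rnorm_lt1.
  by rewrite dr ltW.
have zE : rnorm z = 1 by apply/eqP; rewrite eq_le z1 /= leNgt -rnorm_lt1.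
have [L HL] := radial_limit f z1.
by rewrite (delta_sphere zE HL); exact: HL rd dr r1.
Qed.

(** At a point of the sphere, approximate at a slightly smaller multiple of z. *)
Lemma delta_approx (fs : seq (Au X)) (gs : seq (dual X)) z (e : R) :
  rnorm z <= 1 -> 0 < e -> exists x : X, [/\ rnorm x < 1,
    (forall f, f \in fs -> rnorm (ext0 f x - delta z f) <= e) &
    forall g, g \in gs -> rnorm (g x - z g) <= e].
Proof.
move=> z1 e0; have e2 : 0 < e / 2 by lra.
have [d d01 Hd] : exists2 d : R, 0 < d < 1 & forall f, f \in fs ->
    forall r, 1 - d <= r < 1 -> rnorm (delta z f - ab f (r%:C *: z)) <= e / 2.
  elim: fs => [|f fs [d /andP[d0 d1] IH]]; first by exists 2^-1 => //; apply/andP; split; lra.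
  have [d' /andP[d'0 d'1] H] := delta_radial f e2.
  exists (Num.min d d'); first by rewrite lt_min d0 d'0 gt_min d1.
  move=> h; rewrite in_cons => /orP[/eqP->|hfs] r /andP[rd r1].
    apply: H => //; rewrite r1 andbT; apply: le_trans rd.
    by rewrite lerD2l lerN2 ge_min lexx orbT.
  apply: IH => //; rewrite r1 andbT; apply: le_trans rd.
  by rewrite lerD2l lerN2 ge_min lexx.
have [G G0 HG] : exists2 G : R, 0 <= G & forall g, g \in gs -> rnorm (z g) <= G.
  elim: gs => [|g gs [G G0 IH]]; first by exists 0.
  exists (G + rnorm (z g)); first by rewrite addr_ge0 ?rnorm_ge0.
  move=> h; rewrite in_cons => /orP[/eqP->|/IH]; first by lra.
  by have := rnorm_ge0 (z g); lra.
case/andP: d01 => d0 d1.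
have G1 : 0 < 2 * (G + 1) by lra.
pose t := Num.min d (e / (2 * (G + 1))).
have t0 : 0 < t by rewrite lt_min d0 divr_gt0.
have td : t <= d by rewrite ge_min lexx.
have tG : t * (2 * (G + 1)) <= e by rewrite -ler_pdivlMr// ge_min lexx orbT.
pose r := 1 - t.
have r0 : 0 < r by rewrite /r; lra.
have rz : rnorm (r%:C *: z) < 1.
  rewrite rnormZ rnorm_pos ?(ltW r0)//.
  have : r * rnorm z <= r * 1 by rewrite ler_wpM2l// ltW.
  rewrite /r; lra.
have [x [x1 Hf Hg]] := approx_ball fs gs rz e2; exists x; split => //.
  move=> f ffs; have h1 := Hf f ffs 1; rewrite rmorph1 !scale1r ler01 lexx in h1; have {}h1 := h1 isT.
  have h2 : rnorm (delta z f - ab f (r%:C *: z)) <= e / 2.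
    by apply: Hd => //; rewrite /r; apply/andP; split; lra.
  have := rnorm_tri (ext0 f x) (ab f (r%:C *: z)) (delta z f).
  rewrite (rnormBC (ab f (r%:C *: z))); lra.
move=> g ggs; have := Hg g ggs; have := HG g ggs.
have -> : (r%:C *: z) g = r%:C * z g by [].
have -> : g x - z g = (g x - r%:C * z g) - t%:C * z g.
  by rewrite /r rmorphB rmorph1; ring.
move=> h1 h2; have := rnormB (g x - r%:C * z g) (t%:C * z g).
rewrite (rnormM t%:C) rnorm_pos ?(ltW t0)//.
have : t * rnorm (z g) <= t * G by rewrite ler_wpM2l// ltW.
lra.
Qed.

End Approximation.

(** * Moebius transforms in the algebra *)

Section Moebius.
Variables (R : realType) (X : normedModType R[i]).
Local Notation C := R[i].
Local Notation B := (set_type (unit_ball X)).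
Implicit Types (f g : Au X) (c : C).

Lemma Au_norm_le f (M : R) : (Au_norm f <= M%:E)%E <-> forall b, rnorm (f b) <= M.
Proof.
split=> [H b|H].
  rewrite -lee_fin; apply: le_trans H; apply: ereal_sup_ubound.
  by exists b.
by apply: ge_ereal_sup => _ [b _ <-]; rewrite lee_fin -rnorm_modulus.
Qed.

Lemma AuME f g b : (f * g) b = f b * g b. Proof. by []. Qed.
Lemma AuBE f g b : (f - g) b = f b - g b. Proof. by []. Qed.
Lemma AuZE c f b : (c *: f) b = c * f b. Proof. by []. Qed.
Lemma Au1E b : (1 : Au X) b = 1. Proof. by []. Qed.

Lemma Au_ext f g : (forall b, f b = g b) -> f = g.
Proof. by move=> fg; apply/val_inj/funext. Qed.

(** The difference of inverses is the difference divided by a product bounded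
    away from 0. *)
Lemma Au_inverse f (c : R) : 0 < c -> (forall b, c <= rnorm (f b)) ->
  exists k : Au X, f * k = 1.
Proof.
move=> c0 fc; have f0 b : f b != 0 by rewrite -rnorm_gt0; exact: lt_le_trans (fc b).
have [fd fu] : (forall x : B, differentiable ('valL_0 (Au_val f)) (val x)) /\
    unif_continuous (Au_val f : B -> C) by case: (f) => h /= /set_mem.
pose k : B -> C := fun b => (f b)^-1.
have kA : k \in @Au_pred R X.
  apply/mem_set; split => [b|].
    have vE : 'valL_0 k = (fun y => ('valL_0 (Au_val f) y)^-1) :> (X -> C).
      apply/funext => y; have [yB|yB] := pselect (unit_ball X y); last first.
        by rewrite !valL_out// invr0.
      by rewrite (valL_val k (SigSub (mem_set yB))) (valL_val (Au_val f) (SigSub (mem_set yB))).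
    rewrite vE; apply: differentiableV; first exact: fd.
    by rewrite valL_val.
  apply/Au_unif_continuousP => e e0.
  have [d d0 H] := (Au_unif_continuousP _).1 fu (e * c ^+ 2) (mulr_gt0 e0 (exprn_gt0 2 c0)).
  exists d => // x y xy; rewrite /k -rnorm_modulus.
  have -> : (f x)^-1 - (f y)^-1 = (f y - f x) / (f x * f y).
    by field; rewrite !f0.
  rewrite rnormM rnormV rnormM rnormBC ltr_pdivrMr ?mulr_gt0 ?rnorm_gt0//.
  apply: lt_le_trans (H x y xy) _; rewrite ler_pM2l// expr2.
  by apply: ler_pM => //; exact: ltW.
exists (MkAu kA); apply: Au_ext => b; rewrite AuME Au1E /=.
exact: mulfV.
Qed.

Lemma conj_sq (a : C) : a * conjc a = (rnorm a ^+ 2)%:C.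
Proof. by rewrite -sqr_normc rnormE rmorphXn. Qed.

Lemma conj_scale (r : R) (a : C) : conjc (r%:C * a) = r%:C * conjc a.
Proof. by case: a => x y /=; congr (_ +i* _); ring. Qed.

Lemma moebius_identity (a c : C) : rnorm (1 - conjc c * a) ^+ 2 =
  rnorm (a - c) ^+ 2 + (1 - rnorm a ^+ 2) * (1 - rnorm c ^+ 2).
Proof. by rewrite !rnormXsqr; case: a => x y; case: c => u v /=; ring. Qed.

Lemma moebius_ge (a c : C) : rnorm a <= 1 -> 1 - rnorm c <= rnorm (1 - conjc c * a).
Proof.
move=> a1; apply: le_trans (rnorm_subl _ _); rewrite rnorm1 lerB// rnormM rnormJ.
by rewrite ler_piMr// rnorm_ge0.
Qed.

Lemma sq_le1 (a : R) : 0 <= a -> a <= 1 -> a ^+ 2 <= 1.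
Proof. by move=> a0 a1; rewrite exprn_ile1. Qed.

Section Characters.
Variables (phi : Au X -> C).
Hypothesis phis : spectrum phi.

Lemma specD f g : phi (f + g) = phi f + phi g.
Proof. by case: phis => l _ _; have := l 1 f g; rewrite !scale1r. Qed.

Lemma spec0 : phi 0 = 0.
Proof. by have := specD 0 0; rewrite addr0 => /eqP; rewrite -subr_eq0 opprD addrA subrr sub0r oppr_eq0 => /eqP. Qed.

Lemma specZ c f : phi (c *: f) = c * phi f.
Proof. by case: phis => l _ _; have := l c f 0; rewrite !addr0 spec0 addr0. Qed.

Lemma specB f g : phi (f - g) = phi f - phi g.
Proof. by rewrite specD -scaleN1r specZ mulN1r. Qed.

Lemma specM f g : phi (f * g) = phi f * phi g.
Proof. by case: phis => _ m _; exact: m. Qed.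

Lemma spec1 : phi 1 = 1.
Proof.
case: phis => _ _ [f f0]; apply: (mulIf f0).
by rewrite -specM mul1r mul1r.
Qed.

(** If |phi f| > sup |f| then phi f - f is invertible, although phi kills it. *)
Lemma spec_contract f (M : R) : (forall b, rnorm (f b) <= M) -> rnorm (phi f) <= M.
Proof.
move=> fM; rewrite leNgt; apply/negP => Mphi.
have [|b|k] := @Au_inverse (phi f *: (1 : Au X) - f) (rnorm (phi f) - M).
- by rewrite subr_gt0.
- rewrite AuBE AuZE Au1E mulr1; apply: le_trans (rnorm_subl _ _).
  by rewrite lerB.
move=> /(congr1 phi); rewrite specM specB specZ spec1 mulr1 subrr mul0r.
by move=> /esym/eqP; rewrite oner_eq0.
Qed.

End Characters.

(** F = (f - c) / (1 - conj c f), bounded by 1 through moebius_identity. *)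
Lemma moebius f c : (forall b, rnorm (f b) <= 1) -> rnorm c < 1 ->
  exists F : Au X, (forall b, rnorm (F b) <= 1) /\
    forall phi, spectrum phi -> phi F * (1 - conjc c * phi f) = phi f - c.
Proof.
move=> f1 c1; have c0 := rnorm_ge0 c.
have [|b|k kE] := @Au_inverse ((1 : Au X) - conjc c *: f) (1 - rnorm c).
- by rewrite subr_gt0.
- by rewrite AuBE Au1E AuZE; exact: moebius_ge.
exists ((f - c *: (1 : Au X)) * k); split=> [b|phi ps]; last first.
  rewrite (specM ps) -mulrA [phi k * _]mulrC.
  have -> : 1 - conjc c * phi f = phi (1 - conjc c *: f) by rewrite specB// specZ// spec1.
  by rewrite -(specM ps) kE spec1// mulr1 specB// specZ// spec1// mulr1.
have kb : (1 - conjc c * f b) * k b = 1.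
  by have := congr1 (fun h : Au X => h b) kE; rewrite AuME AuBE Au1E AuZE.
rewrite AuME AuBE AuZE Au1E mulr1 rnormM.
apply: (@le_trans _ _ (rnorm (1 - conjc c * f b) * rnorm (k b))); last by rewrite -rnormM kb rnorm1.
rewrite ler_wpM2r ?rnorm_ge0// -(@ler_pXn2r _ 2)// ?nnegrE ?rnorm_ge0//.
rewrite moebius_identity lerDl mulr_ge0// subr_ge0 sq_le1 ?rnorm_ge0//; exact: ltW.
Qed.

(** The pseudo-hyperbolic form of the condition of being at distance less than
    2: a first Moebius transform sends the value at phi to 0, and a second one,
    centred at radius g close to 1 in the direction of the value at psi, spreads
    the two values almost to opposite points of the disc. *)
Lemma pseudohyperbolic phi psi : spectrum phi -> spectrum psi ->
  (gleason_dist phi psi < 2%:E)%E ->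
  exists2 rho : R, 0 <= rho < 1 & forall f, (forall b, rnorm (f b) <= 1) ->
    rnorm (phi f) < 1 -> rnorm (psi f - phi f) <= rho * rnorm (1 - conjc (phi f) * psi f).
Proof.
move=> ps qs dist.
have [eps [e0 e1] He] : exists2 eps : R, 0 < eps /\ eps <= 1 & forall f, (forall b, rnorm (f b) <= 1) ->
    rnorm (phi f - psi f) <= 2 - eps.
  have ub f : (forall b, rnorm (f b) <= 1) -> ((rnorm (phi f - psi f))%:E <= gleason_dist phi psi)%E.
    by move=> f1; apply: ereal_sup_ubound; exists f => //=; apply/Au_norm_le.
  move: dist ub; case: (gleason_dist phi psi) => [d| |]; rewrite ?lte_fin//.
    move=> d2 ub; exists (Num.min 1 (2 - d)).
      by split; [rewrite lt_min ltr01/= subr_gt0|rewrite ge_min lexx].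
    move=> f /ub; rewrite lee_fin => h.
    have : Num.min 1 (2 - d) <= 2 - d by rewrite ge_min lexx orbT.
    lra.
  by move=> _ ub; exists 1 => // f /ub.
(* In the end the second transform yields (t - g) / (1 - g t) <= h for the modulus
   t of the value at psi, which amounts to t <= rho. *)
pose g := 1 - eps / 4; pose h := 1 - 3 * eps / 4.
have g0 : 0 < g by rewrite /g; lra.
have g1 : g < 1 by rewrite /g; lra.
have h0 : 0 <= h by rewrite /h; lra.
have h1 : h < 1 by rewrite /h; lra.
have gh : 0 < 1 + g * h by have := mulr_ge0 (ltW g0) h0; lra.
pose rho := (h + g) / (1 + g * h).
have rho0 : 0 <= rho by rewrite /rho divr_ge0//; lra.
have rho1 : rho < 1.
  have gh1 : 0 < (1 - g) * (1 - h) by apply: mulr_gt0; lra.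
  rewrite /rho ltr_pdivrMr// mul1r.
  lra.
exists rho; first by rewrite rho0.
move=> f f1 phi1; have [F [F1 HF]] := moebius f1 phi1.
set a := phi f in phi1 HF *; set b := psi f.
have a1 : rnorm a < 1 by [].
have nza : 1 - conjc a * a != 0.
  by rewrite -rnorm_gt0; apply: lt_le_trans (moebius_ge a (ltW a1)); rewrite subr_gt0.
have phF : phi F = 0.
  have := HF phi ps; rewrite -/a subrr => /eqP; rewrite mulf_eq0 (negbTE nza) orbF.
  by move/eqP.
set be := psi F; have HB : be * (1 - conjc a * b) = b - a by exact: (HF psi qs).
have be1 : rnorm be <= 1 by exact: spec_contract.
suff beR : rnorm be <= rho by rewrite -HB rnormM ler_wpM2r ?rnorm_ge0.
have [->|be0] := eqVneq be 0; first by rewrite rnorm0.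
have t0 : 0 < rnorm be by rewrite rnorm_gt0.
set t := rnorm be in be1 t0 *.
pose c : C := (g / t)%:C * be.
have c1 : rnorm c < 1.
  by rewrite rnormM rnorm_pos ?divr_ge0 ?(ltW g0) ?(ltW t0)// -/t divfK// gt_eqF.
have [G [G1 HG]] := moebius F1 c1.
have phG : phi G = - c by have := HG phi ps; rewrite phF mulr0 subr0 mulr1 sub0r.
have gt1 : 0 < 1 - g * t.
  by rewrite subr_gt0; apply: le_lt_trans g1; rewrite ler_piMr// ltW.
have cbe : conjc c * be = (g * t)%:C.
  rewrite /c conj_scale -mulrA [conjc be * be]mulrC conj_sq -/t -rmorphM.
  by congr (_%:C); field; rewrite gt_eqF.
have psG : psi G = ((t - g) / (t * (1 - g * t)))%:C * be.
  have := HG psi qs; rewrite -/be cbe.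
  have -> : 1 - (g * t)%:C = (1 - g * t)%:C :> C by rewrite rmorphB rmorph1.
  move=> E.
  have nz : (1 - g * t)%:C != 0 :> C by apply/eqP => /complexI/eqP; rewrite gt_eqF.
  apply: (mulIf nz); rewrite E mulrAC -rmorphM /c.
  have -> : be - (g / t)%:C * be = (1 - g / t)%:C * be by rewrite rmorphB rmorph1; ring.
  by congr (_%:C * _); field; rewrite !gt_eqF.
have := He G G1; rewrite phG psG /c.
have -> : - ((g / t)%:C * be) - ((t - g) / (t * (1 - g * t)))%:C * be =
   - ((g / t + (t - g) / (t * (1 - g * t)))%:C * be).
  by rewrite rmorphD /=; ring.
rewrite rnormN rnormM rnorm_real -/t => E.
have E2 : (g / t + (t - g) / (t * (1 - g * t))) * t <= 2 - eps.
  by apply: le_trans E; rewrite ler_wpM2r ?(ltW t0)// ler_norm.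
have E3 : g + (t - g) / (1 - g * t) <= 2 - eps.
  apply: le_trans E2; rewrite le_eqVlt; apply/orP; left; apply/eqP.
  by field; rewrite !gt_eqF.
have E4 : (t - g) / (1 - g * t) <= h by rewrite /h; move: E3; rewrite {1}/g; lra.
rewrite /rho ler_pdivlMr//; move: E4; rewrite ler_pdivrMr//; lra.
Qed.

(** A Moebius transform reduces the case |phi g| < 1 to phi g = 0.  For a = phi g
    and b = psi g it gives |b - a| <= rho |1 - conj a b|, and the identity of the
    transform turns this into s |b - a|^2 <= (2 - |b - a|)^2 with s = 1 - rho^2,
    which excludes |b - a| > 2 - s. *)
Lemma schwarz_dist phi psi (rho : R) : spectrum phi -> spectrum psi ->
  0 <= rho < 1 ->
  (forall f, (forall b, rnorm (f b) <= 1) -> phi f = 0 -> rnorm (psi f) <= rho) ->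
  (gleason_dist phi psi < 2%:E)%E.
Proof.
move=> ps qs /andP[rho0 rho1] schwarz.
pose s := 1 - rho ^+ 2.
have s0 : 0 < s by rewrite subr_gt0 exprn_ilt1.
have s1 : s <= 1 by rewrite /s; have := sqr_ge0 rho; lra.
suff H f : (forall b, rnorm (f b) <= 1) -> rnorm (phi f - psi f) <= 2 - s.
  apply: (@le_lt_trans _ _ (2 - s)%:E); last by rewrite lte_fin; lra.
  apply: ge_ereal_sup => _ [f /= /Au_norm_le f1 <-].
  by rewrite lee_fin -rnorm_modulus; exact: H.
move=> f1.
have key g : (forall b, rnorm (g b) <= 1) -> rnorm (phi g) < 1 -> rnorm (phi g - psi g) <= 2 - s.
  move=> g1 phi1; have [F [F1 HF]] := moebius g1 phi1.
  have b1 : rnorm (psi g) <= 1 by exact: spec_contract.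
  move: (HF _ ps) (HF _ qs) b1; set a := phi g in phi1 HF *; set b := psi g => phF HB b1.
  have a0 := rnorm_ge0 a; have b0 := rnorm_ge0 b.
  have nza : 1 - conjc a * a != 0.
    by rewrite -rnorm_gt0; apply: lt_le_trans (moebius_ge a (ltW phi1)); rewrite subr_gt0.
  move: phF; rewrite subrr => /eqP; rewrite mulf_eq0 (negbTE nza) orbF => /eqP phF.
  have be := schwarz F F1 phF.
  have d1 : rnorm (b - a) <= rho * rnorm (1 - conjc a * b).
    by rewrite -HB rnormM ler_wpM2r ?rnorm_ge0.
  have id := moebius_identity b a.
  rewrite rnormBC; set d := rnorm (b - a) in d1 id *.
  have d0 : 0 <= d by exact: rnorm_ge0.
  have dab : d <= rnorm a + rnorm b by rewrite addrC; exact: rnormB.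
  have d2 : d ^+ 2 <= rho ^+ 2 * rnorm (1 - conjc a * b) ^+ 2.
    by rewrite -exprMn lerXn2r// nnegrE// mulr_ge0// rnorm_ge0.
  pose u := 1 - rnorm a; pose v := 1 - rnorm b.
  have u0 : 0 <= u by rewrite /u; lra.
  have v0 : 0 <= v by rewrite /v; lra.
  have uv : (1 - rnorm b ^+ 2) * (1 - rnorm a ^+ 2) <= (2 - d) ^+ 2.
    have e1 : 1 - rnorm b ^+ 2 <= 2 * v by rewrite /v; have := sqr_ge0 (1 - rnorm b); rewrite !expr2; lra.
    have e2 : 1 - rnorm a ^+ 2 <= 2 * u by rewrite /u; have := sqr_ge0 (1 - rnorm a); rewrite !expr2; lra.
    apply: (@le_trans _ _ (2 * v * (2 * u))).
      by apply: ler_pM => //; rewrite subr_ge0 sq_le1// ltW.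
    have e3 : u + v <= 2 - d by rewrite /u /v; lra.
    apply: (@le_trans _ _ ((u + v) ^+ 2)).
      by have := sqr_ge0 (u - v); rewrite !expr2; lra.
    by rewrite lerXn2r// ?nnegrE; lra.
  have key : d ^+ 2 * s <= (2 - d) ^+ 2.
    have : rho ^+ 2 * ((1 - rnorm b ^+ 2) * (1 - rnorm a ^+ 2)) <= (2 - d) ^+ 2.
      apply: le_trans uv; rewrite ler_piMl//; last by rewrite sq_le1// ltW.
      by rewrite mulr_ge0// subr_ge0 sq_le1// ltW.
    rewrite /s; move: d2; rewrite id; lra.
  rewrite leNgt; apply/negP => dn.
  have dd : 1 < d ^+ 2 by rewrite exprn_egt1//; lra.
  have : (2 - d) ^+ 2 < s ^+ 2 by rewrite ltrXn2r// ?nnegrE; lra.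
  have : s * 1 < s * d ^+ 2 by rewrite ltr_pM2l.
  have : s ^+ 2 <= s by rewrite expr2 ler_piMr// ltW.
  rewrite [s * d ^+ 2]mulrC; lra.
have phi1 : rnorm (phi f) <= 1 by exact: spec_contract.
apply/ler_addgt0Pr => e e0.
pose r := 1 - Num.min (e / 3) 2^-1.
have m0 : 0 < Num.min (e / 3) 2^-1 by rewrite lt_min divr_gt0//= invr_gt0.
have mh : Num.min (e / 3) 2^-1 <= 2^-1 by rewrite ge_min lexx orbT.
have r0 : 0 < r by rewrite /r; lra.
have r1 : r < 1 by rewrite /r; lra.
have rn : rnorm (r%:C : C) = r by rewrite rnorm_pos// ltW.
have K := key (r%:C *: f) _ _; rewrite !specZ// -mulrBr !rnormM rn in K.
have {}K : r * rnorm (phi f - psi f) <= 2 - s.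
  apply: K => [b|].
    by rewrite AuZE rnormM rn; apply: le_trans (ler_wpM2l (ltW r0) (f1 b)) _; rewrite mulr1 ltW.
  by apply: le_lt_trans r1; rewrite ler_piMr// ltW.
have D2 : rnorm (phi f - psi f) <= 2.
  have : rnorm (psi f) <= 1 by exact: spec_contract.
  by have := rnormB (phi f) (psi f); lra.
have : (1 - r) * rnorm (phi f - psi f) <= (1 - r) * 2 by rewrite ler_wpM2l//; lra.
have : 1 - r <= e / 3 by rewrite /r opprB addrCA subrr addr0 ge_min lexx.
lra.
Qed.

End Moebius.

(** * Evaluation characters and their Gleason parts *)

Section Delta.
Variables (R : realType) (X : normedModType R[i]).
Local Notation C := R[i].
Local Notation B := (set_type (unit_ball X)).
Local Notation tf := (@taylor_form R X).
Implicit Types (f g : Au X) (z : bidual X).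

Lemma delta_approx_ball (fs : seq (Au X)) (gs : seq (dual X)) z (e : R) :
  rnorm z <= 1 -> 0 < e -> exists b : B,
    (forall f, f \in fs -> rnorm (f b - delta z f) <= e) /\
    forall g : dual X, g \in gs -> rnorm (g (val b) - z g) <= e.
Proof.
move=> z1 e0; have [x [x1 Hf Hg]] := delta_approx fs gs z1 e0.
have xB : unit_ball X x by rewrite /unit_ball/= rnorm_lt1.
exists (SigSub (mem_set xB)); split=> [f ffs|]; last exact: Hg.
by rewrite -(ext0E f (SigSub (mem_set xB))); exact: Hf.
Qed.

Lemma approx_linear (a x y x' y' w : C) (e : R) :
  rnorm (x - x') <= e -> rnorm (y - y') <= e -> rnorm (a * x + y - w) <= e ->
  rnorm (w - (a * x' + y')) <= (2 + rnorm a) * e.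
Proof.
move=> h2 h3 h1.
have -> : w - (a * x' + y') = a * (x - x') + (y - y') - (a * x + y - w) by ring.
apply: le_trans (rnormB _ _) _; have := rnormD (a * (x - x')) (y - y').
rewrite rnormM; have := ler_wpM2l (rnorm_ge0 a) h2; lra.
Qed.

Lemma approx_mul (x y x' y' w : C) (e M : R) : rnorm x <= M ->
  rnorm (x - x') <= e -> rnorm (y - y') <= e -> rnorm (x * y - w) <= e ->
  rnorm (w - x' * y') <= (1 + M + rnorm y') * e.
Proof.
move=> xM h2 h3 h1.
have -> : w - x' * y' = x * (y - y') + (x - x') * y' - (x * y - w) by ring.
apply: le_trans (rnormB _ _) _.
have := rnormD (x * (y - y')) ((x - x') * y'); rewrite !rnormM.
have : rnorm x * rnorm (y - y') <= M * e by apply: ler_pM; rewrite ?rnorm_ge0.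
have := ler_wpM2r (rnorm_ge0 y') h2; lra.
Qed.

(** The identities hold for evaluation at points of the ball, hence in the limit. *)
Lemma delta_spectrum z : rnorm z <= 1 -> spectrum (delta z : Au X -> C).
Proof.
move=> z1; split.
- move=> a f g; apply/eqP; rewrite -subr_eq0; apply/eqP.
  apply: (@rnorm_small_eq0 _ _ _ (2 + rnorm a)); first by rewrite addr_ge0 ?rnorm_ge0.
  move=> e e0; have [b [Hb _]] := delta_approx_ball [:: a *: f + g; f; g] [::] z1 e0.
  apply: (@approx_linear _ (f b) (g b)).
  - by apply: Hb; rewrite !inE eqxx orbT.
  - by apply: Hb; rewrite !inE eqxx !orbT.
  - exact: (Hb (a *: f + g) (mem_head _ _)).
- move=> f g; apply/eqP; rewrite -subr_eq0; apply/eqP.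
  have [M M0 HM] := ext0_bound f.
  apply: (@rnorm_small_eq0 _ _ _ (1 + M + rnorm (delta z g))).
    by rewrite !addr_ge0 ?rnorm_ge0.
  move=> e e0; have [b [Hb _]] := delta_approx_ball [:: f * g; f; g] [::] z1 e0.
  apply: (@approx_mul (f b) (g b)).
  - by rewrite -ext0E; apply: HM; rewrite -rnorm_lt1; exact: unit_ballP.
  - by apply: Hb; rewrite !inE eqxx orbT.
  - by apply: Hb; rewrite !inE eqxx !orbT.
  - exact: (Hb (f * g) (mem_head _ _)).
exists 1; have [b [Hb _]] := delta_approx_ball [:: 1] [::] z1 (divr_gt0 ltr01 (ltr0n R 2)).
have := Hb 1 (mem_head _ _); rewrite Au1E; move: (delta z 1) => d h.
apply/eqP => d0; move: h; rewrite d0 subr0 rnorm1 -subr_ge0.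
by lra.
Qed.

Lemma delta_fiber z : rnorm z <= 1 -> fiber z (delta z).
Proof.
move=> z1; split; first exact: delta_spectrum.
move=> g; apply/eqP; rewrite -subr_eq0; apply/eqP.
apply: (@rnorm_small_eq0 _ _ _ 2) => // e e0.
have [b [Hf Hg]] := delta_approx_ball [:: dual_Au g] [:: g] z1 e0.
have h1 : rnorm (g (val b) - delta z (dual_Au g)) <= e by exact: (Hf _ (mem_head _ _)).
have h2 := Hg _ (mem_head _ _).
move: h1 h2; move: (delta z _) (z g) (g (val b)) => d1 d2 d3 h1 h2.
apply: le_trans (rnorm_tri _ d3 _) _; rewrite (rnormBC d1); lra.
Qed.

(** Schwarz's lemma along the disc z + l u.  The sum G of the first terms of the
    extended Taylor series at r (z + l u) is a polynomial in l, within 2 e' of the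
    function to be bounded; dividing it by l, up to its small constant term, and
    applying the maximum modulus principle gives the estimate up to e. *)
Lemma delta_schwarz z (u : bidual X) f (l : C) :
  (forall l : C, rnorm l <= 1 -> rnorm (z + l *: u) <= 1) ->
  (forall b, rnorm (f b) <= 1) -> delta z f = 0 -> rnorm l <= 1 ->
  rnorm (delta (z + l *: u) f) <= rnorm l.
Proof.
move=> zu f1 fz l1; apply/ler_addgt0Pr => e e0.
pose e' := e / 8; have e'0 : 0 < e' by rewrite divr_gt0.
have [d /andP[d0 d1] Hd] := delta_radial f e'0.
pose r := 1 - d / 2.
have r0 : 0 < r by rewrite /r; lra.
have r1 : r < 1 by rewrite /r; lra.
have rd : 1 - d <= r < 1 by rewrite r1 andbT /r; lra.
have r01 : 0 <= r < 1 by rewrite (ltW r0).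
have rn : rnorm (r%:C : C) = r by rewrite rnorm_pos// ltW.
have F1 x : rnorm x < 1 -> rnorm (ext0 f x) <= 1.
  by move=> x1; apply: (@ext0P _ _ _ _ (fun c => rnorm c <= 1)).
have [n /(_ n (leqnn _)) Hn] := @geometric_small _ (1 / (1 - r)) r e' r01 e'0.
have w1 (t : C) : rnorm t <= 1 -> rnorm (r%:C *: (z + t *: u)) <= r.
  by move=> t1; rewrite rnormZ rn ler_piMr ?(ltW r0)// zu.
pose G (t : C) : C := \sum_(m < n) abz (@tf f m) (r%:C *: (z + t *: u)).
have GA (t : C) : rnorm t <= 1 -> rnorm (aron_berner_ball f (r%:C *: (z + t *: u)) - G t) <= e'.
  move=> t1; have wr := w1 t t1.
  apply: le_trans (@geometric_tail _ (fun m => abz (@tf f m) (r%:C *: (z + t *: u))) 1 r _ n r01 ler01 _ (aron_berner_ball_tends f (le_lt_trans wr r1))) _.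
    by move=> m; exact: abz_cauchy F1 wr r0 (ltW r1).
  by rewrite mulrAC.
have GD (t : C) : rnorm t <= 1 -> rnorm (delta (z + t *: u) f - G t) <= 2 * e'.
  move=> t1; have := Hd r rd _ (zu t t1); have := GA t t1.
  have := rnorm_tri (delta (z + t *: u) f) (aron_berner_ball f (r%:C *: (z + t *: u))) (G t); lra.
have [p Hp] : exists p : {poly C}, forall t, G t = p.[t].
  rewrite /G; elim: (n) => [|m [p Hp]].
    by exists 0 => t; rewrite big_ord0 horner0.
  have [K Ag] := taylor_good f m.
  have [q [_ Hq]] := diag_line z u (iterated_lim_mlin Ag).
  exists (p + (r%:C ^+ m) *: q) => t; rewrite big_ord_recr /= Hp hornerD hornerZ -Hq.
  by rewrite abzZ.
have D1 (t : C) : rnorm t <= 1 -> rnorm (delta (z + t *: u) f) <= 1.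
  by move=> t1; apply: spec_contract => //; apply: delta_spectrum; exact: zu.
have p0 : rnorm p.[0] <= 2 * e'.
  have z0 : rnorm (0 : C) <= 1 by rewrite rnorm0.
  have := GD 0 z0; rewrite scale0r addr0 fz sub0r rnormN -Hp.
  by [].
have [q Hq] : exists q : {poly C}, forall t, p.[t] = q.[t] * t + p.[0].
  have : root (p - (p.[0])%:P) 0 by rewrite /root !hornerE subrr.
  move=> /factor_theorem[q]; rewrite subr0 => E; exists q => t.
  by rewrite -[p in LHS](subrK (p.[0])%:P) E !hornerE.
have qb (t : C) : rnorm t = 1 -> rnorm q.[t] <= 1 + 4 * e'.
  move=> t1; have t1' : rnorm t <= 1 by rewrite t1.
  have -> : rnorm q.[t] = rnorm (q.[t] * t) by rewrite rnormM t1 mulr1.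
  have -> : q.[t] * t = p.[t] - p.[0] by rewrite Hq addrK.
  have := GD t t1'; have := D1 t t1'; rewrite -Hp => h1 h2.
  have := rnormB (G t) p.[0]; have := rnorm_subl (G t) (delta (z + t *: u) f).
  rewrite (rnormBC (G t)); lra.
have ql : rnorm q.[l] <= 1 + 4 * e' by exact: poly_max_modulus qb l1.
have pl : rnorm p.[l] <= (1 + 4 * e') * rnorm l + 2 * e'.
  rewrite Hq; apply: le_trans (rnormD _ _) _; rewrite rnormM lerD//.
  by rewrite ler_wpM2r ?rnorm_ge0.
have := GD l l1; rewrite Hp.
have := rnorm_subl (delta (z + l *: u) f) p.[l].
have : 4 * e' * rnorm l <= 4 * e' * 1 by rewrite ler_wpM2l// mulr_ge0// ltW.
have -> : e = 8 * e' by rewrite /e'; field.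
lra.
Qed.

(** The pseudo-hyperbolic estimate for f = r g, with a = z g and b = w g, yields
    key as r tends to 1; the factor r ensures |phi f| < 1.  The radius
    (1 - rho) / (2 rho + 1) of the disc then bounds its image under g by 1. *)
Lemma same_part_disc (z w : bidual X) phi psi : rnorm z <= 1 -> rnorm w <= 1 ->
  fiber z phi -> fiber w psi -> (gleason_dist phi psi < 2%:E)%E ->
  exists2 k : R, 0 < k & forall l : C, rnorm l <= 1 -> rnorm (z + l *: (k%:C *: (w - z))) <= 1.
Proof.
move=> z1 w1 [ps pz] [qs qw] dist.
have [rho /andP[rho0 rho1] H] := pseudohyperbolic ps qs dist.
have r2 : 0 < 2 * rho + 1 by lra.
exists ((1 - rho) / (2 * rho + 1)); first by rewrite divr_gt0//; lra.
move=> l l1; rewrite rnorm_dual; apply: dual_norm_le => g.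
rewrite rnorm_le1 => g1; rewrite -rnorm_modulus.
have -> : (z + l *: (((1 - rho) / (2 * rho + 1))%:C *: (w - z))) g =
   z g + l * (((1 - rho) / (2 * rho + 1))%:C * (w g - z g)) by [].
set a := z g; set b := w g.
have a1 : rnorm a <= 1.
  by apply: le_trans (dual_bound _ _) _; rewrite mulr_ile1// ?rnorm_ge0.
have b1 : rnorm b <= 1.
  by apply: le_trans (dual_bound _ _) _; rewrite mulr_ile1// ?rnorm_ge0.
have a0 := rnorm_ge0 a; have d0 := rnorm_ge0 (b - a).
have gb c : rnorm (dual_Au g c) <= 1.
  have -> : dual_Au g c = g (val c) by [].
  apply: le_trans (dual_bound _ _) _; rewrite mulr_ile1 ?rnorm_ge0//.
  by apply: ltW; rewrite -rnorm_lt1; exact: unit_ballP.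
have key : rnorm (b - a) * (1 - rho) <= 2 * rho * (1 - rnorm a).
  apply/ler_addgt0Pr => e e0.
  pose t := Num.min 2^-1 (e / 8); have t0 : 0 < t by rewrite lt_min invr_gt0 ltr0n divr_gt0.
  have th : t <= 2^-1 by rewrite ge_min lexx.
  have te : t <= e / 8 by rewrite ge_min lexx orbT.
  pose r := 1 - t; have r0 : 0 < r by rewrite /r; lra.
  have r1 : r < 1 by rewrite /r; lra.
  have rn : rnorm (r%:C : C) = r by rewrite rnorm_pos// ltW.
  have fb c : rnorm ((r%:C *: dual_Au g) c) <= 1.
    by rewrite AuZE rnormM rn mulr_ile1 ?rnorm_ge0 ?(ltW r0) ?(ltW r1).
  have := H (r%:C *: dual_Au g) fb; rewrite (specZ ps) (specZ qs) pz qw -/a -/b.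
  rewrite (rnormM r%:C a) rn => /(_ _)/wrap[]; first by apply: le_lt_trans r1; rewrite ler_piMr// ltW.
  rewrite -mulrBr (rnormM r%:C (b - a)) rn conj_scale => h.
  have E : rnorm (1 - r%:C * conjc a * (r%:C * b)) <= 1 - (r * rnorm a) ^+ 2 + (r * rnorm a) * (r * rnorm (b - a)).
    have -> : 1 - r%:C * conjc a * (r%:C * b) =
       (1 - (r * rnorm a) ^+ 2)%:C - (r%:C * conjc a) * (r%:C * (b - a)).
      have -> : (1 - (r * rnorm a) ^+ 2)%:C = 1 - r%:C * r%:C * (a * conjc a).
        by rewrite conj_sq -!rmorphM -(rmorph1 (real_complex R)) -rmorphB exprMn expr2.
      ring.
    apply: le_trans (rnormB _ _) _; rewrite !rnormM rnormJ rn rnorm_pos// subr_ge0.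
    by rewrite exprn_ile1// ?mulr_ge0 ?mulr_ile1// ltW.
  have h2 : r * rnorm (b - a) <= rho * (1 - (r * rnorm a) ^+ 2 + (r * rnorm a) * (r * rnorm (b - a))).
    by apply: le_trans h _; rewrite ler_wpM2l.
  set A := r * rnorm a in h2.
  have A1 : A <= 1 by rewrite /A mulr_ile1// ltW.
  have A0 : 0 <= A by rewrite /A mulr_ge0// ltW.
  set D := r * rnorm (b - a) in h2.
  have D0 : 0 <= D by rewrite /D mulr_ge0// ltW.
  have h3 : rho * (1 - A ^+ 2) <= rho * (2 * (1 - A)).
    by rewrite ler_wpM2l//; have := sqr_ge0 (1 - A); rewrite expr2; rewrite expr2; lra.
  have h4 : rho * (A * D) <= rho * D by rewrite ler_wpM2l// ler_piMl.
  have h5 : D * (1 - rho) <= 2 * rho * (1 - A) by lra.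
  have h6 : rnorm (b - a) <= 2 by have := rnormB b a; lra.
  have h7 : t * (rnorm (b - a) * (1 - rho)) <= t * 2.
    by rewrite ler_pM2l//; apply: le_trans h6; rewrite ler_piMr//; lra.
  have h8 : 2 * rho * (t * rnorm a) <= 2 * t.
    have : rho * (t * rnorm a) <= 1 * t.
      by apply: ler_pM => //; [rewrite mulr_ge0// ltW|exact: ltW|rewrite ler_piMr// ltW].
    lra.
  move: h5; rewrite /D /A /r; lra.
apply: le_trans (rnormD _ _) _.
have k0 : 0 <= (1 - rho) / (2 * rho + 1) by rewrite divr_ge0//; lra.
rewrite rnormM (rnormM _%:C) rnorm_pos//.
have h1 : (1 - rho) / (2 * rho + 1) * rnorm (b - a) <= 1 - rnorm a.
  rewrite mulrAC ler_pdivrMr//; have : rnorm (b - a) * (1 - rho) <= (2 * rho + 1) * (1 - rnorm a) by lra.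
  lra.
have : rnorm l * ((1 - rho) / (2 * rho + 1) * rnorm (b - a)) <= (1 - rho) / (2 * rho + 1) * rnorm (b - a).
  by rewrite ler_piMl// mulr_ge0.
lra.
Qed.

Lemma gleason_part_refl (phi : Au X -> C) : spectrum phi -> gleason_part phi phi.
Proof.
move=> ps; split => //; apply: (@le_lt_trans _ _ 0%:E); last by rewrite lte_fin.
apply: ge_ereal_sup => _ [f _ <-]; rewrite lee_fin subrr -rnorm_modulus rnorm0//.
Qed.

Lemma complex_extreme_fiber (z w : bidual X) phi psi :
  complex_extreme (closed_unit_ball (bidual X)) z -> rnorm w <= 1 ->
  fiber z phi -> fiber w psi -> (gleason_dist phi psi < 2%:E)%E -> w = z.
Proof.
move=> [z1 zext] w1 pz qw dist.
rewrite /closed_unit_ball/= rnorm_le1 in z1.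
have [k k0 H] := same_part_disc z1 w1 pz qw dist.
have := zext (k%:C *: (w - z)) => /(_ _)/wrap[].
  by move=> l; rewrite /closed_unit_ball/= !rnorm_le1; exact: H.
move/eqP; rewrite scaler_eq0 subr_eq0 => /orP[/eqP/complexI/eqP|/eqP//].
by rewrite gt_eqF.
Qed.

End Delta.

Theorem proposition2p5 (R : realType) (X : completeNormedModType R[i])
    (z : bidual X) (z_sphere : `|z| = 1) :
  (complex_extreme (closed_unit_ball (bidual X)) z ->
     (forall w : bidual X, closed_unit_ball (bidual X) w -> w <> z ->
        gleason_part (delta z) `&` fiber w = set0) /\
     (forall (w : bidual X) (phi psi : Au X -> R[i]), `|w| = 1 -> w <> z ->
        fiber z phi -> fiber w psi -> gleason_part phi <> gleason_part psi)) /\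
  (~ complex_extreme (closed_unit_ball (bidual X)) z ->
     exists u : bidual X, [/\ u <> 0,
       (forall l : R[i], `|l| < 1 -> closed_unit_ball (bidual X) (z + l *: u)) &
       [set delta (z + l *: u) | l in [set l : R[i] | `|l| < 1]]
         `<=` gleason_part (delta z)]).
Proof.
have z1 : rnorm z <= 1 by rewrite -rnorm_le1 z_sphere.
split=> [zext|zext].
  split=> [w w1 wz|w phi psi w1 wz pz qw E].
    rewrite /closed_unit_ball/= rnorm_le1 in w1.
    rewrite -subset0 => psi [[_ dist] qw]; apply: wz.
    exact: complex_extreme_fiber zext w1 (delta_fiber z1) qw dist.
  have w1' : rnorm w <= 1 by rewrite -rnorm_le1 w1.
  have [_ dist] : gleason_part phi psi by rewrite E; apply: gleason_part_refl; case: qw.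
  exact/wz/(complex_extreme_fiber zext w1' pz qw dist).
have [u u0 zu] : exists2 u : bidual X, u <> 0 &
    forall l : R[i], rnorm l <= 1 -> rnorm (z + l *: u) <= 1.
  apply: contrapT => nu; apply: zext; split; first by rewrite /closed_unit_ball/= rnorm_le1.
  move=> y Hy; apply: contrapT => y0; apply: nu; exists y => // l l1.
  by have := Hy l; rewrite /closed_unit_ball/= !rnorm_le1; exact.
exists u; split=> // [l l1|_ [l /= l1 <-]].
  by rewrite /closed_unit_ball/= rnorm_le1; apply: zu; rewrite -rnorm_le1 ltW.
rewrite rnorm_lt1 in l1; have zl := zu l (ltW l1).
split; first exact: delta_spectrum.
apply: (@schwarz_dist _ _ _ _ (rnorm l)); [exact: delta_spectrum|exact: delta_spectrum| |].
  by rewrite rnorm_ge0.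
by move=> f f1 f0; exact: (delta_schwarz zu f1 f0 (ltW l1)).
Qed.
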